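(* Let $0<q<1$, let $\mathcal{U}=\mathcal{U}_q(su_2)$, $\mathcal{A}=\mathcal{O}(SU_q(2))$, let $h$ be the Haar state of $\mathcal{A}$ and let $\pi_h$ be the Heisenberg representation of the cross product $*$-algebra $\mathcal{U}\ltimes\mathcal{A}$. Let $\mathcal{C}$ be the closure of the operator $\pi_h(C_q)$, where $C_q\in\mathcal{U}$ is the Casimir element. For $z\in\mathbb{C}$ with $\operatorname{Re}z>1$ put $$\zeta(z)=(q^{-1}-q)^{2z-1}\sum_{n=1}^\infty n\,(q^{-n/2}-q^{n/2})^{-2z}(q^{-n}-q^n).$$ If $z\in\mathbb{C}$, $\operatorname{Re}z>1$, and $x\in\mathcal{A}$, then the closure of the operator $\mathcal{C}^{-z}\pi_h(K^{-2}x)$ is of trace class and $$h(x)=\zeta(z)^{-1}\,\mathrm{Tr}\,\overline{\mathcal{C}^{-z}\pi_h(K^{-2}x)}.$$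
   Context: Fix $0<q<1$, $\lambda=q-q^{-1}$, $[k]_q=\lambda^{-1}(q^k-q^{-k})$. $\mathcal{U}_q(su_2)$ is the Hopf $*$-algebra with generators $E,F,K,K^{-1}$ and relations $KK^{-1}=K^{-1}K=1$, $KEK^{-1}=qE$, $KFK^{-1}=q^{-1}F$, $EF-FE=\lambda^{-1}(K^2-K^{-2})$; $\Delta(E)=E\otimes K+K^{-1}\otimes E$, $\Delta(F)=F\otimes K+K^{-1}\otimes F$, $\Delta(K)=K\otimes K$; $\varepsilon(E)=\varepsilon(F)=0$, $\varepsilon(K)=1$; $S(E)=-qE$, $S(F)=-q^{-1}F$, $S(K)=K^{-1}$; $E^*=F$, $K^*=K$. Its Casimir element is $C_q=EF+\lambda^{-2}(q^{-1}K^2+qK^{-2}-2)$. $\mathcal{O}(SU_q(2))$ is the unital $*$-algebra with generators $a,b,c,d$, relations $ab=qba$, $ac=qca$, $bd=qdb$, $cd=qdc$, $bc=cb$, $ad-da=\lambda bc$, $ad-qbc=1$, and involution $a^*=d$, $b^*=-qc$. $\mathcal{A}=\mathcal{O}(SU_q(2))$ is a right $\mathcal{U}$-module $*$-algebra: the right action $\triangleleft$ satisfies $(xy)\triangleleft f=(x\triangleleft f_{(1)})(y\triangleleft f_{(2)})$ and $1\triangleleft f=\varepsilon(f)1$, and is determined by $a\triangleleft E=b\triangleleft E=0$, $c\triangleleft E=a$, $d\triangleleft E=b$; $a\triangleleft F=c$, $b\triangleleft F=d$, $c\triangleleft F=d\triangleleft F=0$; $a\triangleleft K=q^{-1/2}a$,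 $b\triangleleft K=q^{-1/2}b$, $c\triangleleft K=q^{1/2}c$, $d\triangleleft K=q^{1/2}d$. The right cross product $*$-algebra $\mathcal{U}\ltimes\mathcal{A}$ is the vector space $\mathcal{U}\otimes\mathcal{A}$ with product $(g\otimes x)(f\otimes y)=gf_{(1)}\otimes(x\triangleleft f_{(2)})y$ and involution $(f\otimes x)^*=f^*_{(1)}\otimes(x^*\triangleleft f^*_{(2)})$; it is generated by its $*$-subalgebras $\mathcal{U}$, $\mathcal{A}$ with cross relations $xf=f_{(1)}(x\triangleleft f_{(2)})$. The Haar state $h$ is the unique linear functional on $\mathcal{A}$ with $h(1)=1$ and $h(x\triangleleft f)=\varepsilon(f)h(x)$ for all $x\in\mathcal{A}$, $f\in\mathcal{U}$; explicitly $h(a^rb^kc^l)=h(d^rb^kc^l)=\delta_{r0}\delta_{kl}(-1)^k[k+1]_q^{-1}$. A $*$-representation of a $*$-algebra $\mathcal{X}$ on a dense linear subspace $\mathcal{D}$ of a Hilbert space is a homomorphism $\pi$ into the algebra of linear operators mapping $\mathcal{D}$ into itself with $\langle\pi(x)\eta,\xi\rangle=\langle\eta,\pi(x^* )\xi\rangle$; its closure is $x\mapsto\overline{\pi(x)}$ restricted to $\bigcap_x\mathcal{D}(\overline{\pi(x)})$. Let $\pi_h$ be the GNS representation of $h$ on $\mathcal{D}_h=\pi_h(\mathcal{A})v_h$, with cyclic vector $v_h$, $h(x)=\langle\pi_h(x)v_h,v_h\rangle$. There is a well-defined $*$-representation $\tilde\pi_h$ of $\mathcal{U}\ltimes\mathcal{A}$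 on $\mathcal{D}_h$ with $\tilde\pi_h(x)=\pi_h(x)$ for $x\in\mathcal{A}$ and $\tilde\pi_h(f)\pi_h(x)v_h=\pi_h(x\triangleleft S^{-1}(f))v_h$ for $f\in\mathcal{U}$. Its closure, again denoted $\pi_h$, is the Heisenberg representation of $\mathcal{U}\ltimes\mathcal{A}$. The operator $\mathcal{C}=\overline{\pi_h(C_q)}$ is a strictly positive self-adjoint operator (its eigenvalues are $[l+\frac12]_q^2$, $l\in\frac12\mathbb{N}_0$), and $\mathcal{C}^{-z}$ is defined by the functional calculus. An overline on an operator denotes its closure.
   Formalization: Since ζ(z) can vanish for some z with Re z > 1 (for instance when q is transcendental), the formula h(x) = ζ(z)^{-1} Tr is asserted when ζ(z) ≠ 0; for every z with Re z > 1 it is proved that the trace equals ζ(z) h(x). *)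

(* Defs.v *)
From HB Require Import structures.
From mathcomp Require Import all_boot all_order all_algebra.
From mathcomp Require Import all_classical all_reals all_analysis.
From mathcomp Require Import complex.

Set Implicit Arguments.
Unset Strict Implicit.
Unset Printing Implicit Defensive.

Import Order.TTheory GRing.Theory Num.Theory.
Import numFieldNormedType.Exports.

Local Open Scope classical_set_scope.
Local Open Scope quotient_scope.
Local Open Scope complex_scope.
Local Open Scope ring_scope.

(* Limits are taken for the topology of the modulus, which the library attaches
   to an arbitrary [numFieldType]; these are instantiated with [K := R[i]]. *)
Definition has_sum (K : numFieldType) (u : nat -> K) (l : K) : Prop :=
  series u @ \oo --> l.

Definition sum_from1 (K : numFieldType) (u : nat -> K) : K :=
  limn (fun N => \sum_(1 <= n < N) u n).

Section Tensor.
Variables (K : fieldType) (U V : lmodType K).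
Implicit Types s t : seq (U * V).

Definition tsum (W : lmodType K) (b : U -> V -> W) s : W :=
  \sum_(p <- s) b p.1 p.2.

(* A list of pairs [(u_i, v_i)] stands for the sum of the [u_i (x) v_i]; two
   lists are identified when no bilinear map tells them apart. *)
Definition teq s t : bool :=
  `[< forall (W : lmodType K) (b : {bilinear U -> V -> W}),
        tsum b s = tsum b t >].

Lemma teqP s t :
  reflect (forall (W : lmodType K) (b : {bilinear U -> V -> W}),
             tsum b s = tsum b t) (teq s t).
Proof. exact: asboolP. Qed.

Lemma teq_refl : reflexive teq.
Proof. by move=> s; apply/teqP. Qed.

Lemma teq_sym : symmetric teq.
Proof. by move=> s t; apply/teqP/teqP => st W b; rewrite st. Qed.

Lemma teq_trans : transitive teq.
Proof. by move=> s t u /teqP ts /teqP su; apply/teqP => W b; rewrite ts su. Qed.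

Canonical teq_equiv := EquivRel teq teq_refl teq_sym teq_trans.

Definition tensor := {eq_quot teq}.
HB.instance Definition _ := Choice.on tensor.

Implicit Types x y z : tensor.

Definition tpi s : tensor := \pi s.
Definition tlift (W : lmodType K) (b : U -> V -> W) x : W := tsum b (repr x).
Definition tens (u : U) (v : V) : tensor := tpi [:: (u, v)].

Lemma tlift_pi (W : lmodType K) (b : {bilinear U -> V -> W}) s :
  tlift b (tpi s) = tsum b s.
Proof.
rewrite /tlift /tpi; have /eqmodP/teqP -> // : repr (\pi_tensor s) = s %[mod tensor].
by rewrite reprK.
Qed.

Lemma tensor_ext x y :
  (forall (W : lmodType K) (b : {bilinear U -> V -> W}), tlift b x = tlift b y)
  -> x = y.
Proof. by move=> xy; rewrite -[x]reprK -[y]reprK; apply/eqmodP/teqP. Qed.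

Definition tadd x y := tpi (repr x ++ repr y).
Definition tscale (c : K) x := tpi [seq (c *: p.1, p.2) | p <- repr x].
Definition topp x := tscale (-1) x.
Definition tzero := tpi [::].

Section Lift.
Variables (W : lmodType K) (b : {bilinear U -> V -> W}).

Lemma tlift_tens u v : tlift b (tens u v) = b u v.
Proof. by rewrite tlift_pi /tsum big_seq1. Qed.

Lemma tlift_add x y : tlift b (tadd x y) = tlift b x + tlift b y.
Proof. by rewrite tlift_pi /tsum big_cat. Qed.

Lemma tlift_scale c x : tlift b (tscale c x) = c *: tlift b x.
Proof.
rewrite tlift_pi /tsum big_map scaler_sumr.
by apply: eq_bigr => p _; rewrite linearZl_LR.
Qed.

Lemma tlift_zero : tlift b tzero = 0.
Proof. by rewrite tlift_pi /tsum big_nil. Qed.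

Lemma tlift_opp x : tlift b (topp x) = - tlift b x.
Proof. by rewrite tlift_scale scaleN1r. Qed.

End Lift.

Lemma taddA : associative tadd.
Proof. by move=> x y z; apply: tensor_ext => W b; rewrite !tlift_add addrA. Qed.
Lemma taddC : commutative tadd.
Proof. by move=> x y; apply: tensor_ext => W b; rewrite !tlift_add addrC. Qed.
Lemma tadd0 : left_id tzero tadd.
Proof.
by move=> x; apply: tensor_ext => W b; rewrite tlift_add tlift_zero add0r.
Qed.
Lemma taddN : left_inverse tzero topp tadd.
Proof.
move=> x; apply: tensor_ext => W b.
by rewrite tlift_add tlift_opp tlift_zero addNr.
Qed.

HB.instance Definition _ := GRing.isZmodule.Build tensor taddA taddC tadd0 taddN.

Lemma tscaleA c d x : tscale c (tscale d x) = tscale (c * d) x.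
Proof. by apply: tensor_ext => W b; rewrite !tlift_scale scalerA. Qed.
Lemma tscale1 : left_id 1 tscale.
Proof. by move=> x; apply: tensor_ext => W b; rewrite tlift_scale scale1r. Qed.
Lemma tscaleDr : right_distributive tscale +%R.
Proof.
move=> c x y; apply: tensor_ext => W b.
by rewrite tlift_scale !tlift_add !tlift_scale scalerDr.
Qed.
Lemma tscaleDl x : {morph tscale^~ x : c d / c + d}.
Proof.
move=> c d; apply: tensor_ext => W b.
by rewrite tlift_scale tlift_add !tlift_scale scalerDl.
Qed.

HB.instance Definition _ :=
  GRing.Zmodule_isLmodule.Build K tensor tscaleA tscale1 tscaleDr tscaleDl.

End Tensor.

(* Sweedler notation: the image of t under the map induced by F, a function of
   the legs f1 (x) f2. It does not depend on the representative of t when F is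
   bilinear, or conjugate-linear in both variables as in [comul_star]. *)
Reserved Notation "\sw_ ( f1 , f2 <- t ) F"
  (at level 41, F at level 41, f1 name, f2 name,
   format "'[' \sw_ ( f1 ,  f2  <-  t ) '/  '  F ']'").
Notation "\sw_ ( f1 , f2 <- t ) F" :=
  (tlift (fun f1 f2 => F) t) : ring_scope.
Reserved Notation "u ⊗ v" (at level 40, left associativity).
Notation "u ⊗ v" := (tens u v) : ring_scope.

Record starAlgType (R : realType) := StarAlgType {
  starAlg_sort :> algType R[i];
  star : starAlg_sort -> starAlg_sort;
  starD : forall x y, star (x + y) = star x + star y;
  starZ : forall (c : R[i]) x, star (c *: x) = c^* *: star x;
  starM : forall x y, star (x * y) = star y * star x;
  starK : involutive star
}.

Record hopfStar (R : realType) (U : starAlgType R) := HopfStar {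
  comul : {linear U -> tensor U U};
  counit : {lrmorphism U -> R[i]};
  antipode : {linear U -> U};
  antipodeI : U -> U;
  comul1 : comul 1 = 1 ⊗ 1;
  comulM : forall f g, comul (f * g) =
    \sw_(f1, f2 <- comul f) \sw_(g1, g2 <- comul g) ((f1 * g1) ⊗ (f2 * g2));
  comulA : forall f,
    \sw_(f1, f2 <- comul f) \sw_(f11, f12 <- comul f1) (f11 ⊗ (f12 ⊗ f2)) =
    \sw_(f1, f2 <- comul f) (f1 ⊗ comul f2);
  counitl : forall f, \sw_(f1, f2 <- comul f) (counit f1 *: f2) = f;
  counitr : forall f, \sw_(f1, f2 <- comul f) (counit f2 *: f1) = f;
  antipodel : forall f,
    \sw_(f1, f2 <- comul f) (antipode f1 * f2) = counit f *: 1;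
  antipoder : forall f,
    \sw_(f1, f2 <- comul f) (f1 * antipode f2) = counit f *: 1;
  antipodeK : cancel antipode antipodeI;
  antipodeIK : cancel antipodeI antipode;
  comul_star : forall f,
    comul (star f) = \sw_(f1, f2 <- comul f) (star f1 ⊗ star f2);
  counit_star : forall f, counit (star f) = (counit f)^*
}.

Record modStarAlg (R : realType) (U : starAlgType R) (HU : hopfStar U)
    (A : starAlgType R) := ModStarAlg {
  act : {bilinear A -> U -> A};
  act1 : forall x, act x 1 = x;
  actM : forall x f g, act x (f * g) = act (act x f) g;
  act_unit : forall f, act 1 f = counit HU f *: 1;
  act_mul : forall x y f,
    act (x * y) f = \sw_(f1, f2 <- comul HU f) (act x f1 * act y f2);
  act_star : forall x f, star (act x f) = act (star x) (star (antipode HU f))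
}.

(* The cross product is a star-algebra together with a linear isomorphism
   [cross] from U (x) A onto it. *)
Record crossProduct (R : realType) (U : starAlgType R) (HU : hopfStar U)
    (A : starAlgType R) (a : modStarAlg HU A) := CrossProduct {
  cross_sort :> starAlgType R;
  cross : {linear tensor U A -> cross_sort};
  cross_bij : bijective cross;
  cross1 : cross (1 ⊗ 1) = 1;
  crossM : forall g x f y, cross (g ⊗ x) * cross (f ⊗ y) =
    cross (\sw_(f1, f2 <- comul HU f) ((g * f1) ⊗ (act a x f2 * y)));
  cross_star : forall f x, star (cross (f ⊗ x)) =
    cross (\sw_(f1, f2 <- comul HU (star f)) (f1 ⊗ act a (star x) f2))
}.

Section CrossEmbeddings.
Variables (R : realType) (U : starAlgType R) (HU : hopfStar U).
Variables (A : starAlgType R) (a : modStarAlg HU A) (X : crossProduct a).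

Definition inU (f : U) : X := cross X (f ⊗ 1).
Definition inA (x : A) : X := cross X (1 ⊗ x).

End CrossEmbeddings.

Section QuantumSU2.
Variables (R : realType) (q : R).

Definition lam : R[i] := (q - q^-1)%:C.

Definition uq_rels (B : algType R[i]) (E F K Ki : B) : Prop :=
  [/\ K * Ki = 1, Ki * K = 1, K * E * Ki = q%:C *: E, K * F * Ki = q^-1%:C *: F
    & E * F - F * E = lam^-1 *: (K ^+ 2 - Ki ^+ 2)].

Definition oq_rels (B : algType R[i]) (a b c d : B) : Prop :=
  [/\ a * b = q%:C *: (b * a), a * c = q%:C *: (c * a),
      b * d = q%:C *: (d * b) & c * d = q%:C *: (d * c)] /\
  [/\ b * c = c * b, a * d - d * a = lam *: (b * c)
    & a * d - q%:C *: (b * c) = 1].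

(* "Generated by ... with relations ..." is the universal property
   [uq_univ], [oq_univ] among unital algebras. *)
Record uqSU2 := UqSU2 {
  uq_alg :> starAlgType R;
  uq_hopf : hopfStar uq_alg;
  uqE : uq_alg; uqF : uq_alg; uqK : uq_alg; uqKi : uq_alg;
  uqP : uq_rels uqE uqF uqK uqKi;
  uq_univ : forall (B : algType R[i]) (E F K Ki : B), uq_rels E F K Ki ->
    exists phi : {lrmorphism uq_alg -> B},
      [/\ phi uqE = E, phi uqF = F, phi uqK = K & phi uqKi = Ki] /\
      forall psi : {lrmorphism uq_alg -> B},
        [/\ psi uqE = E, psi uqF = F, psi uqK = K & psi uqKi = Ki] ->
        psi =1 phi;
  uq_comul : [/\ comul uq_hopf uqE = uqE ⊗ uqK + uqKi ⊗ uqE,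
                 comul uq_hopf uqF = uqF ⊗ uqK + uqKi ⊗ uqF
               & comul uq_hopf uqK = uqK ⊗ uqK];
  uq_counit : [/\ counit uq_hopf uqE = 0, counit uq_hopf uqF = 0
                & counit uq_hopf uqK = 1];
  uq_antipode : [/\ antipode uq_hopf uqE = - q%:C *: uqE,
                    antipode uq_hopf uqF = - q^-1%:C *: uqF
                  & antipode uq_hopf uqK = uqKi];
  uq_star : star uqE = uqF /\ star uqK = uqK
}.

Definition casimir (U : uqSU2) : U :=
  uqE U * uqF U
  + lam ^- 2 *: (q^-1%:C *: uqK U ^+ 2 + q%:C *: uqKi U ^+ 2 - 2%:R).

Record oqSU2 := OqSU2 {
  oq_alg :> starAlgType R;
  oqa : oq_alg; oqb : oq_alg; oqc : oq_alg; oqd : oq_alg;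
  oqP : oq_rels oqa oqb oqc oqd;
  oq_univ : forall (B : algType R[i]) (a b c d : B), oq_rels a b c d ->
    exists phi : {lrmorphism oq_alg -> B},
      [/\ phi oqa = a, phi oqb = b, phi oqc = c & phi oqd = d] /\
      forall psi : {lrmorphism oq_alg -> B},
        [/\ psi oqa = a, psi oqb = b, psi oqc = c & psi oqd = d] ->
        psi =1 phi;
  oq_star : star oqa = oqd /\ star oqb = - q%:C *: oqc
}.

Record is_suq2_action (U : uqSU2) (A : oqSU2) (m : modStarAlg (uq_hopf U) A)
    : Prop := {
  actE : [/\ act m (oqa A) (uqE U) = 0, act m (oqb A) (uqE U) = 0,
             act m (oqc A) (uqE U) = oqa A & act m (oqd A) (uqE U) = oqb A];
  actF : [/\ act m (oqa A) (uqF U) = oqc A, act m (oqb A) (uqF U) = oqd A,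
             act m (oqc A) (uqF U) = 0 & act m (oqd A) (uqF U) = 0];
  actK : [/\ act m (oqa A) (uqK U) = (q `^ (- 2^-1))%:C *: oqa A,
             act m (oqb A) (uqK U) = (q `^ (- 2^-1))%:C *: oqb A,
             act m (oqc A) (uqK U) = (q `^ 2^-1)%:C *: oqc A
           & act m (oqd A) (uqK U) = (q `^ 2^-1)%:C *: oqd A]
}.

End QuantumSU2.

Definition is_haar (R : realType) (U : starAlgType R) (HU : hopfStar U)
    (A : starAlgType R) (m : modStarAlg HU A) (h : {linear A -> R[i]}) : Prop :=
  h 1 = 1 /\ forall x f, h (act m x f) = counit HU f * h x.

(* The inner product is linear in the first variable. *)
Record hilbertType (R : realType) := HilbertType {
  hilbert_sort :> completeNormedModType R[i];
  dot : {dot hilbert_sort for Num.conj};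
  dot_norm : forall u : hilbert_sort, dot u u = `|u| ^+ 2
}.

(* A possibly unbounded operator is given by its graph, so that [closure] is
   the closure of operators. *)
Section Operators.
Variables (R : realType) (H : hilbertType R).
Implicit Types (S T : set (H * H)) (u v w : H).

(* [op_comp S T] is S after T, on its natural domain. *)
Definition op_comp S T : set (H * H) :=
  [set p | exists w, T (p.1, w) /\ S (w, p.2)].

Definition graph_of (f : H -> H) : set (H * H) := [set p | p.2 = f p.1].

(* Projection-valued measures on the line; [sm_meas v] is B |-> <E(B) v, v>. *)
Record spectralMeasure := SpectralMeasure {
  sm_proj : set R -> {linear H -> H};
  sm_idem : forall B, measurable B ->
    forall v, sm_proj B (sm_proj B v) = sm_proj B v;
  sm_sym : forall B, measurable B ->
    forall u v, dot H (sm_proj B u) v = dot H u (sm_proj B v);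
  sm_total : forall v, sm_proj setT v = v;
  sm_meas : H -> {measure set (measurableTypeR R) -> \bar R};
  sm_measE : forall v B, measurable B ->
    sm_meas v B = (complex.Re (dot H (sm_proj B v) v))%:E
}.

Definition cintegral (mu : {measure set (measurableTypeR R) -> \bar R})
    (f : R -> R[i]) : R[i] :=
  (\int[mu]_(x in setT) complex.Re (f x))%R
  +i* (\int[mu]_(x in setT) complex.Im (f x))%R.

Definition sm_dom (E : spectralMeasure) (f : R -> R[i]) : set H :=
  [set v | (\int[sm_meas E v]_(x in setT)
              ((complex.Re (f x)) ^+ 2 + (complex.Im (f x)) ^+ 2)%:E < +oo)%E].

(* The operator f(E), the integral of f against E. On its domain it is
   determined by <f(E) v, u>, the integral of f against the complex measure
   <E(.) v, u>, which is obtained from the positive ones by polarization. *)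
Definition sm_integral (E : spectralMeasure) (f : R -> R[i]) : set (H * H) :=
  [set p | sm_dom E f p.1 /\ forall u, sm_dom E f u ->
     dot H p.2 u =
       4%:R^-1 * \sum_(k < 4)
         'i ^+ k * cintegral (sm_meas E (p.1 + 'i ^+ k *: u)) f].

Definition is_spectral_measure_of (E : spectralMeasure) T : Prop :=
  sm_integral E (fun x => x%:C) = T.

(* The functional calculus f(T) of a self-adjoint T, whose spectral measure
   exists and is unique by the spectral theorem; empty if there is none. *)
Definition fun_calc T (f : R -> R[i]) : set (H * H) :=
  [set p | exists2 E, is_spectral_measure_of E T & sm_integral E f p].

Definition orthonormal_basis (e : nat -> H) : Prop :=
  (forall i j, dot H (e i) (e j) = (i == j)%:R) /\
  (forall v, (forall i, dot H v (e i) = 0) -> v = 0).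

(* [P] is the modulus |t|, the positive square root of t^* t. *)
Definition is_modulus (t P : {linear H -> H}) : Prop :=
  [/\ continuous P, forall v, 0 <= dot H (P v) v
    & forall u v, dot H (P (P u)) v = dot H (t u) (t v)].

(* T is an everywhere defined bounded operator with Tr |T| finite. Orthonormal
   bases are sequences, so this is meant for H separable and infinite
   dimensional. *)
Definition trace_class T : Prop :=
  exists t : {linear H -> H}, [/\ T = graph_of t, continuous t &
    exists P : {linear H -> H}, is_modulus t P /\
      exists2 e, orthonormal_basis e
               & exists s, has_sum (fun n => dot H (P (e n)) (e n)) s].

Definition is_trace T (r : R[i]) : Prop :=
  exists2 t : H -> H, T = graph_of t &
    forall e, orthonormal_basis e ->
      has_sum (fun n => dot H (t (e n)) (e n)) r.

End Operators.

Record starRep (R : realType) (X : starAlgType R) (H : hilbertType R) :=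
StarRep {
  rep_dom : set H;
  rep : X -> H -> H;
  rep_dom0 : rep_dom 0;
  rep_domD : forall (c : R[i]) u v,
    rep_dom u -> rep_dom v -> rep_dom (c *: u + v);
  rep_dense : dense rep_dom;
  rep_stable : forall x u, rep_dom u -> rep_dom (rep x u);
  rep_linear : forall x (c : R[i]) u v, rep_dom u -> rep_dom v ->
    rep x (c *: u + v) = c *: rep x u + rep x v;
  rep_linearl : forall (c : R[i]) x y u, rep_dom u ->
    rep (c *: x + y) u = c *: rep x u + rep y u;
  repM : forall x y u, rep_dom u -> rep (x * y) u = rep x (rep y u);
  rep1 : forall u, rep_dom u -> rep 1 u = u;
  rep_adj : forall x u v, rep_dom u -> rep_dom v ->
    dot H (rep x u) v = dot H u (rep (star x) v)
}.

Section Representations.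
Variables (R : realType) (X : starAlgType R) (H : hilbertType R).
Variable pi : starRep X H.

Definition rep_op (x : X) : set (H * H) :=
  [set p | rep_dom pi p.1 /\ p.2 = rep pi x p.1].

(* The closure of the representation [pi]. *)
Definition clos_dom : set H :=
  [set u | forall x, exists w, closure (rep_op x) (u, w)].
Definition clos_op (x : X) : set (H * H) :=
  [set p | clos_dom p.1 /\ closure (rep_op x) p].

(* [pi] with cyclic vector [v] is the GNS representation of [h], on the domain
   [pi(X) v]. *)
Definition is_gns (h : {linear X -> R[i]}) (v : H) : Prop :=
  [/\ rep_dom pi v, rep_dom pi = [set rep pi x v | x in setT]
    & forall x, h x = dot H (rep pi x v) v].

End Representations.

(* The representation of the cross product on the GNS domain; the Heisenberg
   representation is its closure. *)
Definition is_heisenberg (R : realType) (U : starAlgType R) (HU : hopfStar U)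
    (A : starAlgType R) (m : modStarAlg HU A) (X : crossProduct m)
    (H : hilbertType R) (pi_h : starRep A H) (v_h : H) (pi_t : starRep X H)
    : Prop :=
  [/\ rep_dom pi_t = rep_dom pi_h,
      forall x u, rep_dom pi_h u -> rep pi_t (inA X x) u = rep pi_h x u
    & forall f x, rep pi_t (inU X f) (rep pi_h x v_h) =
        rep pi_h (act m x (antipodeI HU f)) v_h].

Section Zeta.
Variable R : realType.

(* t ^ w = exp (w log t) for t > 0. *)
Definition cpow (t : R) (w : R[i]) : R[i] :=
  (expR (complex.Re w * ln t))%:C *
  (cos (complex.Im w * ln t) +i* sin (complex.Im w * ln t)).

Definition zeta (q : R) (z : R[i]) : R[i] :=
  cpow (q^-1 - q) (2%:R * z - 1) *
  sum_from1 (fun n =>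
    n%:R * cpow (q `^ (- (n%:R / 2)) - q `^ (n%:R / 2)) (- (2%:R * z))
    * (q ^- n - q ^+ n)%:C).

End Zeta.

(* Main.v *)
(* The matrix coefficients a^i b^(n-i) are highest weight vectors for the action
   of U_q(su_2); after orthonormalization in each degree n, their images under
   powers of F form an orthonormal basis of H on which the Casimir operator is
   diagonal, with eigenvalue [(n+1)/2]_q^2 of multiplicity (n+1)^2, and so is
   K^-2. Hence the operator of the theorem is v |-> sum_p d_p <v, x^* e_p> e_p
   with a summable sequence d_p, which is trace class with trace
   sum_p d_p <x e_p, e_p>. On one string of length n+1, the functional
   x |-> sum_k t_k^2 <x f_k, f_k>, where K^-1 f_k = t_k f_k, is a quantum trace:
   it is invariant under the action, so by uniqueness of the Haar state it equals
   h(x) times its value at 1. What is left is the sum over n, which is zeta(z). *)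
Require Import Defs.
From HB Require Import structures.
From mathcomp Require Import all_boot all_order all_algebra.
From mathcomp Require Import all_classical all_reals all_analysis.
From mathcomp Require Import complex.
From mathcomp Require Import ring lra zify measurable_realfun.

Import Order.TTheory GRing.Theory Num.Theory.
Import numFieldNormedType.Exports.

Local Open Scope classical_set_scope.
Local Open Scope complex_scope.
Local Open Scope ring_scope.

Set Implicit Arguments.
Unset Strict Implicit.
Unset Printing Implicit Defensive.

Local Notation Re := complex.Re.
Local Notation Im := complex.Im.
Local Notation "<| u , v |>" := (dot _ u v) (at level 0, format "<| u ,  v |>").

(** * Induction on the generators *)

Section Subalgebra.
Variables (K : comNzRingType) (A : algType K) (S : subalgClosed A).

Record subalg := Subalg { subalg_val : A; _ : subalg_val \in S }.
HB.instance Definition _ := [isSub for subalg_val].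
HB.instance Definition _ := [Choice of subalg by <:].
HB.instance Definition _ := [SubChoice_isSubAlgebra of subalg by <:].

Definition subalg_incl : subalg -> A := subalg_val.

Lemma subalg_incl_linear : linear subalg_incl.
Proof. by []. Qed.

Lemma subalg_incl_monoid : monoid_morphism subalg_incl.
Proof. by []. Qed.

HB.instance Definition _ :=
  GRing.isLinear.Build K subalg A _ subalg_incl subalg_incl_linear.
HB.instance Definition _ :=
  GRing.isMonoidMorphism.Build subalg A subalg_incl subalg_incl_monoid.

End Subalgebra.

Section Generation.
Variables (R : realType) (q : R) (A : oqSU2 q) (P : A -> Prop).
Hypothesis P1 : P 1.
Hypothesis PZ : forall (c : R[i]) x y, P x -> P y -> P (c *: x + y).
Hypothesis PM : forall x y, P x -> P y -> P (x * y).

Definition gen_pred : {pred A} := fun x => `[< P x >].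

Lemma gen_pred_subproof : GRing.subalg_closed gen_pred.
Proof.
split.
- exact/asboolP.
- by move=> c x y /asboolP Px /asboolP Py; apply/asboolP/PZ.
- by move=> x y /asboolP Px /asboolP Py; apply/asboolP/PM.
Qed.

HB.instance Definition _ :=
  GRing.isSubalgClosed.Build R[i] A gen_pred gen_pred_subproof.

Let B := subalg (gen_pred : subalgClosed A).

Lemma oq_gen_ind : P (oqa A) -> P (oqb A) -> P (oqc A) -> P (oqd A) ->
  forall x, P x.
Proof.
have sP y : P y -> y \in (gen_pred : subalgClosed A) by move=> Py; apply/asboolP.
move=> /sP Pa /sP Pb /sP Pc /sP Pd x.
have [[h1 h2 h3 h4] [h5 h6 h7]] := oqP A.
have rels : oq_rels q (Subalg Pa : B) (Subalg Pb : B) (Subalg Pc : B) (Subalg Pd : B).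
  split; split; apply: val_inj;
  by rewrite ?(rmorphB, linearZ) /= ?rmorphM ?linearZ /= ?rmorphM /= ?scalerN.
have [phi [[ha hb hc hd] _]] := oq_univ A rels.
have [psi [_ uni]] := oq_univ A (oqP A).
pose incl : {lrmorphism A -> A} := @subalg_incl _ _ gen_pred \o phi.
have e1 : incl =1 psi by apply: uni; rewrite /incl /= ha hb hc hd.
have e2 : (idfun : A -> A) =1 psi by exact: (uni idfun).
have -> : x = subalg_incl (phi x) by rewrite -[LHS]/(idfun x) e2 -e1.
exact/asboolP/(valP (phi x : B)).
Qed.

End Generation.

(** * The action on the coordinate algebra *)

Section ActionBasics.
Variables (R : realType) (q : R).
Hypotheses (hq0 : 0 < q) (hq1 : q < 1).
Variables (U : uqSU2 q) (A : oqSU2 q) (m : modStarAlg (uq_hopf U) A).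
Hypothesis hm : is_suq2_action m.

Let s : R[i] := (q `^ 2^-1)%:C.

Lemma sqrtq_gt0 : 0 < s. Proof. by rewrite ltcR powR_gt0. Qed.

Lemma sqrtq_sqr : s ^+ 2 = q%:C.
Proof.
by rewrite /s -rmorphXn /= -powR_mulrn ?powR_ge0// -powRrM mulVf ?powRr1 ?ltW.
Qed.

Lemma sqrtqV : (q `^ (- 2^-1))%:C = s^-1.
Proof. by rewrite powRN fmorphV. Qed.

Let s0 : s != 0. Proof. by rewrite gt_eqF ?sqrtq_gt0. Qed.
Let q0 : q%:C != 0 :> R[i]. Proof. by rewrite -sqrtq_sqr expf_neq0. Qed.

Section Coproduct.
Variables x y : A.

Definition act2 (f g : U) : A := act m x f * act m y g.

Lemma act2_bilinear : bilinear_for *:%R *:%R act2.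
Proof.
split=> [u c v w|u c v w]; rewrite /act2.
  by rewrite linearP /= mulrDl scalerAl.
by rewrite linearP /= mulrDr scalerAr.
Qed.

HB.instance Definition _ :=
  bilinear_isBilinear.Build R[i] U U A *:%R *:%R act2 act2_bilinear.

Lemma act_mulE f : act m (x * y) f = tlift act2 (comul (uq_hopf U) f).
Proof. by rewrite act_mul. Qed.

End Coproduct.

Local Notation E x := (act m x (uqE U)).
Local Notation F x := (act m x (uqF U)).
Local Notation K x := (act m x (uqK U)).
Local Notation Ki x := (act m x (uqKi U)).
Local Notation a := (oqa A).
Local Notation b := (oqb A).
Local Notation c := (oqc A).
Local Notation d := (oqd A).

Lemma actE_mul x y : E (x * y) = E x * K y + Ki x * E y.
Proof. have [h _ _] := uq_comul U; rewrite act_mulE h tlift_add.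
by congr (_ + _); exact: tlift_tens. Qed.

Lemma actF_mul x y : F (x * y) = F x * K y + Ki x * F y.
Proof. have [_ h _] := uq_comul U; rewrite act_mulE h tlift_add.
by congr (_ + _); exact: tlift_tens. Qed.

Lemma actK_mul x y : K (x * y) = K x * K y.
Proof. by have [_ _ h] := uq_comul U; rewrite act_mulE h !tlift_tens. Qed.

Lemma actKK x : Ki (K x) = x.
Proof. by have [h _ _ _ _] := uqP U; rewrite -actM h act1. Qed.

Lemma actKiK x : K (Ki x) = x.
Proof. by have [_ h _ _ _] := uqP U; rewrite -actM h act1. Qed.

Lemma act1E : E 1 = 0.
Proof. by have [h _ _] := uq_counit U; rewrite act_unit h scale0r. Qed.

Lemma act1F : F 1 = 0.
Proof. by have [_ h _] := uq_counit U; rewrite act_unit h scale0r. Qed.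

Lemma act1K : K 1 = 1.
Proof. by have [_ _ h] := uq_counit U; rewrite act_unit h scale1r. Qed.

Lemma actKi_of_K (r : R[i]) x : r != 0 -> K x = r *: x -> Ki x = r^-1 *: x.
Proof.
move=> r0 h; rewrite -[in LHS](scale1r x) -(mulVf r0) -scalerA -h.
by rewrite linearZl_LR /= actKK.
Qed.

Lemma actFK x : K (F x) = q%:C *: F (K x).
Proof.
have [_ hKi _ h _] := uqP U.
have e : uqK U * uqF U = q^-1%:C *: (uqF U * uqK U).
  by rewrite scalerAl -h -!mulrA hKi mulr1.
by rewrite -!actM e linearZr_LR /= scalerA -rmorphM /= divff ?scale1r// gt_eqF.
Qed.

Lemma actK_gen : [/\ K a = s^-1 *: a, K b = s^-1 *: b, K c = s *: c & K d = s *: d].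
Proof. by have [h1 h2 h3 h4] := actK hm; rewrite h1 h2 h3 h4 sqrtqV. Qed.

Lemma actKi_gen :
  [/\ Ki a = s *: a, Ki b = s *: b, Ki c = s^-1 *: c & Ki d = s^-1 *: d].
Proof.
have [h1 h2 h3 h4] := actK_gen.
split; [rewrite (actKi_of_K _ h1) | rewrite (actKi_of_K _ h2)
  | rewrite (actKi_of_K _ h3) | rewrite (actKi_of_K _ h4)];
  by rewrite ?invrK ?invr_eq0.
Qed.

Definition hw i j : A := a ^+ i * b ^+ j.

Lemma hwS i j : hw i.+1 j = a * hw i j.
Proof. by rewrite /hw exprS mulrA. Qed.

Lemma hw0S j : hw 0 j.+1 = b * hw 0 j.
Proof. by rewrite /hw !mul1r exprS. Qed.

Lemma actK_hw i j : K (hw i j) = s ^- (i + j) *: hw i j.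
Proof.
have [h1 h2 _ _] := actK_gen.
elim: i => [|i IH].
  elim: j => [|j IH]; first by rewrite /hw mulr1 act1K invr1 scale1r.
  rewrite hw0S actK_mul IH h2 -scalerAl -scalerAr scalerA.
  by rewrite !add0n exprS invfM.
by rewrite hwS actK_mul IH h1 -scalerAl -scalerAr scalerA addSn exprS invfM.
Qed.

Lemma actE_hw i j : E (hw i j) = 0.
Proof.
have [h1 h2 _ _] := actE hm.
elim: i => [|i IH].
  elim: j => [|j IH]; first by rewrite /hw mulr1 act1E.
  by rewrite hw0S actE_mul IH h2 mul0r mulr0 addr0.
by rewrite hwS actE_mul IH h1 mul0r mulr0 addr0.
Qed.

Lemma actF_a x : F (a * x) = c * K x + s *: (a * F x).
Proof.
have [h _ _ _] := actF hm; have [h' _ _ _] := actKi_gen.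
by rewrite actF_mul h h' -scalerAl.
Qed.

Lemma actF_b x : F (b * x) = d * K x + s *: (b * F x).
Proof.
have [_ h _ _] := actF hm; have [_ h' _ _] := actKi_gen.
by rewrite actF_mul h h' -scalerAl.
Qed.

Lemma actF_c x : F (c * x) = s^-1 *: (c * F x).
Proof.
have [_ _ h _] := actF hm; have [_ _ h' _] := actKi_gen.
by rewrite actF_mul h h' mul0r add0r -scalerAl.
Qed.

Lemma actF_d x : F (d * x) = s^-1 *: (d * F x).
Proof.
have [_ _ _ h] := actF hm; have [_ _ _ h'] := actKi_gen.
by rewrite actF_mul h h' mul0r add0r -scalerAl.
Qed.

(* [hw_alpha n] is q^((n+1)/2) [n]_q and [hw_gamma j] is q^((j-1)/2) [j]_q. *)
Fixpoint hw_alpha n : R[i] :=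
  if n is n'.+1 then s ^+ 2 * (s ^- n' + s * hw_alpha n') else 0.
Fixpoint hw_gamma j : R[i] :=
  if j is j'.+1 then s ^- j' + s ^+ 3 * hw_gamma j' else 0.

Lemma hw_alpha_ge0 n : 0 <= hw_alpha n.
Proof.
have sp := sqrtq_gt0; elim: n => //= n IH.
by rewrite mulr_ge0 ?addr_ge0 ?mulr_ge0 ?invr_ge0 ?exprn_ge0// ltW.
Qed.

Lemma hw_gammaS_gt0 n : 0 < hw_gamma n.+1.
Proof.
have sp := sqrtq_gt0; elim: n => /= [|n IH].
  by rewrite invr1 mulr0 addr0.
rewrite ltr_wpDr ?invr_gt0 ?exprn_gt0// mulr_ge0 ?exprn_ge0 ?(ltW sp)//.
exact: ltW.
Qed.

Lemma a_actF_hw i j :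
  a * F (hw i j) = hw_alpha (i + j) *: (c * hw i j)
                   + (s ^+ i * hw_gamma j) *: hw i j.-1.
Proof.
have [[ab ac bd cd] [bc adda ad]] := oqP A.
elim: i => [|i IH].
  elim: j => [|j IH].
    by rewrite /hw mulr1 act1F !mulr0 !scale0r addr0.
  have ad1 : a * d = 1 + q%:C *: (b * c) by rewrite -ad addrNK.
  have bg : b * (hw_gamma j *: hw 0 j.-1) = hw_gamma j *: hw 0 j.
    case: j {IH} => [|j]; first by rewrite /= !scale0r mulr0.
    by rewrite hw0S -scalerAr.
  have e1 x : a * (b * x) = q%:C *: (b * (a * x)).
    by rewrite mulrA ab -scalerAl mulrA.
  have e2 x : a * (d * x) = x + q%:C *: (c * (b * x)).
    by rewrite mulrA ad1 mulrDl mul1r -scalerAl bc mulrA.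
  have e3 x : b * (c * x) = c * (b * x) by rewrite !mulrA bc.
  rewrite hw0S actF_b actK_hw mulrDr -!scalerAr e2 e1 IH mulrDr expr0 mul1r bg.
  rewrite -scalerAr e3 !add0n /= mul1r -!sqrtq_sqr !scalerDr !scalerA.
  rewrite -addrA addrCA [X in _ + X]addrCA addrA -!scalerDl; congr (_ *: _ + _ *: _).
  - by ring.
  - by ring.
have e1 x : a * (c * x) = q%:C *: (c * (a * x)).
  by rewrite mulrA ac -scalerAl mulrA.
rewrite hwS actF_a actK_hw mulrDr -!scalerAr e1 IH mulrDr -!scalerAr e1 -hwS.
rewrite -sqrtq_sqr !scalerDr !scalerA addrA -scalerDl -hwS; congr (_ *: _ + _ *: _).
- by rewrite addSn /=; ring.
- by rewrite exprS; ring.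
Qed.

Lemma d_a_expS n : d * hw n.+1 0 - q^-1%:C *: (b * (c * hw n 0)) = hw n 0.
Proof.
have [[ab ac bd cd] [bc adda ad]] := oqP A.
have e : d * a - q^-1%:C *: (b * c) = 1.
  have -> : d * a = a * d - lam q *: (b * c).
    by rewrite -adda opprB addrC subrK.
  rewrite -ad -addrA -!scaleNr -scalerDl; congr (_ + _ *: _).
  by rewrite /lam rmorphB /=; ring.
by rewrite -[RHS]mul1r -e mulrBl -scalerAl hwS !mulrA.
Qed.

Lemma actF_hw_exp n : F (hw n.+1 0) = (s ^- n + s * hw_alpha n) *: (c * hw n 0).
Proof.
rewrite hwS actF_a actK_hw -scalerAr a_actF_hw /= mulr0 scale0r addr0 scalerA.
by rewrite !addn0 scalerDl.
Qed.

Definition hwF k i j : A := iter k (fun x => act m x (uqF U)) (hw i j).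

Lemma hwF0 i j : hwF 0 i j = hw i j. Proof. by []. Qed.

Lemma hwFS k i j : hwF k.+1 i j = F (hwF k i j). Proof. by []. Qed.

Section Span.
Variable P : A -> Prop.
Hypothesis P0 : P 0.
Hypothesis PZ : forall (r : R[i]) x y, P x -> P y -> P (r *: x + y).
Hypothesis Phw : forall k i j, P (hwF k i j).

Definition in_span x := forall Q : A -> Prop, Q 0 ->
  (forall (r : R[i]) x y, Q x -> Q y -> Q (r *: x + y)) ->
  (forall k i j, Q (hwF k i j)) -> Q x.

Local Notation W := in_span.

Lemma in_span0 : W 0. Proof. by move=> Q. Qed.

Lemma in_spanP (r : R[i]) x y : W x -> W y -> W (r *: x + y).
Proof. by move=> hx hy Q Q0 QZ Qh; apply: (QZ); [apply: hx | apply: hy]. Qed.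

Lemma in_spanZ (r : R[i]) x : W x -> W (r *: x).
Proof. by move=> hx; rewrite -[X in W X]addr0; apply: in_spanP => //; exact: in_span0. Qed.

Lemma in_spanD x y : W x -> W y -> W (x + y).
Proof. by move=> hx hy; rewrite -[x]scale1r; apply: in_spanP. Qed.

Lemma in_spanZI (r : R[i]) x : r != 0 -> W (r *: x) -> W x.
Proof. by move=> r0 /(in_spanZ r^-1); rewrite scalerA mulVf// scale1r. Qed.

Lemma in_spanDI x y : W (x + y) -> W y -> W x.
Proof. by move=> hxy hy; rewrite -[x](addrK y) -scaleN1r addrC; apply: in_spanP. Qed.

Lemma in_span_hwF k i j : W (hwF k i j). Proof. by move=> Q _ _. Qed.

Lemma in_span_hw i j : W (hw i j). Proof. exact: (in_span_hwF 0). Qed.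

Lemma in_span_F x : W x -> W (F x).
Proof.
move=> hx; apply: (hx (fun x => W (F x))).
- by rewrite linear0l; exact: in_span0.
- by move=> r y z hy hz; rewrite linearPl; exact: in_spanP.
- by move=> k i j; exact: (in_span_hwF k.+1).
Qed.

Lemma in_span_doublet u v k i j :
  (forall x, F (u * x) = v * K x + s *: (u * F x)) ->
  (forall x, F (v * x) = s^-1 *: (v * F x)) ->
  W (u * hw i j) -> W (v * hw i j) -> W (u * hwF k i j) /\ W (v * hwF k i j).
Proof.
move=> hu hv wu wv; elim: k => [//|k [IHu IHv]]; rewrite !hwFS.
have hK : exists r, K (hwF k i j) = r *: hwF k i j.
  elim: (k) => [|k' [r hr]]; first by eexists; exact: actK_hw.
  by exists (q%:C * r); rewrite !hwFS actFK hr linearZl_LR scalerA.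
split; last first.
  by apply: (@in_spanZI s^-1); rewrite ?invr_eq0// -hv; exact: in_span_F.
apply: (@in_spanZI s) => //; case: hK => r hr.
apply: (@in_spanDI _ (v * K (hwF k i j))).
  by rewrite addrC -hu; exact: in_span_F.
by rewrite hr -scalerAr; exact: in_spanZ.
Qed.

Lemma b_hw i j : exists r, b * hw i j = r *: hw i j.+1.
Proof.
have [[ab ac bd cd] [bc adda ad]] := oqP A.
elim: i => [|i [r IH]]; first by exists 1; rewrite scale1r hw0S.
have ba : b * a = q%:C^-1 *: (a * b) by rewrite ab scalerA mulVf// scale1r.
by exists (q%:C^-1 * r); rewrite !hwS mulrA ba -scalerAl -mulrA IH -scalerAr scalerA.
Qed.

Lemma in_span_c_hw i j : W (c * hw i j).
Proof.
have : W (F (hw i.+1 j)) by exact: (in_span_hwF 1).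
rewrite hwS actF_a actK_hw -scalerAr a_actF_hw !scalerDr addrA !scalerA -scalerDl.
move=> /in_spanDI h; apply: (in_spanZI _ (h _)).
  have sp := sqrtq_gt0; rewrite gt_eqF// ltr_pwDl ?invr_gt0 ?exprn_gt0//.
  by rewrite mulr_ge0 ?hw_alpha_ge0// ltW.
by apply: in_spanZ; exact: in_span_hw.
Qed.

Lemma in_span_d_hw i j : W (d * hw i j).
Proof.
have [[ab ac bd cd] [bc adda ad]] := oqP A.
case: i => [|i].
  have [r [r0 h]] : exists r, 0 < r /\ F (hw 0 j.+1) = r *: (d * hw 0 j).
    have sp := sqrtq_gt0.
    elim: j => [|j [r [r0 h]]].
      exists (s ^- 0); rewrite invr_gt0 exprn_gt0//; split=> //.
      by rewrite hw0S actF_b actK_hw {2}/hw mulr1 act1F !mulr0 scaler0 addr0 -scalerAr.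
    exists (s ^- j.+1 + s * (r * q%:C)); split.
      by rewrite addr_gt0 ?invr_gt0 ?exprn_gt0// !mulr_gt0// ltcR.
    rewrite hw0S actF_b actK_hw h -!scalerAr [b * (d * _)]mulrA bd -scalerAl -mulrA -hw0S.
    by rewrite !scalerA -scalerDl -!mulrA.
  by apply: (@in_spanZI r); rewrite ?gt_eqF// -h; exact: (in_span_hwF 1).
have da : d * a = 1 + q^-1%:C *: (c * b).
  have -> : d * a = a * d - lam q *: (b * c).
    by rewrite -adda opprB addrC subrK.
  have -> : a * d = 1 + q%:C *: (b * c) by rewrite -ad addrNK.
  rewrite -addrA -!scaleNr -scalerDl -bc; congr (_ + _ *: _).
  by rewrite /lam rmorphB /=; ring.
rewrite hwS mulrA da mulrDl mul1r -scalerAl -mulrA.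
have [r ->] := b_hw i j.
apply: in_spanD; first exact: in_span_hw.
by apply: in_spanZ; rewrite -scalerAr; apply: in_spanZ; exact: in_span_c_hw.
Qed.

Lemma in_spanT x : W x.
Proof.
pose gens u := forall k i j, W (u * hwF k i j).
have lift u : gens u -> forall y, W y -> W (u * y).
  move=> gu y hy; apply: (hy (fun y => W (u * y))) => //.
  - by rewrite mulr0; exact: in_span0.
  - by move=> r y1 y2 h1 h2; rewrite mulrDr -scalerAr; exact: in_spanP.
have gac k i j : W (a * hwF k i j) /\ W (c * hwF k i j).
  apply: (in_span_doublet _ actF_a actF_c _ (in_span_c_hw i j)).
  by rewrite -hwS; exact: in_span_hw.
have gbd k i j : W (b * hwF k i j) /\ W (d * hwF k i j).
  apply: (in_span_doublet _ actF_b actF_d _ (in_span_d_hw i j)).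
  by have [r ->] := b_hw i j; apply: in_spanZ; exact: in_span_hw.
suff: forall y, W y -> W (x * y).
  move=> h; rewrite -[x]mulr1; apply: h.
  by have := in_span_hw 0 0; rewrite /hw mulr1.
apply: (oq_gen_ind (P := fun x => forall y, W y -> W (x * y))) x.
- by move=> y; rewrite mul1r.
- move=> r x1 x2 h1 h2 y hy; rewrite mulrDl -scalerAl.
  by apply: in_spanP; [exact: h1 | exact: h2].
- by move=> x1 x2 h1 h2 y hy; rewrite -mulrA; apply: h1; apply: h2.
- by apply: lift => k i j; have [] := gac k i j.
- by apply: lift => k i j; have [] := gbd k i j.
- by apply: lift => k i j; have [] := gac k i j.
- by apply: lift => k i j; have [] := gbd k i j.
Qed.

Lemma oq_span_ind x : P x. Proof. exact: (in_spanT x P0 PZ Phw). Qed.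

End Span.

Lemma haar_unique (h psi : {linear A -> R[i]}) : is_haar m h ->
  (forall x, psi (F x) = 0) -> (forall x, psi (K x) = psi x) ->
  forall x, psi x = psi 1 * h x.
Proof.
move=> [h1 hinv] psiF psiK; have [_ e2 e3] := uq_counit U.
have hF x : h (F x) = 0 by rewrite hinv e2 mul0r.
have hK x : h (K x) = h x by rewrite hinv e3 mul1r.
have kill (g : {linear A -> R[i]}) : (forall x, g (K x) = g x) ->
    forall i j, (i + j)%N != 0%N -> g (hw i j) = 0.
  move=> gK i j ij; apply/eqP; have := gK (hw i j).
  rewrite actK_hw linearZ /= => /eqP; rewrite -subr_eq0 -{2}[g _]mul1r -mulrBl.
  rewrite mulf_eq0 => /orP[|//]; rewrite subr_eq0 -exprVn.
  have s1 : 1 < s^-1.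
    rewrite invf_gt1 ?sqrtq_gt0// -(@ltr_pXn2r _ 2)// ?nnegrE ?(ltW sqrtq_gt0)//.
    by rewrite sqrtq_sqr expr1n ltcR.
  by rewrite gt_eqF// exprn_egt1.
apply: oq_span_ind.
- by rewrite !linear0 mulr0.
- by move=> r x y hx hy; rewrite !linearP /= hx hy mulrDr; congr (_ + _); exact: mulrCA.
- move=> [|k] i j; last by rewrite hwFS hF psiF mulr0.
  rewrite hwF0; case: (eqVneq (i + j)%N 0%N) => [|ij].
    by move=> /eqP; rewrite addn_eq0 => /andP[/eqP -> /eqP ->]; rewrite /hw mulr1 h1 mulr1.
  by rewrite !kill// mulr0.
Qed.

End ActionBasics.

(** * Hilbert spaces over the complex numbers *)

Lemma sum_from1_has_sum (K : numFieldType) (u : nat -> K) l :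
  has_sum (fun n => u n.+1) l -> sum_from1 u = l.
Proof.
move=> h; apply/cvg_lim => //; rewrite -cvg_shiftS /=.
apply: cvg_trans h; apply: near_eq_cvg; near=> n.
by rewrite /series /= big_add1.
Unshelve. all: by end_near.
Qed.

Section RealNorm.
Variable R : realType.
Implicit Types (V : normedZmodType R[i]) (c : R[i]) (r e : R).

Definition nrm V (u : V) : R := Re `|u|.

Lemma nrmE V (u : V) : `|u| = (nrm u)%:C.
Proof. by rewrite /nrm RRe_real ?normr_real. Qed.

Lemma nrm_ge0 V (u : V) : 0 <= nrm u.
Proof. by rewrite -ler0c -nrmE. Qed.

Lemma nrm0 V : nrm (0 : V) = 0.
Proof. by rewrite /nrm normr0. Qed.

Lemma nrm_eq0 V (u : V) : nrm u = 0 -> u = 0.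
Proof. by move=> h; apply/normr0_eq0; rewrite nrmE h. Qed.

Lemma nrmN V (u : V) : nrm (- u) = nrm u.
Proof. by rewrite /nrm normrN. Qed.

Lemma nrmBC V (u v : V) : nrm (u - v) = nrm (v - u).
Proof. by rewrite -nrmN opprB. Qed.

Lemma nrmD V (u v : V) : nrm (u + v) <= nrm u + nrm v.
Proof. by rewrite -lecR rmorphD /= -!nrmE ler_normD. Qed.

Lemma nrmB V (u v : V) : nrm (u - v) <= nrm u + nrm v.
Proof. by rewrite (le_trans (nrmD _ _))// nrmN. Qed.

Lemma nrm_sum V n (u : 'I_n -> V) :
  nrm (\sum_(i < n) u i) <= \sum_(i < n) nrm (u i).
Proof.
elim: n u => [|n IH] u; first by rewrite !big_ord0 nrm0.
by rewrite !big_ord_recr /= (le_trans (nrmD _ _))// lerD2r.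
Qed.

Lemma nrmM c c' : nrm (c * c') = nrm c * nrm c'.
Proof. by apply: complexI; rewrite rmorphM /= -!nrmE normrM. Qed.

Lemma nrmJ c : nrm c^* = nrm c.
Proof. by rewrite /nrm normcJ. Qed.

Lemma nrmR r : nrm (r%:C) = `|r|.
Proof. by rewrite /nrm normc_def /= expr0n addr0 sqrtr_sqr. Qed.

Lemma sqr_nrm c : nrm c ^+ 2 = Re c ^+ 2 + Im c ^+ 2.
Proof. by apply: complexI; rewrite rmorphXn /= -nrmE add_Re2_Im2. Qed.

Lemma mulcJ c : c * c^* = (nrm c ^+ 2)%:C.
Proof. by rewrite -sqr_normc nrmE -rmorphXn. Qed.

Lemma Re_le_nrm c : `|Re c| <= nrm c.
Proof. by rewrite -lecR -nrmE normc_ge_Re. Qed.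

Lemma Im_le_nrm c : `|Im c| <= nrm c.
Proof.
rewrite -[`|_|]ger0_norm// -ler_sqr ?nnegrE ?nrm_ge0//.
by rewrite normr_id sqr_nrm real_normK ?num_real// lerDr sqr_ge0.
Qed.

Lemma nrm_le_ReIm c : nrm c <= `|Re c| + `|Im c|.
Proof.
rewrite -ler_sqr ?nnegrE ?nrm_ge0 ?addr_ge0// sqr_nrm sqrrD.
rewrite !real_normK ?num_real// [leRHS]addrAC lerDl.
by rewrite mulrn_wge0// mulr_ge0.
Qed.

Lemma halfC : (2^-1 : R[i]) = (2^-1 : R)%:C.
Proof. by rewrite fmorphV /= rmorph_nat. Qed.

Lemma conjR r : (r%:C)^* = r%:C.
Proof. exact: conjc_real. Qed.

Definition tends V (u : nat -> V) (l : V) : Prop :=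
  forall e, 0 < e -> exists N, forall n, (N <= n)%N -> nrm (u n - l) < e.

Lemma gt0C (e : R[i]) : 0 < e -> 0 < Re e /\ e = (Re e)%:C.
Proof.
move=> e0; have h : e = (Re e)%:C by rewrite RRe_real// gtr0_real.
by split=> //; rewrite -ltcR -h.
Qed.

Lemma has_sum_tends (u : nat -> R[i]) l : has_sum u l <->
  tends (fun n => \sum_(i < n) u i) l.
Proof.
have seriesE n : series u n = \sum_(i < n) u i by rewrite /series /= big_mkord.
split.
  move=> /cvgrPdist_lt h e e0; have [|N _ hN] := h e%:C; first by rewrite ltcR.
  exists N => n hn; rewrite -ltcR -nrmE distrC -seriesE; exact: hN.
move=> h; apply/cvgrPdist_lt => e /gt0C[e0 ->]; have [N hN] := h _ e0.
exists N => // n hn; rewrite distrC nrmE ltcR seriesE; exact: hN.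
Qed.

Section Tends.
Variable V : normedZmodType R[i].
Implicit Types (u v : nat -> V) (l : V).

Lemma tends_cst l : tends (fun=> l) l.
Proof. by move=> e e0; exists 0%N => n _; rewrite subrr nrm0. Qed.

Lemma tendsD u v l l' : tends u l -> tends v l' ->
  tends (fun n => u n + v n) (l + l').
Proof.
move=> hu hv e e0; have e2 : 0 < e / 2 by rewrite divr_gt0.
have [N hN] := hu _ e2; have [M hM] := hv _ e2.
exists (maxn N M) => n; rewrite geq_max => /andP[/hN h1 /hM h2].
rewrite opprD addrACA (le_lt_trans (nrmD _ _))// [e]splitr; exact: ltrD.
Qed.

Lemma tendsN u l : tends u l -> tends (fun n => - u n) (- l).
Proof.
by move=> hu e /hu[N hN]; exists N => n /hN; rewrite -opprD nrmN.
Qed.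

Lemma tendsB u v l l' : tends u l -> tends v l' ->
  tends (fun n => u n - v n) (l - l').
Proof. by move=> hu /tendsN; exact: tendsD. Qed.

Lemma tends_le u l (f : nat -> R) :
  (forall e, 0 < e -> exists N, forall n, (N <= n)%N -> f n < e) ->
  (forall n, nrm (u n - l) <= f n) -> tends u l.
Proof.
move=> hf hu e /hf[N hN]; exists N => n /hN; exact: le_lt_trans.
Qed.

Lemma le_tends_nrm u l M : tends u l -> (forall n, nrm (u n) <= M) -> nrm l <= M.
Proof.
move=> hu hM; apply/ler_addgt0Pr => e /hu[N /(_ N (leqnn _)) h].
rewrite -[l](subrK (u N)) (le_trans (nrmD _ _))// nrmBC addrC lerD//; exact: ltW.
Qed.

Lemma tends_uniq u l l' : tends u l -> tends u l' -> l = l'.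
Proof.
move=> h h'; apply/eqP; rewrite -subr_eq0; apply/eqP/nrm_eq0/le_anti.
rewrite nrm_ge0 andbT; apply: (le_tends_nrm (tendsB h h')) => n.
by rewrite subrr nrm0.
Qed.

Lemma tends_sub u l (f : nat -> nat) : (forall n, (n <= f n)%N) ->
  tends u l -> tends (fun n => u (f n)) l.
Proof.
move=> hf hu e /hu[N hN]; exists N => n hn; apply: hN; exact: leq_trans (hf n).
Qed.

Lemma tends_ext u v l : u =1 v -> tends u l -> tends v l.
Proof. by move=> uv hu e /hu[N hN]; exists N => n /hN; rewrite uv. Qed.

End Tends.

Lemma tends_map V (W : normedZmodType R[i]) (f : V -> W) M u l :
  (forall v w, nrm (f v - f w) <= M * nrm (v - w)) ->
  tends u l -> tends (fun n => f (u n)) (f l).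
Proof.
move=> hf hu e e0.
have M1 : 0 < `|M| + 1 by rewrite ltr_wpDl.
have [|N hN] := hu (e / (`|M| + 1)); first by rewrite divr_gt0.
exists N => n /hN h; rewrite (le_lt_trans (hf _ _))//.
rewrite (@le_lt_trans _ _ ((`|M| + 1) * nrm (u n - l)))//.
  by rewrite ler_wpM2r ?nrm_ge0// (le_trans (ler_norm M))// lerDl.
by rewrite mulrC -ltr_pdivlMr.
Qed.

Lemma tendsZ c (u : nat -> R[i]) l : tends u l -> tends (fun n => c * u n) (c * l).
Proof. by apply: (tends_map (M := nrm c)) => v w; rewrite -mulrBr nrmM. Qed.

Lemma tends_Re (u : nat -> R[i]) l : tends u l ->
  (fun n => Re (u n)) @ \oo --> Re l.
Proof.
move=> hu; apply/cvgrPdist_lt => e /hu[N hN]; exists N => // n hn.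
by rewrite -raddfB (le_lt_trans (Re_le_nrm _))// nrmBC; exact: hN.
Qed.

Lemma tends_ReIm (u : nat -> R[i]) (r s : R) :
  (fun n => Re (u n)) @ \oo --> r -> (fun n => Im (u n)) @ \oo --> s ->
  tends u (r +i* s).
Proof.
move=> /cvgrPdist_lt hr /cvgrPdist_lt hs e e0.
have e2 : 0 < e / 2 by rewrite divr_gt0.
have [N _ hN] := hr _ e2; have [M _ hM] := hs _ e2.
exists (maxn N M) => n; rewrite geq_max => /andP[/hN h1 /hM h2].
rewrite (le_lt_trans (nrm_le_ReIm _))// [e]splitr !raddfB /= ltrD//.
  by rewrite distrC.
by rewrite distrC.
Qed.

End RealNorm.

Section HilbertBasics.
Variables (R : realType) (H : hilbertType R).
Implicit Types (u v w : H) (c : R[i]).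

Lemma dotC u v : <|u, v|> = <|v, u|>^*.
Proof. by rewrite hermC /= expr0 mul1r. Qed.

Lemma dotDl u v w : <|u + v, w|> = <|u, w|> + <|v, w|>.
Proof. by rewrite linearDl. Qed.

Lemma dotBl u v w : <|u - v, w|> = <|u, w|> - <|v, w|>.
Proof. by rewrite linearBl. Qed.

Lemma dotZl c u v : <|c *: u, v|> = c * <|u, v|>.
Proof. by rewrite linearZl_LR. Qed.

Lemma dotZr c u v : <|u, c *: v|> = c^* * <|u, v|>.
Proof. by rewrite linearZr_LR. Qed.

Lemma dotDr u v w : <|u, v + w|> = <|u, v|> + <|u, w|>.
Proof. by rewrite linearDr. Qed.

Lemma dotBr u v w : <|u, v - w|> = <|u, v|> - <|u, w|>.
Proof. by rewrite linearBr. Qed.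

Lemma dotNr u v : <|u, - v|> = - <|u, v|>.
Proof. by rewrite linearNr. Qed.

Lemma dot0l u : <|0, u|> = 0.
Proof. by rewrite linear0l. Qed.

Lemma dot0r u : <|u, 0|> = 0.
Proof. by rewrite linear0r. Qed.

Lemma dot_suml n (f : 'I_n -> H) v :
  <|\sum_(i < n) f i, v|> = \sum_(i < n) <|f i, v|>.
Proof. by rewrite linear_sumlz. Qed.

Lemma dot_sumr n (f : 'I_n -> H) v :
  <|v, \sum_(i < n) f i|> = \sum_(i < n) <|v, f i|>.
Proof. by rewrite linear_sumr. Qed.

Lemma nrmZ c u : nrm (c *: u) = nrm c * nrm u.
Proof. by apply: complexI; rewrite rmorphM /= -!nrmE normrZ. Qed.

Lemma dotuu u : <|u, u|> = (nrm u ^+ 2)%:C.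
Proof. by rewrite dot_norm nrmE -rmorphXn. Qed.

Lemma nrm2D u v : nrm (u + v) ^+ 2 = nrm u ^+ 2 + nrm v ^+ 2 + 2 * Re <|u, v|>.
Proof.
apply: complexI; rewrite -dotuu dotDl !dotDr !dotuu (dotC v u).
by case: <|u, v|> => x y /=; apply/eqP; rewrite eq_complex /=; apply/andP; split; apply/eqP; ring.
Qed.

Lemma dot_le u v : nrm <|u, v|> <= nrm u * nrm v.
Proof.
have [->|v0] := eqVneq v 0; first by rewrite dot0r !nrm0 mulr0.
have nv : 0 < nrm v.
  by rewrite lt_def nrm_ge0 andbT; apply: contra v0 => /eqP/nrm_eq0 ->.
pose a := <|u, v|> / (nrm v ^+ 2)%:C.
have := sqr_ge0 (nrm (u - a *: v)); rewrite -lecR -dotuu.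
have nvC : (nrm v ^+ 2)%:C != 0 :> R[i].
  by rewrite (inj_eq (@complexI R)) expf_neq0 ?gt_eqF.
have h : <|u - a *: v, v|> = 0 by rewrite dotBl dotZl dotuu /a divfK ?subrr.
rewrite dotBr dotZr h mulr0 subr0 dotBl dotZl (dotC v u) /a mulrAC mulcJ.
rewrite dotuu -fmorphV -rmorphM -rmorphB /= lecR subr_ge0 ler_pdivrMr ?exprn_gt0//.
by rewrite -exprMn ler_sqr ?nnegrE ?mulr_ge0 ?nrm_ge0.
Qed.

Lemma tends_dotl (u : nat -> H) l v : tends u l -> tends (fun n => <|u n, v|>) <|l, v|>.
Proof.
apply: (tends_map (f := fun u => <|u, v|>) (M := nrm v)) => u1 u2.
by rewrite -dotBl mulrC dot_le.
Qed.

Lemma tends_dotr (u : nat -> H) l v : tends u l -> tends (fun n => <|v, u n|>) <|v, l|>.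
Proof.
apply: (tends_map (f := fun u => <|v, u|>) (M := nrm v)) => u1 u2.
by rewrite -dotBr dot_le.
Qed.

Lemma hilbert_complete (u : nat -> H) :
  (forall e : R, 0 < e ->
     exists N, forall n m, (N <= n)%N -> (N <= m)%N -> nrm (u n - u m) < e) ->
  exists l, tends u l.
Proof.
move=> hu; suff /cauchy_cvgP/cvg_ex[l hl] : cauchy (u @ \oo).
  exists l => e e0; move/cvgrPdist_lt : hl => /(_ e%:C); rewrite ltcR => /(_ e0).
  by case=> N _ hN; exists N => n /hN; rewrite /= nrmE ltcR nrmBC.
apply/cauchy_ballP => e /gt0C[e0 ->]; have [N hN] := hu _ e0.
pose T := [set v | exists2 n, (N <= n)%N & v = u n].
exists (T, T) => /=; first by split; exists N => // n hn; exists n.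
move=> [_ _] /= [[n hn ->] [k hk ->]].
by rewrite -ball_normE /= nrmE ltcR; exact: hN.
Qed.

End HilbertBasics.

(** * Orthonormal bases *)

Lemma nondecreasing_cauchy (R : realType) (S : nat -> R) M :
  (forall n, S n <= S n.+1) -> (forall n, S n <= M) ->
  forall e, 0 < e -> exists N, forall n m, (N <= n)%N -> (N <= m)%N ->
    `|S n - S m| < e.
Proof.
move=> hS hM e e0.
have nd : nondecreasing_seq S by apply/nondecreasing_seqP.
have cS : cvgn S by apply: nondecreasing_is_cvgn => //; exists M => _ [n _ <-].
have := cS => /cvgrPdist_lt /(_ (e / 2)); rewrite divr_gt0// => /(_ isT)[N _ hN].
exists N => n k hn hk; rewrite -(subrKA (limn S)) (le_lt_trans (ler_normD _ _))//.
by rewrite [e]splitr ltrD//; [rewrite distrC|]; exact: hN.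
Qed.

Section OrthonormalSums.
Variables (R : realType) (H : hilbertType R) (e : nat -> H).
Implicit Types (u v w : H) (c : nat -> R[i]).

Lemma dot_orthonormal_sum n c j : (forall i j, <|e i, e j|> = (i == j)%:R) ->
  <|\sum_(i < n) c i *: e i, e j|> = if (j < n)%N then c j else 0.
Proof.
move=> he; rewrite dot_suml; under eq_bigr do rewrite dotZl he.
elim: n => [|n IH]; first by rewrite big_ord0.
rewrite big_ord_recr /= IH ltnS [(j <= n)%N]leq_eqVlt.
case: (ltngtP j n) => [_|_|->] /=; rewrite ?mulr1 ?mulr0 ?addr0 ?add0r//.
Qed.

Lemma nrm_orthonormal_sum n c : (forall i j, <|e i, e j|> = (i == j)%:R) ->
  nrm (\sum_(i < n) c i *: e i) ^+ 2 = \sum_(i < n) nrm (c i) ^+ 2.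
Proof.
move=> he; apply: complexI; rewrite -dotuu rmorph_sum /= dot_sumr.
apply: eq_bigr => i _; rewrite dotZr dot_orthonormal_sum// ltn_ord.
by rewrite mulrC mulcJ.
Qed.

End OrthonormalSums.

Section Basis.
Variables (R : realType) (H : hilbertType R) (e : nat -> H).
Implicit Types (u v w : H) (c : nat -> R[i]).
Hypothesis he : orthonormal_basis e.
Let eo := he.1.

Lemma nrm_basis i : nrm (e i) = 1.
Proof.
apply/eqP; rewrite -(@eqrXn2 _ 2) ?nrm_ge0// expr1n -(inj_eq (@complexI R)).
by rewrite -dotuu he.1 eqxx.
Qed.

Lemma coef_inj u v : (forall i, <|u, e i|> = <|v, e i|>) -> u = v.
Proof.
move=> h; apply/eqP; rewrite -subr_eq0; apply/eqP/he.2 => i.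
by rewrite dotBl h subrr.
Qed.

Lemma riesz_fischer c M : (forall n, \sum_(i < n) nrm (c i) ^+ 2 <= M) ->
  exists v, [/\ forall i, <|v, e i|> = c i, nrm v ^+ 2 <= M
    & tends (fun n => \sum_(i < n) c i *: e i) v].
Proof.
move=> hM; pose u n := \sum_(i < n) c i *: e i.
pose S n := \sum_(i < n) nrm (c i) ^+ 2.
have dif n k : (n <= k)%N -> nrm (u k - u n) ^+ 2 = S k - S n.
  move=> /subnKC <-; rewrite /u /S !big_split_ord /= !(addrC (\sum_(i < n) _)) !addrK.
  have eo' i j : <|e (n + i)%N, e (n + j)%N|> = (i == j)%:R by rewrite eo eqn_add2l.
  exact: (nrm_orthonormal_sum (k - n) (fun i => c (n + i)%N) eo').
have M0 : 0 <= M by have := hM 0%N; rewrite big_ord0.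
have [|l hl] := @hilbert_complete _ _ u.
  move=> r r0; have Snd n : S n <= S n.+1 by rewrite /S big_ord_recr /= lerDl sqr_ge0.
  have [N hN] := nondecreasing_cauchy Snd hM (exprn_gt0 2 r0).
  have main n k : (N <= n)%N -> (n <= k)%N -> nrm (u k - u n) < r.
    move=> hn hk; rewrite -ltr_sqr ?nnegrE ?nrm_ge0 ?(ltW r0)// dif//.
    by rewrite (le_lt_trans (ler_norm _))// hN// (leq_trans hn).
  exists N => n k hn hk; have [nk|kn] := leqP n k; first by rewrite nrmBC main.
  by apply: main => //; exact: ltnW.
have hc i : <|l, e i|> = c i.
  apply: (tends_uniq (tends_dotl (e i) hl)) => r r0; exists i.+1 => n hn.
  by rewrite /u dot_orthonormal_sum// hn subrr nrm0.
exists l; split => //.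
rewrite -[M]sqr_sqrtr// ler_sqr ?nnegrE ?nrm_ge0 ?sqrtr_ge0//.
apply: (le_tends_nrm hl) => n.
by rewrite -ler_sqr ?nnegrE ?nrm_ge0 ?sqrtr_ge0// sqr_sqrtr// nrm_orthonormal_sum.
Qed.

Definition trunc n v := \sum_(i < n) <|v, e i|> *: e i.

Lemma bessel n v : \sum_(i < n) nrm <|v, e i|> ^+ 2 <= nrm v ^+ 2.
Proof.
have h : <|v - trunc n v, trunc n v|> = 0.
  rewrite {2}/trunc dot_sumr big1// => i _.
  rewrite dotZr dotBl (dot_orthonormal_sum n (fun i => <|v, e i|>) i eo).
  by rewrite ltn_ord subrr mulr0.
rewrite -(subrK (trunc n v) v) nrm2D h mulr0 addr0 subrK.
by rewrite (nrm_orthonormal_sum n (fun i => <|v, e i|>) eo) lerDr sqr_ge0.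
Qed.

Lemma trunc_tends v : tends (trunc^~ v) v.
Proof.
have [w [hw _ hl]] := @riesz_fischer (fun i => <|v, e i|>) _ (bessel^~ v).
by move: hl; rewrite (coef_inj hw).
Qed.

Lemma parseval u v :
  tends (fun n => \sum_(i < n) <|u, e i|> * <|v, e i|>^*) <|u, v|>.
Proof.
apply: tends_ext (tends_dotl v (trunc_tends u)) => n.
rewrite dot_suml; apply: eq_bigr => i _; by rewrite dotZl (dotC (e i) v).
Qed.

Lemma nrm_le_coef v M : (forall n, \sum_(i < n) nrm <|v, e i|> ^+ 2 <= M) ->
  nrm v ^+ 2 <= M.
Proof.
by move=> /(@riesz_fischer (fun i => <|v, e i|>))[w [hw hM _]]; rewrite -(coef_inj hw).
Qed.

Lemma abs_summable (c : nat -> R[i]) M :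
  (forall n, \sum_(i < n) nrm (c i) <= M) ->
  exists l, tends (fun n => \sum_(i < n) c i) l.
Proof.
move=> hM; pose S n := \sum_(i < n) nrm (c i).
have Snd n : S n <= S n.+1 by rewrite /S big_ord_recr /= lerDl nrm_ge0.
have [|l hl] := @hilbert_complete _ _ (fun n => (\sum_(i < n) c i) *: e 0%N); last first.
  exists <|l, e 0%N|>; apply: tends_ext (tends_dotl (e 0%N) hl) => n.
  by rewrite dotZl eo mulr1.
move=> r r0; have [N hN] := nondecreasing_cauchy Snd hM r0.
have main n k : (N <= n)%N -> (n <= k)%N ->
    nrm ((\sum_(i < k) c i) *: e 0%N - (\sum_(i < n) c i) *: e 0%N) < r.
  move=> hn hk; rewrite -scalerBl nrmZ nrm_basis mulr1.
  apply: le_lt_trans (hN k n (leq_trans hn hk) hn).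
  move: hk => /subnKC <-; rewrite /S !big_split_ord /= !(addrC (\sum_(i < n) _)) !addrK.
  by rewrite (le_trans (nrm_sum _))// ler_norm.
exists N => n k hn hk; have [nk|kn] := leqP n k; first by rewrite nrmBC main.
by apply: main => //; exact: ltnW.
Qed.

End Basis.

Section LinearMaps.
Variables (R : realType) (H : hilbertType R).

Lemma linear_mk (f : H -> H) : linear f -> exists T : {linear H -> H}, T =1 f.
Proof.
move=> lf; pose T : {linear H -> H} := HB.pack f (GRing.isLinear.Build _ _ _ _ f lf).
by exists T.
Qed.

Definition opbound (T : H -> H) (M : R) : Prop := forall v, nrm (T v) <= M * nrm v.

Lemma opbound_tends (T : {linear H -> H}) M u l : opbound T M -> tends u l ->
  tends (fun n => T (u n)) (T l).
Proof. by move=> hT; apply: (tends_map (M := M)) => v w; rewrite -linearB. Qed.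

Lemma opbound_continuous (T : {linear H -> H}) M : opbound T M -> continuous T.
Proof.
move=> hT; apply: bounded_linear_continuous.
apply/linear_boundedP; exists `|M|%:C; split; first by rewrite realE ler0c normr_ge0.
move=> r hr v; rewrite !nrmE; apply: le_trans (_ : (`|M| * nrm v)%:C <= _).
  by rewrite lecR (le_trans (hT v))// ler_wpM2r ?nrm_ge0// ler_norm.
by rewrite rmorphM /= ler_wpM2r ?ler0c ?nrm_ge0// ltW.
Qed.
Variables (e : nat -> H).
Hypothesis he : orthonormal_basis e.

Lemma coef_map (g : H -> nat -> R[i]) M : 0 <= M ->
  (forall i (c : R[i]) u v, g (c *: u + v) i = c * g u i + g v i) ->
  (forall v n, \sum_(i < n) nrm (g v i) ^+ 2 <= (M * nrm v) ^+ 2) ->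
  exists2 T : {linear H -> H}, (forall v i, <|T v, e i|> = g v i) & opbound T M.
Proof.
move=> M0 lg hM; have [f hf] := choice (fun v => riesz_fischer he (hM v)).
have [|T hT] := @linear_mk f.
  move=> c u v; apply: (coef_inj he) => i.
  by rewrite dotDl dotZl; case: (hf u) (hf v) (hf (c *: u + v)) => -> _ _ [-> _ _] [-> _ _].
exists T => [v i|v]; rewrite hT; have [// h1 h2 _] := hf v.
by rewrite -ler_sqr ?nnegrE ?mulr_ge0 ?nrm_ge0.
Qed.

Lemma adjoint_exists (T : {linear H -> H}) M : opbound T M ->
  exists2 S : {linear H -> H}, (forall u v, <|T u, v|> = <|u, S v|>) & opbound S M.
Proof.
move=> hT; have M0 : 0 <= M.
  have := hT (e 0%N); rewrite (nrm_basis he).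
  by rewrite mulr1; apply: le_trans; exact: nrm_ge0.
have [|v n|S hS bS] := @coef_map (fun v i => <|v, T (e i)|>) M M0.
- by move=> i c u v; rewrite dotDl dotZl.
- pose s := \sum_(i < n) nrm <|v, T (e i)|> ^+ 2; rewrite -/s.
  pose w := \sum_(i < n) <|v, T (e i)|> *: e i.
  have sw : s = nrm w ^+ 2 by rewrite (nrm_orthonormal_sum n (fun i => <|v, T (e i)|>) he.1).
  have sE : s%:C = <|v, T w|>.
    rewrite /w linear_sum dot_sumr rmorph_sum; apply: eq_bigr => i _.
    by rewrite linearZ /= dotZr mulrC mulcJ.
  have s0 : 0 <= s by apply: sumr_ge0 => i _; exact: sqr_ge0.
  rewrite sw ler_sqr ?nnegrE ?mulr_ge0 ?nrm_ge0//.
  have : nrm w * nrm w <= (M * nrm v) * nrm w.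
    rewrite -expr2 -sw -[s]ger0_norm// -nrmR sE (le_trans (dot_le _ _))//.
    by rewrite (mulrC M) -mulrA ler_wpM2l ?nrm_ge0.
  have [w0 _|w0] := eqVneq (nrm w) 0; first by rewrite w0 mulr_ge0 ?nrm_ge0.
  by rewrite ler_pM2r// lt_def w0 nrm_ge0.
exists S => // u v.
have hT' := tends_dotl v (opbound_tends hT (trunc_tends he u)).
apply: (tends_uniq hT').
apply: tends_ext (tends_dotl (S v) (trunc_tends he u)) => n.
rewrite /trunc linear_sum !dot_suml; apply: eq_bigr => i _.
by rewrite linearZ /= !dotZl (dotC (e i) (S v)) hS -dotC.
Qed.

End LinearMaps.

(** * Square roots and nuclear operators *)

Section SquareRoot.
Variables (R : realType) (H : hilbertType R) (T S : {linear H -> H}).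
Hypothesis adj : forall u v, <|T u, v|> = <|u, S v|>.
Hypotheses (T1 : opbound T 1) (S1 : opbound S 1).

Let adj' u v : <|S u, v|> = <|u, T v|>.
Proof. by rewrite dotC -adj -dotC. Qed.

(* The iteration Y' = (B + Y^2) / 2 for B = 1 - T^* T; its limit Y satisfies
   (1 - Y)^2 = T^* T. *)
Fixpoint sqrt_iter n : {linear H -> H} :=
  if n is n'.+1 then
    [the {linear H -> H} of
      2^-1 \*: ((idfun \- (S \o T)) \+ (sqrt_iter n' \o sqrt_iter n'))]
  else [the {linear H -> H} of \0].
Local Notation Y := sqrt_iter.

(* Majorizes the norm of [sqrt_iter n]. *)
Fixpoint sqrt_bound n : R := if n is n'.+1 then (1 + sqrt_bound n' ^+ 2) / 2 else 0.
Local Notation p := sqrt_bound.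

Lemma sqrt_iterS n v : Y n.+1 v = 2^-1 *: (v - S (T v) + Y n (Y n v)).
Proof. by []. Qed.

Lemma sqrt_bound01 n : 0 <= p n <= 1.
Proof. by elim: n => /= [|n /andP[h1 h2]]; rewrite ?lexx ?ler01//; nra. Qed.

Lemma sqrt_bound_le n : p n <= p n.+1.
Proof. by have := sqrt_bound01 n; rewrite /=; nra. Qed.

Lemma one_sub_le v : nrm (v - S (T v)) <= nrm v.
Proof.
rewrite -ler_sqr ?nnegrE ?nrm_ge0// nrm2D nrmN dotNr -adj dotuu /=.
have : nrm (S (T v)) ^+ 2 <= nrm (T v) ^+ 2.
  by rewrite ler_sqr ?nnegrE ?nrm_ge0// -[leRHS]mul1r S1.
have := sqr_ge0 (nrm (T v)); lra.
Qed.

Lemma sqrt_iter_bound n v : nrm (Y n v) <= p n * nrm v.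
Proof.
elim: n v => [|n IH] v; first by rewrite nrm0 mul0r.
rewrite sqrt_iterS nrmZ; rewrite halfC nrmR ger0_norm//.
rewrite [leRHS](_ : _ = 2^-1 * (nrm v + p n ^+ 2 * nrm v)); last by rewrite /=; ring.
rewrite ler_wpM2l// (le_trans (nrmD _ _))// lerD ?one_sub_le//.
rewrite (le_trans (IH _))// expr2 -mulrA ler_wpM2l//.
by have /andP[] := sqrt_bound01 n.
Qed.

Lemma sqrt_iter_sym n u v : <|Y n u, v|> = <|u, Y n v|>.
Proof.
elim: n u v => [|n IH] u v; first by rewrite dot0l dot0r.
rewrite !sqrt_iterS dotZl dotZr dotDl dotBl dotDr dotBr !IH adj' -adj.
by rewrite halfC conjR.
Qed.

Lemma sqrt_iter_comm n (C : {linear H -> H}) :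
  (forall v, C (S (T v)) = S (T (C v))) -> forall v, C (Y n v) = Y n (C v).
Proof.
move=> hC; elim: n => [|n IH] v; first by rewrite linear0.
by rewrite !sqrt_iterS linearZ /= linearD linearB hC !IH.
Qed.

Lemma sqrt_iter_commY n k v : Y n (Y k v) = Y k (Y n v).
Proof.
apply: sqrt_iter_comm => w; symmetry.
exact: (sqrt_iter_comm n (C := [the {linear H -> H} of S \o T])).
Qed.

Lemma sqrt_iter_ge0 n v : 0 <= Re <|Y n v, v|>.
Proof.
case: n => [|n]; first by rewrite dot0l.
rewrite sqrt_iterS dotZl halfC dotDl dotBl adj' sqrt_iter_sym !dotuu.
rewrite -rmorphB -rmorphD -rmorphM /= mulr_ge0// addr_ge0 ?sqr_ge0// subr_ge0.
by rewrite ler_sqr ?nnegrE ?nrm_ge0// -[leRHS]mul1r T1.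
Qed.

Lemma sqrt_iter_step n v : nrm (Y n.+1 v - Y n v) <= (p n.+1 - p n) * nrm v.
Proof.
elim: n v => [|n IH] v; first by rewrite [Y 0%N v]/(0 : H) !subr0 sqrt_iter_bound.
have -> : Y n.+2 v - Y n.+1 v =
    2^-1 *: ((Y n.+1 (Y n.+1 v) - Y n (Y n.+1 v)) + (Y n.+1 (Y n v) - Y n (Y n v))).
  rewrite [Y n.+2 v]sqrt_iterS [X in _ - X]sqrt_iterS -scalerBr opprD addrACA subrr add0r.
  by rewrite (sqrt_iter_commY n) addrA addrNK.
rewrite nrmZ halfC nrmR ger0_norm//.
have d0 : 0 <= p n.+1 - p n by rewrite subr_ge0 sqrt_bound_le.
have h1 : nrm (Y n.+1 (Y n.+1 v) - Y n (Y n.+1 v)) <= (p n.+1 - p n) * (p n.+1 * nrm v).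
  by rewrite (le_trans (IH _))// ler_wpM2l// sqrt_iter_bound.
have h2 : nrm (Y n.+1 (Y n v) - Y n (Y n v)) <= (p n.+1 - p n) * (p n * nrm v).
  by rewrite (le_trans (IH _))// ler_wpM2l// sqrt_iter_bound.
have := le_trans (nrmD _ _) (lerD h1 h2) => /(ler_wpM2l (_ : 0 <= 2^-1)) h.
rewrite (le_trans (h _))//.
have e1 : p n.+2 = (1 + p n.+1 ^+ 2) / 2 by [].
have e2 : p n.+1 = (1 + p n ^+ 2) / 2 by [].
have -> : p n.+2 - p n.+1 = 2^-1 * (p n.+1 ^+ 2 - p n ^+ 2) by rewrite e1; lra.
by rewrite le_eqVlt; apply/orP; left; apply/eqP; ring.
Qed.

Lemma sqrt_iter_dist n k v : (n <= k)%N ->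
  nrm (Y k v - Y n v) <= (p k - p n) * nrm v.
Proof.
elim: k => [|k IH]; first by rewrite leqn0 => /eqP ->; rewrite !subrr nrm0 mul0r.
rewrite leq_eqVlt => /orP[/eqP ->|]; first by rewrite !subrr nrm0 mul0r.
rewrite ltnS => /IH h; rewrite -(subrKA (Y k v)) (le_trans (nrmD _ _))//.
rewrite [leRHS](_ : _ = (p k.+1 - p k) * nrm v + (p k - p n) * nrm v); last by ring.
by apply: lerD => //; exact: sqrt_iter_step.
Qed.

Lemma sqrt_exists : exists Z : {linear H -> H},
  [/\ opbound Z 1, forall u v, <|Z u, v|> = <|u, Z v|>,
      forall v, 0 <= Re <|Z v, v|>
    & forall v, (v - Z v) - Z (v - Z v) = S (T v)].
Proof.
have Yb n v : nrm (Y n v) <= 1 * nrm v.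
  rewrite (le_trans (sqrt_iter_bound _ _))// ler_wpM2r ?nrm_ge0//.
  by have /andP[] := sqrt_bound01 n.
have cY v : exists l, tends (fun n => Y n v) l.
  apply: hilbert_complete => e e0.
  have v0 : 0 < nrm v + 1 by rewrite ltr_wpDl ?nrm_ge0.
  have p1 n : p n <= 1 by have /andP[] := sqrt_bound01 n.
  have [N hN] := nondecreasing_cauchy sqrt_bound_le p1 (divr_gt0 e0 v0).
  have main n k : (N <= n)%N -> (n <= k)%N -> nrm (Y k v - Y n v) < e.
    move=> hn hk; rewrite (le_lt_trans (sqrt_iter_dist v hk))//.
    have h := hN k n (leq_trans hn hk) hn.
    rewrite (@le_lt_trans _ _ (`|p k - p n| * (nrm v + 1)))//.
      rewrite ler_pM ?nrm_ge0 ?ler_norm ?lerDl// subr_ge0.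
      by rewrite (homo_leq (@lexx _ R) (@le_trans _ R) sqrt_bound_le).
    by rewrite -ltr_pdivlMr.
  exists N => n k hn hk; have [nk|kn] := leqP n k; first by rewrite nrmBC main.
  by apply: main => //; exact: ltnW.
have [f hf] := choice cY.
have [|Z hZ] := @linear_mk _ _ f.
  move=> c u v; apply: tends_uniq (hf _) _.
  apply: (@tends_ext _ _ (fun n => c *: Y n u + Y n v)).
    by move=> n; rewrite linearP.
  apply: tendsD => //; apply: (tends_map (f := fun w : H => c *: w) (M := nrm c) _ (hf u)).
  by move=> w w'; rewrite -scalerBr nrmZ.
have tZ v : tends (fun n => Y n v) (Z v) by rewrite hZ.
have Z1 : opbound Z 1 by move=> v; exact: le_tends_nrm (tZ v) (Yb^~ v).
exists Z; split => //.
- move=> u v; apply: tends_uniq (tends_dotl v (tZ u)) _.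
  by apply: tends_ext (tends_dotr u (tZ v)) => n; rewrite sqrt_iter_sym.
- move=> v; rewrite leNgt; apply/negP => h.
  have h0 : 0 < - Re <|Z v, v|> by rewrite oppr_gt0.
  have [N /(_ N (leqnn _))] := tends_dotl v (tZ v) h0.
  apply/negP; rewrite -leNgt (le_trans _ (Re_le_nrm _))// (le_trans _ (ler_norm _))//.
  by rewrite raddfB /= lerDr sqrt_iter_ge0.
- move=> v; have tYY : tends (fun n => Y n (Y n v)) (Z (Z v)).
    move=> e e0; have e2 : 0 < e / 2 by rewrite divr_gt0.
    have [N hN] := tZ v _ e2; have [k hk] := tZ (Z v) _ e2.
    exists (maxn N k) => n; rewrite geq_max => /andP[/hN h1 /hk h2].
    rewrite -(subrKA (Y n (Z v))) (le_lt_trans (nrmD _ _))// [e]splitr ltrD//.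
    by rewrite -linearB (le_lt_trans (Yb _ _))// mul1r.
  have : Z v = 2^-1 *: (v - S (T v) + Z (Z v)).
    have tS : tends (fun n => Y n.+1 v) (Z v) by apply: (tends_sub _ (tZ v)).
    apply: tends_uniq tS _.
    apply: (tends_ext (u := fun n => 2^-1 *: (v - S (T v) + Y n (Y n v)))) => //.
    apply: (tends_map (f := fun w : H => 2^-1 *: w) (M := nrm (2^-1 : R[i]))).
      by move=> w w'; rewrite -scalerBr nrmZ.
    by apply: tendsD => //; exact: tends_cst.
  move=> /(congr1 (fun w => 2 *: w)); rewrite scalerA divff ?pnatr_eq0// scale1r.
  rewrite scaler_nat mulr2n => h.
  rewrite linearB opprB addrACA -opprD h; apply/eqP; rewrite subr_eq.
  by rewrite addrA [S (T v) + _]addrC subrK.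
Qed.

End SquareRoot.

Lemma tends_sum (R : realType) n (u : 'I_n -> nat -> R[i]) (l : 'I_n -> R[i]) :
  (forall j, tends (u j) (l j)) ->
  tends (fun k => \sum_(j < n) u j k) (\sum_(j < n) l j).
Proof.
elim: n u l => [|n IH] u l h.
  by rewrite big_ord0; apply: tends_ext (tends_cst _) => k; rewrite big_ord0.
rewrite big_ord_recr /=; apply: tends_ext (tendsD (IH _ _ (fun j => h _)) (h ord_max)) => k.
by rewrite big_ord_recr.
Qed.

Section Nuclear.
Variables (R : realType) (H : hilbertType R) (e : nat -> H).
Hypothesis he : orthonormal_basis e.
Variables (d : nat -> R[i]) (b : nat -> H) (D M : R).
Hypotheses (hD : forall n, \sum_(i < n) nrm (d i) <= D) (hM : forall i, nrm (b i) <= M).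

Let D0 : 0 <= D. Proof. by have := hD 0%N; rewrite big_ord0. Qed.
Let M0 : 0 <= M. Proof. exact: le_trans (nrm_ge0 _) (hM 0%N). Qed.

Lemma sum_sqr_le n (f : 'I_n -> R) : (forall i, 0 <= f i) ->
  \sum_(i < n) f i ^+ 2 <= (\sum_(i < n) f i) ^+ 2.
Proof.
elim: n f => [|n IH] f f0; first by rewrite !big_ord0 expr0n.
rewrite !big_ord_recr /= sqrrD lerD2r (le_trans (IH _ _))// lerDl mulrn_wge0//.
by rewrite mulr_ge0// sumr_ge0.
Qed.

Lemma nuclear_coef_bound v n :
  \sum_(i < n) nrm (d i * <|v, b i|>) ^+ 2 <= (D * M * nrm v) ^+ 2.
Proof.
apply: le_trans (sum_sqr_le _) _ => [i|]; first exact: nrm_ge0.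
rewrite ler_sqr ?nnegrE ?mulr_ge0 ?nrm_ge0 ?sumr_ge0// => [|i _]; last exact: nrm_ge0.
apply: (@le_trans _ _ (\sum_(i < n) nrm (d i) * (M * nrm v))).
  apply: ler_sum => i _; rewrite nrmM ler_wpM2l ?nrm_ge0//.
  by rewrite (le_trans (dot_le _ _))// mulrC ler_wpM2r ?nrm_ge0.
by rewrite -mulr_suml -mulrA ler_wpM2r ?mulr_ge0 ?nrm_ge0.
Qed.

Lemma nuclear_exists : exists2 T : {linear H -> H},
  (forall v i, <|T v, e i|> = d i * <|v, b i|>) & opbound T (D * M).
Proof.
apply: (coef_map he (g := fun v i => d i * <|v, b i|>)); first exact: mulr_ge0.
  by move=> i c u v; rewrite dotDl dotZl mulrDr mulrCA.
by move=> v n; exact: nuclear_coef_bound.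
Qed.

Variable T : {linear H -> H}.
Hypothesis hT : forall v i, <|T v, e i|> = d i * <|v, b i|>.

Lemma nuclear_bound : opbound T (D * M).
Proof.
move=> v; rewrite -ler_sqr ?nnegrE ?mulr_ge0 ?nrm_ge0//.
apply: (nrm_le_coef he) => n; under eq_bigr do rewrite hT.
exact: nuclear_coef_bound.
Qed.

Lemma nuclear_dot u v :
  tends (fun n => \sum_(i < n) d i * <|u, b i|> * <|v, e i|>^*) <|T u, v|>.
Proof.
by apply: tends_ext (parseval he (T u) v) => n; apply: eq_bigr => i _; rewrite hT.
Qed.

Lemma nuclear_pairing_bound (W : {linear H -> H}) c N : opbound W c -> 
  nrm (\sum_(j < N) <|T (e j), W (e j)|>) <= D * (M ^+ 2 + c ^+ 2).
Proof.
move=> hW; have [W' adj hW'] := adjoint_exists he hW.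
have c0 : 0 <= c.
  have := hW (e 0%N); rewrite (nrm_basis he).
  by rewrite mulr1; apply: le_trans; exact: nrm_ge0.
apply: (le_tends_nrm (tends_sum (fun j : 'I_N => nuclear_dot (e j) (W (e j))))) => n.
rewrite exchange_big /=.
apply: (@le_trans _ _ (\sum_(i < n) nrm (d i) * (M ^+ 2 + c ^+ 2))); last first.
  by rewrite -mulr_suml ler_wpM2r ?addr_ge0 ?sqr_ge0.
apply: le_trans (nrm_sum _) _; apply: ler_sum => i _.
under eq_bigr do rewrite -mulrA.
rewrite -mulr_sumr nrmM ler_wpM2l ?nrm_ge0//.
apply: le_trans (nrm_sum _) _.
apply: (@le_trans _ _ (\sum_(j < N) (nrm <|b i, e j|> ^+ 2 + nrm <|W' (e i), e j|> ^+ 2))).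
  apply: ler_sum => j _; rewrite nrmM adj !nrmJ [<|e j, b i|>]dotC [<|e j, W' (e i)|>]dotC !nrmJ.
  have := sqr_ge0 (nrm <|b i, e j|> - nrm <|W' (e i), e j|>).
  have := nrm_ge0 <|b i, e j|>; have := nrm_ge0 <|W' (e i), e j|>; nra.
rewrite big_split /= lerD// (le_trans (bessel he _ _))// ler_sqr ?nnegrE ?nrm_ge0//.
by have := hW' (e i); rewrite (nrm_basis he) mulr1.
Qed.

Lemma nuclear_trace L :
  tends (fun n => \sum_(i < n) d i * <|e i, b i|>) L ->
  forall e', orthonormal_basis e' -> has_sum (fun n => <|T (e' n), e' n|>) L.
Proof.
move=> hL e' he'; apply/has_sum_tends => r r0.
pose t i N := \sum_(n < N) <|e i, e' n|> * <|b i, e' n|>^*.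
have tM i N : nrm (t i N) <= 1 + M ^+ 2.
  apply: le_trans (nrm_sum _) _.
  apply: (@le_trans _ _ (\sum_(j < N) (nrm <|e i, e' j|> ^+ 2 + nrm <|b i, e' j|> ^+ 2))).
    apply: ler_sum => j _; rewrite nrmM nrmJ.
    have := sqr_ge0 (nrm <|e i, e' j|> - nrm <|b i, e' j|>).
    have := nrm_ge0 <|e i, e' j|>; have := nrm_ge0 <|b i, e' j|>; nra.
  rewrite big_split /= lerD// (le_trans (bessel he' _ _))//.
    by rewrite (nrm_basis he) expr1n.
  by rewrite ler_sqr ?nnegrE ?nrm_ge0.
have tl i : tends (t i) <|e i, b i|> by exact: (parseval he').
have hS N : tends (fun I => \sum_(i < I) d i * t i N) (\sum_(n < N) <|T (e' n), e' n|>).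
  apply: tends_ext (tends_sum (fun j : 'I_N => nuclear_dot (e' j) (e' j))) => I.
  rewrite exchange_big /=; apply: eq_bigr => i _; rewrite mulr_sumr.
  apply: eq_bigr => j _; rewrite -mulrA; congr (_ * _).
  by rewrite mulrC -(dotC (e i)) [<|e' j, b i|>]dotC.
pose K := 2 * (1 + M ^+ 2) + 1.
have K0 : 0 < K by rewrite /K; have := sqr_ge0 M; lra.
pose Sd n := \sum_(i < n) nrm (d i).
have Sdnd n : Sd n <= Sd n.+1 by rewrite /Sd big_ord_recr /= lerDl nrm_ge0.
have [|N1 hN1] := nondecreasing_cauchy Sdnd hD (e := r / 3 / K); first by rewrite !divr_gt0.
have r3 : 0 < r / 3 by rewrite divr_gt0.
have [N2 hN2] := hL _ r3; pose I0 := maxn N1 N2.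
have : tends (fun N => \sum_(i < I0) d i * t i N) (\sum_(i < I0) d i * <|e i, b i|>).
  by apply: tends_sum => i; apply: tendsZ; exact: tl.
move=> /(_ _ r3)[N3 hN3]; exists N3 => N hN.
have h3 := hN3 _ hN; have h2 := hN2 I0 (leq_maxr _ _).
rewrite -(subrKA (\sum_(i < I0) d i * t i N)) (le_lt_trans (nrmD _ _))//.
rewrite -(subrKA (\sum_(i < I0) d i * <|e i, b i|>) (\sum_(i < I0) d i * t i N)).
have h1 : nrm (\sum_(n < N) <|T (e' n), e' n|> - \sum_(i < I0) d i * t i N) <= r / 3.
  have hS' : tends (fun I => \sum_(i < (I0 + I)%N) d i * t i N - \sum_(i < I0) d i * t i N)
     (\sum_(n < N) <|T (e' n), e' n|> - \sum_(i < I0) d i * t i N).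
    apply: tendsB (tends_cst _).
    by apply: (tends_sub (f := fun I => (I0 + I)%N)) (hS N) => I; exact: leq_addl.
  apply: (le_tends_nrm hS') => I; rewrite big_split_ord /= addrAC subrr add0r.
  apply: le_trans (nrm_sum _) _.
  apply: (@le_trans _ _ (\sum_(i < I) nrm (d (I0 + i)%N) * K)).
    apply: ler_sum => i _; rewrite nrmM ler_wpM2l ?nrm_ge0// (le_trans (tM _ _))// /K.
    by have := sqr_ge0 M; lra.
  rewrite -mulr_suml -ler_pdivlMr// ltW//.
  have := hN1 (I0 + I)%N I0 (leq_trans (leq_maxl _ _) (leq_addr _ _)) (leq_maxl _ _).
  rewrite /Sd big_split_ord /= addrAC subrr add0r ger0_norm// sumr_ge0// => i _; exact: nrm_ge0.
rewrite (le_lt_trans (lerD h1 (nrmD _ _)))//; lra.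
Qed.

Lemma nuclear_trace_class : trace_class (graph_of T).
Proof.
have hTb := nuclear_bound.
pose C := D * M + 1.
have C0 : 0 < C by rewrite /C ltr_wpDl// mulr_ge0.
have [Ta adj hTa] := adjoint_exists he hTb.
have sc (A : {linear H -> H}) : opbound A (D * M) ->
    exists2 B : {linear H -> H}, (forall v, B v = (C^-1)%:C *: A v) & opbound B 1.
  move=> hA; exists [the {linear H -> H} of (C^-1)%:C \*: A] => // v.
  rewrite /= nrmZ nrmR ger0_norm ?invr_ge0 ?(ltW C0)// mul1r.
  rewrite mulrC ler_pdivrMr// (le_trans (hA v))// mulrC ler_wpM2l ?nrm_ge0//.
  by rewrite lerDl.
have [T1 T1E T1b] := sc _ hTb; have [S1 S1E S1b] := sc _ hTa.
have adj1 u v : <|T1 u, v|> = <|u, S1 v|>.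
  by rewrite T1E S1E dotZl dotZr conjR adj.
have [Y [Y1 Ysym Ypos hY]] := sqrt_exists adj1 T1b S1b.
have [Z ZE] : exists Z : {linear H -> H}, forall v, Z v = v - Y v.
  by exists [the {linear H -> H} of idfun \- Y].
have Zsym u v : <|Z u, v|> = <|u, Z v|> by rewrite !ZE dotBl dotBr Ysym.
have hZ v : Z (Z v) = S1 (T1 v) by rewrite -hY !ZE.
have YZ v : Y (Z v) = Z (Y v) by rewrite !ZE linearB.
have nT1 v : nrm (T1 v) = nrm (Z v).
  apply/eqP; rewrite -(@eqrXn2 _ 2) ?nrm_ge0// -(inj_eq (@complexI R)).
  by rewrite -!dotuu adj1 -hZ Zsym.
have [P PE] : exists P : {linear H -> H}, forall v, P v = C%:C *: Z v.
  by exists [the {linear H -> H} of C%:C \*: Z].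
have Zpos v : 0 <= <|Z v, v|>.
  rewrite lecE; apply/andP; split.
    apply/eqP; have := Zsym v v; rewrite [RHS]dotC => /(congr1 (@complex.Im R)).
    by case: <|Z v, v|> => x y /=; lra.
  rewrite ZE dotBl dotuu raddfB /= subr_ge0 (le_trans (ler_norm _))//.
  rewrite (le_trans (Re_le_nrm _))// (le_trans (dot_le _ _))// expr2 ler_wpM2r ?nrm_ge0//.
  by have := Y1 v; rewrite mul1r.
exists T; split => //; first exact: opbound_continuous hTb.
exists P; split.
  split.
  - apply: (opbound_continuous (M := C * 2)) => v; rewrite PE nrmZ nrmR gtr0_norm//.
    rewrite -mulrA ler_wpM2l ?(ltW C0)// ZE (le_trans (nrmB _ _))//.
    by have := Y1 v; lra.
  - by move=> v; rewrite PE dotZl mulr_ge0 ?Zpos// ler0c ltW.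
  - move=> u v; have TE w : T w = C%:C *: T1 w.
      by rewrite T1E scalerA -rmorphM /= divff ?scale1r// gt_eqF.
    rewrite !TE !PE linearZ /= !dotZl dotZr conjR hZ.
    by rewrite (dotC (S1 (T1 u))) -adj1 -dotC.
exists e => //.
pose K := C^-1 * (D * (M ^+ 2 + 2 ^+ 2)).
pose g k v := \sum_(i < k) iter i Y v.
have Zg k v : Z (g k v) = v - iter k Y v.
  rewrite /g; elim: k => [|k IH]; first by rewrite big_ord0 linear0 subrr.
  by rewrite big_ord_recr /= linearD IH ZE addrA addrNK.
have iterY1 k v : nrm (iter k Y v) <= nrm v.
  elim: k => //= k IH; apply: le_trans IH; have := Y1 (iter k Y v); by rewrite mul1r.
have iterYsym k u v : <|iter k Y u, v|> = <|u, iter k Y v|>.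
  by elim: k u v => //= k IH u v; rewrite Ysym IH -iterSr.
have iterYZ k v : Z (iter k Y v) = iter k Y (Z v).
  by elim: k => //= k IH; rewrite -YZ IH.
have iterYpos k v : 0 <= Re <|iter k Y v, v|>.
  rewrite -(odd_double_half k) -addnn; case: (odd k); rewrite ?add1n ?add0n.
    by rewrite iterS iterD -iterS iterSr iterYsym Ypos.
  by rewrite iterD iterYsym dotuu /= sqr_ge0.
have glin k c u v : g k (c *: u + v) = c *: g k u + g k v.
  rewrite /g scaler_sumr -big_split; apply: eq_bigr => i _.
  by elim: (val i) => //= n ->; rewrite linearP.
have step k v : (k.+1)%:R * Re <|Z (iter k Y v), v|> <= 2 * nrm v ^+ 2.
  pose z i := Re <|Z (iter i Y v), v|>.
  have YE w : Y w = w - Z w by rewrite ZE subKr.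
  have zd i : z i.+1 <= z i.
    rewrite /z iterS YE linearB dotBl raddfB /= lerBlDr lerDl.
    by rewrite Zsym iterYZ iterYpos.
  apply: (@le_trans _ _ (\sum_(i < k.+1) z i)).
    rewrite -[k.+1 in leLHS]card_ord mulr_natl -sumr_const ler_sum// => i _.
    have /nonincreasing_seqP zn := zd; apply: zn; rewrite -ltnS; exact: ltn_ord.
  rewrite /z -raddf_sum -dot_suml -linear_sum -/(g k.+1 v) Zg dotBl dotuu raddfB /=.
  rewrite mulr_natl mulr2n lerD2l -raddfN /=.
  rewrite (le_trans (ler_norm _))// (le_trans (Re_le_nrm _))// nrmN.
  by rewrite (le_trans (dot_le _ _))// expr2 ler_wpM2r ?nrm_ge0//; exact: (iterY1 k.+1).
have main N : \sum_(j < N) Re <|Z (e j), e j|> <= K.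
  apply/ler_addgt0Pr => r r0.
  have [k hk] : exists k, 2 * N%:R / r <= k.+1%:R.
    exists (Num.bound (2 * N%:R / r)); apply: ltW; apply: lt_trans (archi_boundP _) _.
      by rewrite divr_ge0 ?mulr_ge0// ltW.
    by rewrite ltr_nat.
  have [W hW] : exists W : {linear H -> H}, W =1 (fun v => T1 (g k v)).
    by apply: linear_mk => c u v; rewrite glin linearP.
  have bW : opbound W 2.
    move=> v; rewrite hW nT1 Zg (le_trans (nrmB _ _))//.
    by have := iterY1 k v; lra.
  have pb := nuclear_pairing_bound N bW.
  have eqj j : Re <|Z (e j), e j|> =
      C^-1 * Re <|T (e j), W (e j)|> + Re <|Z (iter k Y (e j)), e j|>.
    have -> : C^-1 * Re <|T (e j), W (e j)|> = Re <|W (e j), T1 (e j)|>.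
      rewrite T1E dotZr conjR (dotC (T (e j))).
      by case: <|W (e j), T (e j)|> => x y /=; rewrite mul0r subr0.
    by rewrite hW adj1 -hZ -!Zsym Zg linearB dotBl raddfB addrNK.
  under eq_bigr do rewrite eqj.
  rewrite big_split /= -mulr_sumr -raddf_sum lerD//.
    rewrite /K ler_wpM2l ?invr_ge0 ?(ltW C0)// (le_trans _ pb)//.
    by rewrite (le_trans (ler_norm _))// Re_le_nrm.
  apply: (@le_trans _ _ (\sum_(j < N) 2 / k.+1%:R)).
    apply: ler_sum => j _; rewrite ler_pdivlMr// mulrC (le_trans (step _ _))//.
    by rewrite (nrm_basis he) expr1n mulr1.
  rewrite sumr_const card_ord -[_ *+ N]mulr_natr mulrAC ler_pdivrMr//.
  by rewrite -ler_pdivrMl// mulrC.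
have [|s hs] := @abs_summable _ _ _ he (fun n => <|P (e n), e n|>) (C * K).
  move=> n; under eq_bigr do rewrite PE dotZl nrmM nrmR gtr0_norm//.
  rewrite -mulr_sumr ler_wpM2l ?(ltW C0)// (le_trans _ (main n))// ler_sum// => i _.
  by rewrite [leLHS]/nrm ger0_norm ?Zpos.
by exists s; apply/has_sum_tends.
Qed.

End Nuclear.

(** * Functional calculus of diagonal operators *)

Section DiscreteMeasure.
Variables (d : measure_display) (T : measurableType d) (R : realType).
Variables (lam : nat -> T) (w : nat -> R).
Hypothesis w0 : forall i, 0 <= w i.
Local Open Scope ereal_scope.

Lemma nneseries_real (a : nat -> R) M : (forall i, (0 <= a i)%R) ->
  (forall n, (\sum_(i < n) a i <= M)%R) ->
  cvgn (fun n => (\sum_(i < n) a i)%R) /\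
  \sum_(0 <= i <oo) (a i)%:E = (limn (fun n => (\sum_(i < n) a i)%R))%:E.
Proof.
move=> a0 hM; have c : cvgn (fun n => (\sum_(i < n) a i)%R).
  apply: nondecreasing_is_cvgn; last by exists M => _ [n _ <-].
  by apply/nondecreasing_seqP => n; rewrite big_ord_recr /= lerDl.
split => //; rewrite -EFin_lim//; congr (lim (_ @ \oo)).
by apply/funext => n /=; rewrite big_mkord sumEFin.
Qed.

Variable mu : {measure set T -> \bar R}.
Hypothesis hmu : forall B, measurable B ->
  mu B = \sum_(0 <= i <oo) (w i)%:E * \d_(lam i) B.

Lemma discrete_ge0_integral (f : T -> R) :
  measurable_fun setT f -> (forall x, (0 <= f x)%R) ->
  \int[mu]_(x in setT) (f x)%:E = \sum_(0 <= i <oo) (w i * f (lam i))%:E.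
Proof.
move=> mf f0.
have mf' : measurable_fun setT (EFin \o f) by exact/measurable_EFinP.
pose m_ i := [the {measure set T -> \bar R} of
  mscale (NngNum (w0 i)) (dirac (lam i))].
rewrite (eq_measure_integral (mseries m_ 0)) => [|A mA _]; last by rewrite hmu.
rewrite ge0_integral_measure_series//; last by move=> t _; rewrite lee_fin.
apply: eq_eseriesr => i _; rewrite ge0_integral_mscale//; last first.
  by move=> t _; rewrite lee_fin.
by rewrite integral_dirac// diracT mul1e -EFinM.
Qed.

Lemma discrete_integrable (f : T -> R) :
  measurable_fun setT f -> (forall x, (0 <= f x)%R) ->
  \int[mu]_(x in setT) (f x)%:E < +oo <->
  exists M, forall n, (\sum_(i < n) w i * f (lam i) <= M)%R.
Proof.
move=> mf f0; rewrite discrete_ge0_integral//.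
have a0 i : (0 <= w i * f (lam i))%R by rewrite mulr_ge0.
split=> [h|[M hM]]; last by have [_ ->] := nneseries_real a0 hM; rewrite ltry.
set S := \sum_(0 <= i <oo) _ in h.
have S0 : 0 <= S by apply: nneseries_ge0 => n _ _; rewrite lee_fin.
exists (fine S) => n; rewrite -lee_fin fineK ?ge0_fin_numE//.
rewrite -sumEFin -(big_mkord xpredT (fun i => (w i * f (lam i))%:E)).
by apply: nneseries_lim_ge => k _ _; rewrite lee_fin.
Qed.

Lemma discrete_Rintegral (f : T -> R) M : measurable_fun setT f ->
  (forall n, (\sum_(i < n) w i * `|f (lam i)| <= M)%R) ->
  (fun n => \sum_(i < n) w i * f (lam i))%R @ \oo --> (\int[mu]_(x in setT) f x)%R.
Proof.
move=> mf hM.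
pose fp x := Num.max (f x) 0%R; pose fn x := Num.max (- f x)%R 0%R.
have mfp : measurable_fun setT fp by apply: measurable_funrpos.
have mfn : measurable_fun setT fn by apply: measurable_funrneg.
have fp0 x : (0 <= fp x)%R by rewrite le_max lexx orbT.
have fn0 x : (0 <= fn x)%R by rewrite le_max lexx orbT.
have bnd g : (forall x, (g x <= `|f x|)%R) ->
    forall n, (\sum_(i < n) w i * g (lam i) <= M)%R.
  by move=> hg n; apply: le_trans (hM n); apply: ler_sum => i _; rewrite ler_wpM2l.
have bp := bnd fp (fun x => _); have bn := bnd fn (fun x => _).
have [|cp Ep] := nneseries_real (fun i => mulr_ge0 (w0 i) (fp0 (lam i))) (bp _).
  by move=> x; rewrite ge_max ler_norm normr_ge0.
have [|cn En] := nneseries_real (fun i => mulr_ge0 (w0 i) (fn0 (lam i))) (bn _).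
  by move=> x; rewrite ge_max normr_ge0 andbT -normrN ler_norm.
rewrite /Rintegral integralE.
have -> : (fun x => (f x)%:E)^\+ = (fun x => (fp x)%:E).
  by apply/funext => x; rewrite funeposE /fp EFin_max.
have -> : (fun x => (f x)%:E)^\- = (fun x => (fn x)%:E).
  by apply/funext => x; rewrite funenegE /fn EFin_max.
rewrite !discrete_ge0_integral// Ep En -EFinB /=.
rewrite (_ : (fun n => _) = ((fun n => \sum_(i < n) w i * fp (lam i)) -
  (fun n => \sum_(i < n) w i * fn (lam i)))%R); first exact: cvgB.
apply/funext => n; rewrite fctE -sumrB; apply: eq_bigr => i _; rewrite -mulrBr; congr (_ * _)%R.
rewrite /fp /fn; have [h|h] := boolP (0 <= f (lam i))%R.
  by rewrite max_l// max_r ?subr0// oppr_le0.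
have {}h : (f (lam i) <= 0)%R by rewrite ltW// ltNge.
by rewrite max_r// max_l ?sub0r ?opprK// oppr_ge0.
Qed.

End DiscreteMeasure.

Lemma polarization_sum (R : realType) (a b : R[i]) :
  4%:R^-1 * \sum_(k < 4) 'i ^+ k * (nrm (a + 'i ^+ k * b) ^+ 2)%:C = a * b^*.
Proof.
have e2 : 'i ^+ 2 = -1 :> R[i] by exact: sqrCi.
have e3 : 'i ^+ 3 = - 'i :> R[i] by rewrite exprS e2 mulrN1.
have ci : 'i^* = - 'i :> R[i] by exact: conjCi.
have key (K : fieldType) (j x y x' y' : K) : (4 : K) != 0 -> j ^+ 2 = -1 ->
    4%:R^-1 * (0 + 1 * ((x + 1 * y) * (x' + 1 * y')) + j * ((x + j * y) * (x' + - j * y'))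
     + -1 * ((x + -1 * y) * (x' + -1 * y')) + - j * ((x + - j * y) * (x' + j * y'))) = x * y'.
  move=> c4 h; apply: (mulfI c4); rewrite mulVKf//.
  transitivity (2 * (x * y' + y * x') + (- 2 * j ^+ 2) * (x * y' - y * x')); first by ring.
  by rewrite h; ring.
rewrite !big_ord_recr big_ord0 /= -!mulcJ e3 e2 expr0 expr1.
rewrite !rmorphD !rmorphM /= !rmorphN !rmorph1 /= ci opprK.
by apply: key => //; rewrite pnatr_eq0.
Qed.

Section DiagonalSpectralMeasure.
Variables (R : realType) (H : hilbertType R) (e : nat -> H).
Hypothesis he : orthonormal_basis e.
Variables (lam : nat -> R) (E : spectralMeasure H).
Hypothesis hE : forall B : set R, measurable B ->
  forall i, sm_proj E B (e i) = (lam i \in B)%:R *: e i.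
Let T := measurableTypeR R.

Lemma diag_measE v (B : set T) : measurable B ->
  sm_meas E v B = (\sum_(0 <= i <oo) (nrm <|v, e i|> ^+ 2)%:E * \d_(lam i : T) B)%E.
Proof.
move=> mB; rewrite sm_measE//.
pose a i := nrm <|v, e i|> ^+ 2 * (lam i \in B)%:R.
have a0 i : 0 <= a i by rewrite mulr_ge0 ?sqr_ge0.
have hM n : \sum_(i < n) a i <= nrm v ^+ 2.
  apply: le_trans (bessel he n v); apply: ler_sum => i _; rewrite /a.
  by case: (_ \in _); rewrite ?mulr1 ?mulr0 ?sqr_ge0.
have [ca Ea] := nneseries_real a0 hM.
under eq_eseriesr do rewrite diracE -EFinM.
rewrite Ea; congr (_%:E); symmetry; apply/cvg_lim => //.
have h := tends_Re (parseval he (sm_proj E B v) v).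
suff -> : (fun n => \sum_(i < n) a i) =
  (fun n => Re (\sum_(i < n) <|sm_proj E B v, e i|> * <|v, e i|>^*)) by [].
apply/funext => n; rewrite raddf_sum; apply: eq_bigr => i _.
rewrite sm_sym// hE// dotZr -mulrA mulcJ /a mulrC.
by rewrite rmorph_nat; case: (_ \in _); rewrite ?mul1r ?mul0r.
Qed.

Variable g : R -> R[i].
Hypothesis mRe : measurable_fun [set: T] (fun x : T => Re (g x) : T).
Hypothesis mIm : measurable_fun [set: T] (fun x : T => Im (g x) : T).

Lemma diag_domE v : sm_dom E g v <->
  exists M, forall n, \sum_(i < n) nrm (g (lam i) * <|v, e i|>) ^+ 2 <= M.
Proof.
have w0 i : 0 <= nrm <|v, e i|> ^+ 2 by exact: sqr_ge0.
rewrite /sm_dom /=.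
have mf : measurable_fun [set: T] (fun x : T => (Re (g x)) ^+ 2 + (Im (g x)) ^+ 2 : T).
  by apply: measurable_funD; exact: measurable_funX.
have f0 (x : T) : 0 <= (Re (g x)) ^+ 2 + (Im (g x)) ^+ 2 by rewrite addr_ge0 ?sqr_ge0.
have := discrete_integrable w0 (@diag_measE v) mf f0.
have eqn n : \sum_(i < n) nrm <|v, e i|> ^+ 2 * (Re (g (lam i)) ^+ 2 + Im (g (lam i)) ^+ 2) =
    \sum_(i < n) nrm (g (lam i) * <|v, e i|>) ^+ 2.
  by apply: eq_bigr => i _; rewrite -sqr_nrm nrmM exprMn mulrC.
move=> [h1 h2]; split.
  by move=> /h1[M hM]; exists M => n; rewrite -eqn.
move=> [M hM]; apply: h2; exists M => n; rewrite eqn; exact: hM.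
Qed.

Lemma diag_cintegral v : sm_dom E g v ->
  tends (fun n => \sum_(i < n) g (lam i) * (nrm <|v, e i|> ^+ 2)%:C)
    (cintegral (sm_meas E v) g).
Proof.
move=> /diag_domE[M hM].
have w0 i : 0 <= nrm <|v, e i|> ^+ 2 by exact: sqr_ge0.
have bnd (f : R -> R) : (forall x, `|f x| <= nrm (g x)) -> forall n,
    \sum_(i < n) nrm <|v, e i|> ^+ 2 * `|f (lam i)| <= nrm v ^+ 2 + M.
  move=> hf n; apply: (@le_trans _ _ (\sum_(i < n) (nrm <|v, e i|> ^+ 2 +
    nrm (g (lam i) * <|v, e i|>) ^+ 2))); last first.
    by rewrite big_split /=; apply: lerD; [exact: (bessel he) | exact: hM].
  apply: ler_sum => i _; rewrite nrmM exprMn -[X in X + _]mul1r -mulrDl mulrC.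
  rewrite ler_wpM2r// (le_trans (hf _))//; have := nrm_ge0 (g (lam i)); nra.
apply: tends_ReIm.
  have := discrete_Rintegral w0 (@diag_measE v) mRe (bnd _ (fun x => Re_le_nrm (g x))).
  suff -> : (fun n => Re (\sum_(i < n) g (lam i) * (nrm <|v, e i|> ^+ 2)%:C)) =
    (fun n => \sum_(i < n) nrm <|v, e i|> ^+ 2 * Re (g (lam i))) by [].
  apply/funext => n; rewrite raddf_sum; apply: eq_bigr => i _.
  by case: (g _) => x y /=; ring.
have := discrete_Rintegral w0 (@diag_measE v) mIm (bnd _ (fun x => Im_le_nrm (g x))).
suff -> : (fun n => Im (\sum_(i < n) g (lam i) * (nrm <|v, e i|> ^+ 2)%:C)) =
  (fun n => \sum_(i < n) nrm <|v, e i|> ^+ 2 * Im (g (lam i))) by [].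
apply/funext => n; rewrite raddf_sum; apply: eq_bigr => i _.
by case: (g _) => x y /=; ring.
Qed.

Lemma diag_domZD c u v : sm_dom E g u -> sm_dom E g v -> sm_dom E g (u + c *: v).
Proof.
move=> /diag_domE[M hM] /diag_domE[N hN]; apply/diag_domE.
exists (2 * M + 2 * nrm c ^+ 2 * N) => n.
apply: (@le_trans _ _ (\sum_(i < n) (2 * nrm (g (lam i) * <|u, e i|>) ^+ 2 +
    2 * nrm c ^+ 2 * nrm (g (lam i) * <|v, e i|>) ^+ 2))).
  apply: ler_sum => i _; rewrite dotDl dotZl mulrDr mulrCA.
  have := nrmD (g (lam i) * <|u, e i|>) (c * (g (lam i) * <|v, e i|>)).
  rewrite (nrmM c); have := nrm_ge0 (g (lam i) * <|u, e i|> + c * (g (lam i) * <|v, e i|>)).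
  rewrite -mulrA -exprMn; move: (nrm (_ + _)) (nrm c * _) (nrm (_ * <|u, _|>)) => x y z x0 h.
  have : x ^+ 2 <= (z + y) ^+ 2 by rewrite ler_sqr ?nnegrE// (le_trans x0).
  have := sqr_ge0 (z - y); nra.
rewrite big_split /= -!mulr_sumr; apply: lerD; apply: ler_wpM2l => //.
- exact: hM.
- by rewrite mulr_ge0 ?sqr_ge0.
- exact: hN.
Qed.

Lemma diag_sm_integral v w : sm_integral E g (v, w) <->
  forall i, <|w, e i|> = g (lam i) * <|v, e i|>.
Proof.
pose form u := 4%:R^-1 * \sum_(k < 4)
  'i ^+ k * cintegral (sm_meas E (v + 'i ^+ k *: u)) g.
have formE u : sm_dom E g v -> sm_dom E g u ->
    tends (fun n => \sum_(i < n) g (lam i) * <|v, e i|> * <|u, e i|>^*) (form u).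
  move=> hv hu.
  have := tendsZ 4%:R^-1 (tends_sum (fun k : 'I_4 =>
    tendsZ ('i ^+ k) (diag_cintegral (diag_domZD ('i ^+ k) hv hu)))).
  apply: tends_ext => n; under eq_bigr do rewrite mulr_sumr.
  rewrite exchange_big mulr_sumr /=; apply: eq_bigr => i _.
  rewrite -mulrA -polarization_sum mulrCA; congr (_ * _); rewrite mulr_sumr.
  by apply: eq_bigr => k _; rewrite dotDl dotZl mulrCA.
have dome i : sm_dom E g (e i).
  apply/diag_domE; exists (nrm (g (lam i)) ^+ 2) => n.
  have <- : nrm (g (lam i) *: e i) = nrm (g (lam i)) by rewrite nrmZ (nrm_basis he) mulr1.
  apply: le_trans (bessel he n _); apply: ler_sum => j _; rewrite dotZl he.1.
  by case: eqP => [->|_]; rewrite ?mulr1 ?mulr0.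
split.
  move=> [/= hv hw] i; have := hw _ (dome i); rewrite -/(form (e i)) => ->.
  apply: (tends_uniq (formE _ hv (dome i))) => r r0; exists i.+1 => n hn.
  have := dot_orthonormal_sum n (fun j => g (lam j) * <|v, e j|>) i he.1.
  rewrite hn dot_suml => <-; under eq_bigr do rewrite -dotC -dotZl.
  by rewrite subrr nrm0.
move=> hw; have hv : sm_dom E g v.
  by apply/diag_domE; exists (nrm w ^+ 2) => n; under eq_bigr do rewrite -hw; exact: (bessel he).
split => //= u hu; rewrite -/(form u); apply: tends_uniq (formE _ hv hu).
by apply: tends_ext (parseval he w u) => n; apply: eq_bigr => i _; rewrite hw.
Qed.
End DiagonalSpectralMeasure.

Section PiecewiseProportional.
Variables (d : measure_display) (T : measurableType d) (R : realType).
Variables (mu nu : {measure set T -> \bar R}).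

Section OnePiece.
Variables (D : set T) (k : R).
Hypotheses (mD : measurable D) (k0 : 0 <= k).
Hypothesis hD : forall S, measurable S -> S `<=` D -> nu S = (k%:E * mu S)%E.

Lemma ge0_integral_proportional (f : T -> \bar R) : measurable_fun D f ->
  (forall x, D x -> (0 <= f x)%E) ->
  (\int[nu]_(x in D) f x = k%:E * \int[mu]_(x in D) f x)%E.
Proof.
move=> mf f0; rewrite -(ge0_integral_mscale mu mD (NngNum k0) mf f0).
exact: eq_measure_integral.
Qed.

Lemma integral_proportional (f : T -> R) : mu.-integrable D (EFin \o f) ->
  (\int[nu]_(x in D) (f x)%:E = k%:E * \int[mu]_(x in D) (f x)%:E)%E.
Proof.
move=> fi; have mf := measurable_int mu fi.
have mp := measurable_funepos mf; have mn := measurable_funeneg mf.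
rewrite [LHS]integralE [in RHS]integralE !ge0_integral_proportional//.
rewrite [RHS]muleBr//; apply: fin_num_adde_defl; rewrite fin_numN.
exact: integrable_neg_fin_num.
Qed.

End OnePiece.

Variables (B : set T) (k1 k2 : R).
Hypotheses (mB : measurable B) (k10 : 0 <= k1) (k20 : 0 <= k2).
Hypothesis hB : forall S, measurable S -> S `<=` B -> nu S = (k1%:E * mu S)%E.
Hypothesis hC : forall S, measurable S -> S `<=` ~` B -> nu S = (k2%:E * mu S)%E.
Hypothesis mu_fin : (mu setT < +oo)%E.
Variable f : T -> R.
Hypothesis mf : measurable_fun setT f.
Hypothesis f2 : (\int[mu]_x ((f x) ^+ 2)%:E < +oo)%E.

Lemma square_integrable_integrable : mu.-integrable setT (EFin \o f).
Proof.
have m2 : measurable_fun setT (fun x => ((f x) ^+ 2)%:E).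
  by apply/measurable_EFinP; exact: measurable_funX.
have m1 : measurable_fun setT (fun x => (1 + (f x) ^+ 2)%:E).
  by apply/measurable_EFinP; apply: measurable_funD => //; exact: measurable_funX.
apply: (@le_integrable _ _ _ _ _ measurableT _ (fun x => (1 + (f x) ^+ 2)%:E)).
- exact/measurable_EFinP.
- move=> x _ /=; rewrite lee_fin [leRHS]ger0_norm ?addr_ge0 ?sqr_ge0//.
  rewrite -(@real_normK _ (f x)) ?num_real//; have := normr_ge0 (f x); nra.
- apply/integrableP; split => //.
  under eq_integral do rewrite gee0_abs ?lee_fin ?addr_ge0 ?sqr_ge0// EFinD.
  rewrite ge0_integralD//; last by move=> x _; rewrite lee_fin sqr_ge0.
  by rewrite lte_add_pinfty// integral_cst// mul1e.
Qed.

Lemma piecewise_square_integrable : (\int[nu]_x ((f x) ^+ 2)%:E < +oo)%E.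
Proof.
have m2 : measurable_fun setT (fun x => ((f x) ^+ 2)%:E).
  by apply/measurable_EFinP; exact: measurable_funX.
have g0 x : (0 <= ((f x) ^+ 2)%:E)%E by rewrite lee_fin sqr_ge0.
rewrite -(setUv B) ge0_integral_setU ?setUv//; last 2 first.
- exact: measurableC.
- by apply/disj_setPS; rewrite setICr.
rewrite (@ge0_integral_proportional B k1)//; last exact: measurable_funTS.
rewrite (@ge0_integral_proportional (~` B) k2)//; last 2 first.
- exact: measurableC.
- exact: measurable_funTS.
have sub D : measurable D -> (\int[mu]_(x in D) ((f x) ^+ 2)%:E < +oo)%E.
  by move=> mD; apply: le_lt_trans f2; exact: ge0_subset_integral.
have fin D : measurable D -> (\int[mu]_(x in D) ((f x) ^+ 2)%:E \is a fin_num)%E.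
  by move=> mD; rewrite ge0_fin_numE ?sub// integral_ge0.
by rewrite lte_add_pinfty// lte_mul_pinfty// ?fin// ?lee_fin ?sub//; exact: measurableC.
Qed.

Lemma piecewise_Rintegral : \int[nu]_x f x =
  k1 * \int[mu]_(x in B) f x + k2 * \int[mu]_(x in ~` B) f x.
Proof.
have fi := square_integrable_integrable.
have fiD D : measurable D -> mu.-integrable D (EFin \o f).
  by move=> mD; apply: integrableS fi.
have fin D : measurable D -> (\int[mu]_(x in D) (f x)%:E \is a fin_num)%E.
  by move=> mD; apply: integrable_fin_num => //; exact: fiD.
have mC := measurableC mB.
rewrite /Rintegral -{1}(setUv B) integral_setU ?setUv//; last 2 first.
- exact/measurable_EFinP.
- by apply/disj_setPS; rewrite setICr.
rewrite (@integral_proportional B k1)//; last exact: fiD.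
rewrite (@integral_proportional (~` B) k2)//; last exact: fiD.
by rewrite fineD ?fin_numM ?fin// !fineM ?fin.
Qed.

End PiecewiseProportional.

Lemma positive_Rintegral_eq0 (d : measure_display) (T : measurableType d)
    (R : realType) (mu : {measure set T -> \bar R}) (B : set T) (g : T -> R) :
  measurable B -> mu.-integrable B (EFin \o g) -> (forall x, B x -> 0 < g x) ->
  \int[mu]_(x in B) g x = 0 -> mu B = 0%E.
Proof.
move=> mB gi g0 I0.
have I0' : (\int[mu]_(x in B) `|(g x)%:E| = 0)%E.
  transitivity (\int[mu]_(x in B) (g x)%:E)%E.
    by apply: eq_integral => x; rewrite inE => /g0/ltW h; rewrite gee0_abs ?lee_fin.
  have fin : (\int[mu]_(x in B) (g x)%:E)%E \is a fin_num by exact: integrable_fin_num.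
  by rewrite -(fineK fin); move: I0; rewrite /Rintegral => ->.
have mg : measurable_fun B (fun x => (g x)%:E) := measurable_int mu gi.
have [h _] := ae_eq_integral_abs mu mB mg; have [N [mN N0 hN]] := h I0'.
apply/eqP; rewrite eq_le measure_ge0 andbT -N0.
rewrite le_measure ?inE// => x Bx; apply: hN => /= /(_ Bx) [gx0].
by have := g0 x Bx; rewrite gx0 ltxx.
Qed.

Section SpectralEigenvector.
Variables (R : realType) (H : hilbertType R) (E : spectralMeasure H).
Let T := measurableTypeR R.
Implicit Types (u v w : H).

Lemma sm_meas_nrm v (B : set T) : measurable B ->
  sm_meas E v B = (nrm (sm_proj E B v) ^+ 2)%:E.
Proof.
move=> mB; rewrite sm_measE//; congr (_%:E).
have -> : <|sm_proj E B v, v|> = (nrm (sm_proj E B v) ^+ 2)%:C by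
  rewrite -dotuu !(sm_sym E mB) sm_idem.
by [].
Qed.

Lemma sm_proj_sub v (S B : set T) : measurable S -> measurable B ->
  S `<=` B -> sm_proj E S (sm_proj E B v) = sm_proj E S v.
Proof.
move=> mS mB SB; pose w := v - sm_proj E B v.
have wB : sm_meas E w B = 0%E.
  by rewrite sm_meas_nrm// /w linearB sm_idem// subrr nrm0 expr0n.
have : (sm_meas E w S <= 0)%E by rewrite -wB le_measure ?inE.
rewrite sm_meas_nrm// lee_fin /w linearB => h.
apply/esym/eqP; rewrite -subr_eq0; apply/eqP/nrm_eq0/eqP.
by rewrite -sqrf_eq0 eq_le h sqr_ge0.
Qed.

Lemma sm_proj_disj v (S B : set T) : measurable S -> measurable B ->
  S `<=` ~` B -> sm_proj E S (sm_proj E B v) = 0.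
Proof.
move=> mS mB SB; pose w := sm_proj E B v.
have wT : sm_meas E w setT = sm_meas E w B.
  by rewrite !sm_meas_nrm// sm_total /w sm_idem.
have : (sm_meas E w (S `|` B) <= sm_meas E w setT)%E.
  by rewrite le_measure ?inE//; exact: measurableU.
rewrite measureU//; last by rewrite -subset0 => x [/SB].
rewrite wT /= !sm_meas_nrm// -EFinD lee_fin gerDr => h.
apply/nrm_eq0/eqP; by rewrite -sqrf_eq0 eq_le h sqr_ge0.
Qed.

Section Eigenvector.
Variables (f : H) (l : R).
Hypothesis hf : sm_integral E (fun x => x%:C) (f, l%:C *: f).

Let mid : measurable_fun [set: T] (fun x : T => x : R).
Proof. by []. Qed.

Let f2 : (\int[sm_meas E f]_x (((x : R) ^+ 2)%:E) < +oo)%E.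
Proof.
case: hf => /= + _; rewrite /sm_dom /=.
by under eq_integral do rewrite expr0n addr0.
Qed.

Let ffin : (sm_meas E f setT < +oo)%E.
Proof. by rewrite sm_meas_nrm// ltry. Qed.

Lemma sm_meas_combination c (B S : set T) : measurable B -> measurable S ->
  S `<=` B ->
  sm_meas E (f + c *: sm_proj E B f) S = ((nrm (1 + c) ^+ 2)%:E * sm_meas E f S)%E.
Proof.
move=> mB mS SB; rewrite !sm_meas_nrm// linearD linearZ /= sm_proj_sub//.
by rewrite -[X in X + _]scale1r -scalerDl nrmZ exprMn EFinM.
Qed.

Lemma sm_meas_combinationC c (B S : set T) : measurable B -> measurable S ->
  S `<=` ~` B -> sm_meas E (f + c *: sm_proj E B f) S = (1%:E * sm_meas E f S)%E.
Proof.
move=> mB mS SB; rewrite !sm_meas_nrm// linearD linearZ /= sm_proj_disj//.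
by rewrite scaler0 addr0 mul1e.
Qed.

Lemma sm_dom_proj (B : set T) : measurable B -> sm_dom E (fun x => x%:C) (sm_proj E B f).
Proof.
move=> mB; rewrite /sm_dom /=; under eq_integral do rewrite expr0n addr0.
apply: (@piecewise_square_integrable _ T R (sm_meas E f) _ B 1 0) => //.
  by move=> S mS SB; rewrite !sm_meas_nrm// sm_proj_sub// mul1e.
by move=> S mS SB; rewrite !sm_meas_nrm// sm_proj_disj// nrm0 expr0n mul0e.
Qed.

Lemma sm_eigen_integral (B : set T) : measurable B ->
  \int[sm_meas E f]_(x in B) (x : R) = l * nrm (sm_proj E B f) ^+ 2.
Proof.
move=> mB; case: hf => /= _ /(_ _ (sm_dom_proj mB)).
pose I1 := \int[sm_meas E f]_(x in B) (x : R).
pose I2 := \int[sm_meas E f]_(x in ~` B) (x : R).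
have cI k : cintegral (sm_meas E (f + 'i ^+ k *: sm_proj E B f)) (fun x => x%:C) =
    (nrm (1 + 'i ^+ k * 1 : R[i]) ^+ 2 * I1 + I2)%:C.
  rewrite /cintegral /=; congr (_ +i* _); last by rewrite /Rintegral integral0.
  rewrite (@piecewise_Rintegral _ T R (sm_meas E f) _ B (nrm (1 + 'i ^+ k * 1 : R[i]) ^+ 2) 1)//.
  - by rewrite mul1r.
  - exact: sqr_ge0.
  - by move=> S mS SB; rewrite mulr1; exact: sm_meas_combination.
  - by move=> S mS SB; exact: sm_meas_combinationC.
under eq_bigr do rewrite cI.
have -> : \sum_(k < 4) 'i ^+ k * (nrm (1 + 'i ^+ k * 1 : R[i]) ^+ 2 * I1 + I2)%:C =
    (\sum_(k < 4) 'i ^+ k * (nrm (1 + 'i ^+ k * 1 : R[i]) ^+ 2)%:C) * I1%:C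
    + (\sum_(k < 4) 'i ^+ k) * I2%:C.
  rewrite !mulr_suml -big_split; apply: eq_bigr => k _ /=.
  by rewrite rmorphD rmorphM /= mulrDr mulrA.
have -> : \sum_(k < 4) 'i ^+ k = 0 :> R[i].
  have i2 : 'i ^+ 2 = -1 :> R[i] by exact: sqrCi.
  have i3 : 'i ^+ 3 = - 'i :> R[i] by rewrite exprS i2 mulrN1.
  by rewrite !big_ord_recr big_ord0 /= i3 i2 expr0 expr1 add0r addrAC addrK subrr.
rewrite mul0r addr0 mulrA polarization_sum rmorph1 !mul1r dotZl.
have -> : <|f, sm_proj E B f|> = (nrm (sm_proj E B f) ^+ 2)%:C.
  by rewrite -dotuu (sm_sym E mB) sm_idem.
by rewrite -rmorphM => /complexI.
Qed.

Lemma sm_eigen_null (B : set T) : measurable B ->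
  (forall x, B x -> 0 < x - l) \/ (forall x, B x -> 0 < l - x) ->
  sm_meas E f B = 0%E.
Proof.
move=> mB hB.
have fi : (sm_meas E f).-integrable setT (EFin \o (fun x : T => x : R)).
  exact: square_integrable_integrable.
have fiB : (sm_meas E f).-integrable B (EFin \o (fun x : T => x : R)).
  exact: integrableS fi.
have cB : sm_meas E f B = (nrm (sm_proj E B f) ^+ 2)%:E by exact: sm_meas_nrm.
have ciB : (sm_meas E f).-integrable B (EFin \o (fun x : T => l)).
  apply/integrableP; split; first exact: measurable_cst.
  by rewrite integral_cst// cB lte_mul_pinfty ?ltry.
have cE : \int[sm_meas E f]_(x in B) l = l * nrm (sm_proj E B f) ^+ 2.
  by rewrite Rintegral_cst// cB.
case: hB => hB.
  apply: (positive_Rintegral_eq0 (g := fun x : T => (x : R) - l)) => //.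
    exact: (integrableB mB fiB ciB).
  by rewrite RintegralB// sm_eigen_integral// cE subrr.
apply: (positive_Rintegral_eq0 (g := fun x : T => l - (x : R))) => //.
  exact: (integrableB mB ciB fiB).
by rewrite RintegralB// sm_eigen_integral// cE subrr.
Qed.

Lemma sm_eigen_proj (B : set T) : measurable B -> sm_proj E B f = (l \in B)%:R *: f.
Proof.
have null (S : set T) : measurable S -> ~ S l -> sm_proj E S f = 0.
  move=> mS lS; apply/nrm_eq0/eqP; rewrite -sqrf_eq0.
  have m1 : measurable (S `&` `]l, +oo[ : set T) by exact: measurableI.
  have m2 : measurable (S `&` `]-oo, l[ : set T) by exact: measurableI.
  have : (sm_meas E f S <= 0)%E.
    have SU : S = (S `&` `]l, +oo[) `|` (S `&` `]-oo, l[).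
      apply/seteqP; split => x /=; last by case => -[].
      move=> Sx; rewrite !in_itv /= andbT; case: (ltgtP x l) => h; [right|left|] => //.
      by exfalso; apply: lS; rewrite -h.
    have n1 : sm_meas E f (S `&` `]l, +oo[) = 0%E.
      by apply: sm_eigen_null => //; left => x [_]; rewrite /= in_itv /= andbT subr_gt0.
    have n2 : sm_meas E f (S `&` `]-oo, l[) = 0%E.
      by apply: sm_eigen_null => //; right => x [_]; rewrite /= in_itv /= subr_gt0.
    rewrite SU; apply: le_trans (measureU2 _ m1 m2) _.
    have -> : (0 = sm_meas E f (S `&` `]l, +oo[) + sm_meas E f (S `&` `]-oo, l[))%E.
      by rewrite n1 n2 adde0.
    exact: lexx.
  by rewrite sm_meas_nrm// lee_fin => h; rewrite eq_le h sqr_ge0.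
move=> mB; have [lB|lB] := boolP (l \in B); last first.
  by rewrite scale0r null// => Bl; move: lB; rewrite mem_set.
rewrite scale1r; have mC := measurableC mB.
have h0 : sm_proj E (~` B) f = 0 by apply: null => //; apply; exact: set_mem.
have hT : sm_meas E f setT = (sm_meas E f B + sm_meas E f (~` B))%E.
  by rewrite -measureU ?setUv ?setICr.
move: hT; rewrite !sm_meas_nrm// h0 nrm0 expr0n adde0 sm_total => -[hT].
apply/esym/eqP; rewrite -subr_eq0; apply/eqP/nrm_eq0/eqP.
rewrite -sqrf_eq0 nrm2D nrmN dotNr.
have -> : <|f, sm_proj E B f|> = (nrm (sm_proj E B f) ^+ 2)%:C.
  by rewrite -dotuu (sm_sym E mB) sm_idem.
by rewrite hT /=; apply/eqP; ring.
Qed.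

End Eigenvector.
End SpectralEigenvector.

Section FunctionalCalculus.
Variables (R : realType) (H : hilbertType R) (e : nat -> H) (lam : nat -> R).
Hypothesis he : orthonormal_basis e.
Let T := measurableTypeR R.

Lemma diag_proj_exists (B : set R) : exists P : {linear H -> H},
  forall v i, <|P v, e i|> = (lam i \in B)%:R * <|v, e i|>.
Proof.
have [||v n|P hP _] := coef_map he (g := fun v i => (lam i \in B)%:R * <|v, e i|>) (M := 1).
- exact: ler01.
- by move=> i c u v; rewrite dotDl dotZl mulrDr mulrCA.
- rewrite mul1r; apply: le_trans (bessel he n v); apply: ler_sum => i _.
  by case: (_ \in _); rewrite ?mul1r// mul0r nrm0 expr0n sqr_ge0.
by exists P.
Qed.

Lemma diag_spectral_measure : exists E : spectralMeasure H,
  forall B i, sm_proj E B (e i) = (lam i \in B)%:R *: e i.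
Proof.
have [P hP] := choice diag_proj_exists.
have w0 v i : 0 <= nrm <|v, e i|> ^+ 2 by exact: sqr_ge0.
pose m v i := [the {measure set T -> \bar R} of mscale (NngNum (w0 v i)) (dirac (lam i : T))].
pose mu v := [the {measure set T -> \bar R} of mseries (m v) 0].
have idem (B : set R) : measurable B -> forall v, P B (P B v) = P B v.
  move=> _ v; apply: (coef_inj he) => i; rewrite !hP.
  by case: (_ \in _); rewrite ?mul1r ?mul0r.
have sym (B : set R) : measurable B -> forall u v, <|P B u, v|> = <|u, P B v|>.
  move=> _ u v; apply: (tends_uniq (parseval he _ _)).
  apply: tends_ext (parseval he _ _) => n; apply: eq_bigr => i _; rewrite !hP.
  by rewrite rmorphM rmorph_nat /= mulrCA mulrA.
have tot v : P setT v = v.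
  by apply: (coef_inj he) => i; rewrite hP in_setT mul1r.
have measE v (B : set R) : measurable B -> mu v B = (Re <|P B v, v|>)%:E.
  move=> mB.
  pose a i := nrm <|v, e i|> ^+ 2 * (lam i \in B)%:R.
  have a0 i : 0 <= a i by rewrite mulr_ge0 ?sqr_ge0.
  have hM n : \sum_(i < n) a i <= nrm v ^+ 2.
    apply: le_trans (bessel he n v); apply: ler_sum => i _; rewrite /a.
    by case: (_ \in _); rewrite ?mulr1 ?mulr0 ?sqr_ge0.
  have [ca Ea] := nneseries_real a0 hM.
  transitivity (\sum_(0 <= i <oo) (a i)%:E)%E.
    by apply: eq_eseriesr => i _; rewrite /a EFinM -diracE.
  rewrite Ea; congr (_%:E); apply/cvg_lim => //.
  have h := tends_Re (parseval he (P B v) v).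
  suff -> : (fun n => \sum_(i < n) a i) =
    (fun n => Re (\sum_(i < n) <|P B v, e i|> * <|v, e i|>^*)) by [].
  apply/funext => n; rewrite raddf_sum; apply: eq_bigr => i _.
  rewrite hP -mulrA mulcJ /a mulrC.
  by case: (_ \in _); rewrite ?mul1r ?mul0r.
exists (SpectralMeasure idem sym tot measE) => B i /=.
apply: (coef_inj he) => j; rewrite hP dotZl he.1.
by case: eqP => [->|_]; rewrite ?mulr0.
Qed.

Definition diag_graph (g : nat -> R[i]) : set (H * H) :=
  [set p | forall i, <|p.2, e i|> = g i * <|p.1, e i|>].

Lemma fun_calc_diag (g : R -> R[i]) :
  measurable_fun [set: T] (fun x : T => Re (g x) : T) ->
  measurable_fun [set: T] (fun x : T => Im (g x) : T) ->
  fun_calc (diag_graph (fun i => (lam i)%:C)) g = diag_graph (fun i => g (lam i)).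
Proof.
move=> mRe mIm; apply/seteqP; split => -[v w].
  move=> [E hE hvw].
  have hEe (B : set R) : measurable B -> forall i, sm_proj E B (e i) = (lam i \in B)%:R *: e i.
    move=> mB i; apply: sm_eigen_proj => //.
    rewrite hE => j /=; rewrite dotZl he.1.
    by case: eqP => [->|_]; rewrite ?mulr0.
  by have [h _] := diag_sm_integral he hEe mRe mIm v w; exact: h.
have [E hE] := diag_spectral_measure; move=> hvw; exists E.
  have m1 : measurable_fun [set: T] (fun x : T => Re ((x : R)%:C) : T) by exact: measurable_id.
  have m2 : measurable_fun [set: T] (fun x : T => Im ((x : R)%:C) : T) by exact: measurable_cst.
  have h := diag_sm_integral he (fun B _ => hE B) (g := fun x => x%:C) m1 m2.
  by apply/seteqP; split => -[v' w'] /h.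
by have [_ h] := diag_sm_integral he (fun B _ => hE B) mRe mIm v w; exact: h.
Qed.

End FunctionalCalculus.

(** * The Heisenberg representation *)

Section CrossProductEmbeddings.
Variables (R : realType) (U : starAlgType R) (HU : hopfStar U).
Variables (A : starAlgType R) (m : modStarAlg HU A) (X : crossProduct m).

Lemma tens_linearl (c : R[i]) (u u' : U) (v : A) :
  (c *: u + u') ⊗ v = c *: (u ⊗ v) + u' ⊗ v.
Proof.
apply: tensor_ext => W b; rewrite tlift_tens tlift_add tlift_scale !tlift_tens.
by rewrite linearPl.
Qed.

Lemma tens_linearr (c : R[i]) (u : U) (v v' : A) :
  u ⊗ (c *: v + v') = c *: (u ⊗ v) + u ⊗ v'.
Proof.
apply: tensor_ext => W b; rewrite tlift_tens tlift_add tlift_scale !tlift_tens.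
by rewrite linearPr.
Qed.

Lemma inU_linear (c : R[i]) (f g : U) : inU X (c *: f + g) = c *: inU X f + inU X g.
Proof. by rewrite /inU tens_linearl linearP. Qed.

Lemma tens0r (u : U) : u ⊗ (0 : A) = 0.
Proof.
by have := tens_linearr (-1) u 0 0; rewrite scaleN1r oppr0 add0r scaleN1r addNr.
Qed.

Lemma tens0l (v : A) : (0 : U) ⊗ v = 0.
Proof.
by have := tens_linearl (-1) 0 0 v; rewrite scaleN1r oppr0 add0r scaleN1r addNr.
Qed.

Lemma tensZC (c : R[i]) (u : U) (v : A) : (c *: u) ⊗ v = u ⊗ (c *: v).
Proof.
have := tens_linearl c u 0 v; have := tens_linearr c u v 0.
by rewrite !addr0 tens0r tens0l !addr0 => -> ->.
Qed.

Section Product.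
Variables (g : U) (x y : A).

Definition cross2 (f1 f2 : U) : tensor U A := (g * f1) ⊗ (act m x f2 * y).

Lemma cross2_bilinear : bilinear_for *:%R *:%R cross2.
Proof.
split=> [w c u v|w c u v]; rewrite /cross2.
  by rewrite mulrDr -scalerAr tens_linearl.
by rewrite linearP mulrDl -scalerAl tens_linearr.
Qed.

HB.instance Definition _ :=
  bilinear_isBilinear.Build R[i] U U (tensor U A) *:%R *:%R cross2 cross2_bilinear.

Lemma crossME f : cross X (g ⊗ x) * cross X (f ⊗ y) =
  cross X (tlift cross2 (comul HU f)).
Proof. by rewrite crossM. Qed.

End Product.

Lemma tens_suml I (r : seq I) (F : I -> U) (v : A) :
  (\sum_(i <- r) F i) ⊗ v = \sum_(i <- r) (F i ⊗ v).
Proof.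
elim: r => [|i r IH]; rewrite ?big_nil ?big_cons.
  by have := tens_linearl (-1) 0 0 v; rewrite scaleN1r oppr0 add0r scaleN1r addNr.
by rewrite -[F i]scale1r tens_linearl IH !scale1r.
Qed.

Lemma inUM f g : inU X (f * g) = inU X f * inU X g.
Proof.
rewrite /inU crossME; congr (cross X _).
rewrite -{1}(counitr HU g) /tlift /tsum mulr_sumr tens_suml.
apply: eq_bigr => p _; rewrite /cross2 act_unit mulr1 -scalerAr.
by rewrite tensZC.
Qed.

End CrossProductEmbeddings.

Section Heisenberg.
Variables (R : realType) (q : R).
Hypotheses (hq0 : 0 < q) (hq1 : q < 1).
Variables (U : uqSU2 q) (A : oqSU2 q) (m : modStarAlg (uq_hopf U) A).
Hypothesis hm : is_suq2_action m.
Variable h : {linear A -> R[i]}.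
Hypothesis hh : is_haar m h.
Variables (X : crossProduct m) (H : hilbertType R).
Variables (pi_h : starRep A H) (v_h : H).
Hypothesis hgns : is_gns pi_h h v_h.
Variable pi_t : starRep X H.
Hypothesis hheis : is_heisenberg pi_h v_h pi_t.

Let s : R[i] := (q `^ 2^-1)%:C.
Let sp : 0 < s := sqrtq_gt0 hq0.
Let s0 : s != 0. Proof. by rewrite gt_eqF. Qed.
Let s2 : s ^+ 2 = q%:C := sqrtq_sqr hq0.
Let q0 : q%:C != 0 :> R[i]. Proof. by rewrite -s2 expf_neq0. Qed.

Local Notation E := (uqE U).
Local Notation F := (uqF U).
Local Notation K := (uqK U).
Local Notation Ki := (uqKi U).

Definition eta (x : A) : H := rep pi_h x v_h.
Definition rho (f : U) (u : H) : H := rep pi_t (inU X f) u.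
Definition hdom : set H := rep_dom pi_h.

Lemma hdom_eta x : hdom (eta x).
Proof. by case: hgns => hv _ _; exact: rep_stable. Qed.

Lemma hdomE u : hdom u -> exists x, u = eta x.
Proof. by case: hgns => _ hd _; rewrite /hdom hd => -[x _ <-]; exists x. Qed.

Lemma hdom_t u : hdom u -> rep_dom pi_t u.
Proof. by case: hheis => -> _ _. Qed.

Lemma hdom_lin c u v : hdom u -> hdom v -> hdom (c *: u + v).
Proof. exact: rep_domD. Qed.

Lemma hdom_rho f u : hdom u -> hdom (rho f u).
Proof. by case: hheis => hd _ _; rewrite /hdom -hd; exact: rep_stable. Qed.

Lemma eta_linear c x y : eta (c *: x + y) = c *: eta x + eta y.
Proof. by case: hgns => hv _ _; exact: rep_linearl. Qed.

Lemma eta0 : eta 0 = 0.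
Proof. by have := eta_linear (-1) 0 0; rewrite scaler0 addr0 scaleN1r addNr. Qed.

Lemma etaZ c x : eta (c *: x) = c *: eta x.
Proof. by rewrite -[c *: x]addr0 eta_linear eta0 addr0. Qed.

Lemma etaD x y : eta (x + y) = eta x + eta y.
Proof. by rewrite -[x]scale1r eta_linear !scale1r. Qed.

Lemma eta_sum n (f : 'I_n -> A) : eta (\sum_(i < n) f i) = \sum_(i < n) eta (f i).
Proof.
elim: n f => [|n IH] f; first by rewrite !big_ord0 eta0.
by rewrite !big_ord_recr /= etaD IH.
Qed.

Lemma rep_eta x y : rep pi_h x (eta y) = eta (x * y).
Proof. by case: hgns => hv _ _; rewrite /eta repM. Qed.

Lemma haarE x : h x = <|eta x, v_h|>.
Proof. by case: hgns => _ _ ->. Qed.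

Lemma eta1_neq0 : eta 1 != 0.
Proof.
apply/eqP => e1; have := haarE 1; rewrite e1 dot0l; case: hh => -> _.
by move/eqP; rewrite oner_eq0.
Qed.

Lemma rho_eta f x : rho f (eta x) = eta (act m x (antipodeI (uq_hopf U) f)).
Proof. by case: hheis => _ _ e; rewrite /rho /eta e. Qed.

Lemma rho_lin f c u v : hdom u -> hdom v -> rho f (c *: u + v) = c *: rho f u + rho f v.
Proof. by move=> /hdom_t hu /hdom_t hv; exact: rep_linear. Qed.

Lemma rho0 f : rho f 0 = 0.
Proof.
have h0 : hdom 0 by exact: rep_dom0.
by have := rho_lin f (-1) h0 h0; rewrite scaler0 addr0 scaleN1r addNr.
Qed.

Lemma rhoZ f c u : hdom u -> rho f (c *: u) = c *: rho f u.
Proof.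
move=> hu; have h0 : hdom 0 by exact: rep_dom0.
by rewrite -[c *: u]addr0 rho_lin// rho0 addr0.
Qed.

Lemma rho_linl c f g u : hdom u -> rho (c *: f + g) u = c *: rho f u + rho g u.
Proof. by move=> /hdom_t hu; rewrite /rho inU_linear rep_linearl. Qed.

Lemma rhoZl c f u : hdom u -> rho (c *: f) u = c *: rho f u.
Proof.
move=> hu; have r0 : rho 0 u = 0.
  by have := rho_linl (-1) 0 0 hu; rewrite scaler0 addr0 scaleN1r addNr.
by rewrite -[c *: f]addr0 rho_linl// r0 addr0.
Qed.

Lemma rhoDl f g u : hdom u -> rho (f + g) u = rho f u + rho g u.
Proof. by move=> hu; rewrite -[f]scale1r rho_linl// !scale1r. Qed.

Lemma rhoM f g u : hdom u -> rho (f * g) u = rho f (rho g u).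
Proof. by move=> /hdom_t hu; rewrite /rho inUM repM. Qed.

Lemma rho1 u : hdom u -> rho 1 u = u.
Proof. by move=> /hdom_t hu; rewrite /rho /inU cross1 rep1. Qed.

Lemma rho_adj f u v : hdom u -> hdom v -> <|rho f u, v|> = <|u, rho (star f) v|>.
Proof.
move=> /hdom_t hu /hdom_t hv; rewrite /rho rep_adj//; congr (<|_, rep pi_t _ _|>).
rewrite /inU cross_star; congr (cross X _).
have star1 : star (1 : A) = 1.
  by rewrite -[LHS]mul1r -[X in X * _](starK (1 : A)) -starM mul1r starK.
rewrite star1 /tlift /tsum -[in RHS](counitr (uq_hopf U) (star f)) /tlift /tsum tens_suml.
apply: eq_bigr => p _; rewrite act_unit.
by rewrite tensZC.
Qed.

Lemma rhoK_adj f u v : (f = K \/ f = Ki) -> hdom u -> hdom v ->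
  <|rho f u, v|> = <|u, rho f v|>.
Proof.
move=> hf hu hv; rewrite rho_adj//; congr (<|_, rho _ _|>).
have [KKi KiK _ _ _] := uqP U; have [_ sK] := uq_star U.
have star1 : star (1 : U) = 1.
  by rewrite -[LHS]mul1r -[X in X * _](starK (1 : U)) -starM mul1r starK.
case: hf => -> //; have : star Ki * K = 1 by rewrite -sK -starM KKi star1.
by move=> e; rewrite -[LHS]mulr1 -KKi mulrA e mul1r.
Qed.

Lemma rhoE_adj u v : hdom u -> hdom v -> <|rho E u, v|> = <|u, rho F v|>.
Proof. by move=> hu hv; rewrite rho_adj//; case: (uq_star U) => -> _. Qed.

Lemma rhoKi_eta x : rho Ki (eta x) = eta (act m x K).
Proof.
by rewrite rho_eta; have [_ _ <-] := uq_antipode U; rewrite antipodeK.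
Qed.

Lemma rhoF_eta x : rho F (eta x) = - q%:C *: eta (act m x F).
Proof.
rewrite rho_eta -etaZ; congr eta; rewrite -linearZr_LR /=; congr (act m x _).
have [_ hF _] := uq_antipode U; apply: (canLR (antipodeK (uq_hopf U))).
by rewrite linearZ /= hF scalerA mulrNN -rmorphM /= divff ?scale1r// gt_eqF.
Qed.

Lemma rhoE_eta x : rho E (eta x) = - q^-1%:C *: eta (act m x E).
Proof.
rewrite rho_eta -etaZ; congr eta; rewrite -linearZr_LR /=; congr (act m x _).
have [hE _ _] := uq_antipode U; apply: (canLR (antipodeK (uq_hopf U))).
by rewrite linearZ /= hE scalerA mulrNN -rmorphM /= mulVf ?scale1r// gt_eqF.
Qed.

Lemma rhoKKi u : hdom u -> rho K (rho Ki u) = u.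
Proof. by move=> hu; have [h1 _ _ _ _] := uqP U; rewrite -rhoM// h1 rho1. Qed.

Lemma rhoKiK u : hdom u -> rho Ki (rho K u) = u.
Proof. by move=> hu; have [_ h1 _ _ _] := uqP U; rewrite -rhoM// h1 rho1. Qed.

Lemma rhoKiF u : hdom u -> rho Ki (rho F u) = q%:C *: rho F (rho Ki u).
Proof.
move=> hu; have [_ KiK _ KF _] := uqP U.
have e : Ki * F = q%:C *: (F * Ki).
  have {1}-> : F = q%:C *: (K * F * Ki).
    by rewrite KF scalerA -rmorphM /= divff ?scale1r// gt_eqF.
  by rewrite -scalerAr !mulrA KiK mul1r.
by rewrite -rhoM// e rhoZl// rhoM.
Qed.

Lemma rhoEF u : hdom u ->
  rho E (rho F u) = rho F (rho E u) + (lam q)^-1 *: (rho K (rho K u) - rho Ki (rho Ki u)).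
Proof.
move=> hu; have [_ _ _ _ EF] := uqP U.
rewrite -!rhoM//; have -> : E * F = 1 *: (F * E) + (lam q)^-1 *: (K * K - Ki * Ki).
  by rewrite -!expr2 -EF scale1r addrC subrK.
rewrite rho_linl// scale1r rhoZl//; congr (_ + _ *: _).
by rewrite -scaleN1r addrC rho_linl// scaleN1r addrC.
Qed.

Lemma rho_casimir u : hdom u -> rho (casimir U) u = rho E (rho F u)
  + (lam q) ^- 2 *: (q^-1%:C *: rho K (rho K u) + q%:C *: rho Ki (rho Ki u) - 2%:R *: u).
Proof.
move=> hu; rewrite /casimir rhoDl// rhoM// rhoZl//; congr (_ + _ *: _).
have -> : - 2%:R = - 2%:R *: (1 : U) by rewrite scaleNr scaler_nat.
by rewrite !rhoDl// !rhoZl// !expr2 !rhoM// rho1// scaleNr.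
Qed.

End Heisenberg.

(** * Representations on strings of weight vectors *)

Record uq_operators (R : realType) (q : R) (H : hilbertType R) (D : set H)
    (E F K Ki : H -> H) : Prop := {
  uqo0 : D 0;
  uqoP : forall (c : R[i]) u v, D u -> D v -> D (c *: u + v);
  uqo_stable : forall u, D u -> [/\ D (E u), D (F u), D (K u) & D (Ki u)];
  uqo_linear : forall (c : R[i]) u v, D u -> D v ->
    [/\ E (c *: u + v) = c *: E u + E v, F (c *: u + v) = c *: F u + F v,
        K (c *: u + v) = c *: K u + K v & Ki (c *: u + v) = c *: Ki u + Ki v];
  uqoKKi : forall u, D u -> K (Ki u) = u;
  uqoKiK : forall u, D u -> Ki (K u) = u;
  uqoKiF : forall u, D u -> Ki (F u) = q%:C *: F (Ki u);
  uqoEF : forall u, D u ->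
    E (F u) = F (E u) + (lam q)^-1 *: (K (K u) - Ki (Ki u));
  uqoE_adj : forall u v, D u -> D v -> <|E u, v|> = <|u, F v|>;
  uqoK_adj : forall u v, D u -> D v -> <|K u, v|> = <|u, K v|>;
  uqoKi_adj : forall u v, D u -> D v -> <|Ki u, v|> = <|u, Ki v|>
}.

Section Strings.
Variables (R : realType) (q : R).
Hypotheses (hq0 : 0 < q) (hq1 : q < 1).
Variables (H : hilbertType R) (D : set H) (E F K Ki : H -> H).
Hypothesis ho : uq_operators q D E F K Ki.

Let s : R[i] := (q `^ 2^-1)%:C.
Let sp : 0 < s := sqrtq_gt0 hq0.
Let s0 : s != 0. Proof. by rewrite gt_eqF. Qed.
Let s2 : s ^+ 2 = q%:C := sqrtq_sqr hq0.
Let qn0 : q != 0. Proof. by rewrite gt_eqF. Qed.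
Let qq1 : (q * q - 1 != 0) && (1 + - q * q != 0).
Proof.
have h : q * q < 1 by rewrite -[ltRHS](mulr1 1) ltr_pM// ltW.
by rewrite lt_eqF ?subr_lt0//= gt_eqF// mulNr subr_gt0.
Qed.

Definition qdiff k : R := q ^- k - q ^+ k.

(* [mu n k] is [k+1]_q [n-k]_q. *)
Definition mu n k : R := qdiff k.+1 * qdiff (n - k) / qdiff 1 ^+ 2.

Lemma qdiffS_gt0 k : 0 < qdiff k.+1.
Proof.
rewrite subr_gt0 (@lt_trans _ _ 1)//; first by rewrite exprn_ilt1// ltW.
by rewrite -exprVn exprn_egt1// invf_gt1.
Qed.

Lemma mu_gt0 n k : (k < n)%N -> 0 < mu n k.
Proof.
move=> kn; rewrite divr_gt0 ?exprn_gt0 ?qdiffS_gt0// mulr_gt0 ?qdiffS_gt0//.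
by move: kn; rewrite -subn_gt0; case: (n - k)%N => // j _; exact: qdiffS_gt0.
Qed.

Lemma mu_nn n : mu n n = 0.
Proof. by rewrite /mu subnn /qdiff expr0 invr1 subrr mulr0 mul0r. Qed.

Lemma mu0 n : (mu n 0)%:C = (lam q)^-1 * ((q ^+ n)%:C - (q ^- n)%:C).
Proof.
rewrite /lam -rmorphB -fmorphV -rmorphM /=; congr (_%:C).
by rewrite /mu /qdiff subn0 !expr1; field; rewrite qq1 qn0 expf_neq0.
Qed.

Lemma muS n k : (k < n)%N -> (mu n k.+1)%:C = (mu n k)%:C +
  (lam q)^-1 * ((q ^+ (n - k.+1) / q ^+ k.+1)%:C - (q ^+ k.+1 / q ^+ (n - k.+1))%:C).
Proof.
move=> kn; rewrite /lam -rmorphB -fmorphV -rmorphM -rmorphD /=; congr (_%:C).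
rewrite /mu /qdiff.
have -> : (n - k = (n - k.+1).+1)%N by lia.
move: (n - k.+1)%N => j; rewrite !exprS !expr0.
by field; rewrite qq1 qn0 !expf_neq0.
Qed.

Let DF u : D u -> D (F u). Proof. by move=> /(uqo_stable ho)[]. Qed.
Let DE u : D u -> D (E u). Proof. by move=> /(uqo_stable ho)[]. Qed.
Let DK u : D u -> D (K u). Proof. by move=> /(uqo_stable ho)[]. Qed.
Let DKi u : D u -> D (Ki u). Proof. by move=> /(uqo_stable ho)[]. Qed.

Lemma uqoZ (c : R[i]) u : D u ->
  [/\ E (c *: u) = c *: E u, F (c *: u) = c *: F u,
      K (c *: u) = c *: K u, Ki (c *: u) = c *: Ki u & D (c *: u)].
Proof.
move=> hu; have h0 := uqo0 ho.
have [e1 e2 e3 e4] := uqo_linear ho (-1) h0 h0.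
have [f1 f2 f3 f4] := uqo_linear ho c hu h0.
have hD := uqoP ho c hu h0.
move: e1 e2 e3 e4 f1 f2 f3 f4 hD.
rewrite scaler0 !addr0 !scaleN1r !addNr => -> -> -> -> -> -> -> ->.
by rewrite !addr0.
Qed.

Section OneString.
Variables (n : nat) (u : H).
Hypotheses (hu : D u) (u1 : nrm u = 1) (Eu : E u = 0) (Kiu : Ki u = s ^- n *: u).

Definition fstring k := iter k F u.
Local Notation w := fstring.

Lemma fstring_dom k : D (w k).
Proof. by elim: k => //= k; exact: DF. Qed.
Let Dw := fstring_dom.

Lemma Ki_fstring k : Ki (w k) = (s ^- n * s ^+ k.*2) *: w k.
Proof.
elim: k => [|k IH]; first by rewrite mulr1.
rewrite [w k.+1]/= (uqoKiF ho)// IH; have [_ -> _ _ _] := uqoZ (s ^- n * s ^+ k.*2) (Dw k).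
by rewrite scalerA -s2 doubleS mulrCA -exprD.
Qed.

Lemma K_fstring k : K (w k) = (s ^+ n * s ^- k.*2) *: w k.
Proof.
have t0 : s ^- n * s ^+ k.*2 != 0 by rewrite mulf_neq0 ?invr_eq0 ?expf_neq0.
have := uqoKKi ho (Dw k); rewrite Ki_fstring; have [_ _ -> _ _] := uqoZ (s ^- n * s ^+ k.*2) (Dw k).
move=> h; rewrite -[in RHS]h scalerA -[LHS]scale1r; congr (_ *: _).
by field; rewrite !expf_neq0.
Qed.

Lemma KK_fstring k : (k <= n)%N -> K (K (w k)) = (q ^+ (n - k) / q ^+ k)%:C *: w k.
Proof.
move=> kn; have e1 : s ^+ n = s ^+ (n - k) * s ^+ k by rewrite -exprD subnK.
have e2 : s ^+ k.*2 = s ^+ k * s ^+ k by rewrite -exprD addnn.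
rewrite K_fstring; have [_ _ -> _ _] := uqoZ (s ^+ n * s ^- k.*2) (Dw k).
rewrite K_fstring scalerA rmorphM fmorphV !rmorphXn /= -s2 !(exprAC s 2) e1 e2; congr (_ *: _).
by field; rewrite !expf_neq0.
Qed.

Lemma KiKi_fstring k : (k <= n)%N -> Ki (Ki (w k)) = (q ^+ k / q ^+ (n - k))%:C *: w k.
Proof.
move=> kn; have e1 : s ^+ n = s ^+ (n - k) * s ^+ k by rewrite -exprD subnK.
have e2 : s ^+ k.*2 = s ^+ k * s ^+ k by rewrite -exprD addnn.
rewrite Ki_fstring; have [_ _ _ -> _] := uqoZ (s ^- n * s ^+ k.*2) (Dw k).
rewrite Ki_fstring scalerA rmorphM fmorphV !rmorphXn /= -s2 !(exprAC s 2) e1 e2; congr (_ *: _).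
by field; rewrite !expf_neq0.
Qed.

Lemma EF_fstring k : (k <= n)%N -> E (F (w k)) = (mu n k)%:C *: w k.
Proof.
elim: k => [_|k IH kn].
  rewrite (uqoEF ho)// [w 0]/= Eu -[u]/(w 0) KK_fstring// KiKi_fstring// !subn0.
  have [_ F0 _ _ _] := uqoZ 0 (uqo0 ho).
  rewrite -(scaler0 _ 0) F0 scale0r add0r -scalerBl scalerA mu0.
  by rewrite !expr0 divr1 mul1r.
rewrite (uqoEF ho)// -[E (w k.+1)]/(E (F (w k))) IH 1?ltnW//.
have [_ -> _ _ _] := uqoZ (mu n k)%:C (Dw k).
by rewrite -[F (w k)]/(w k.+1) KK_fstring// KiKi_fstring// -scalerBl scalerA -scalerDl muS.
Qed.

Lemma nrm_fstringS k : (k <= n)%N -> nrm (w k.+1) ^+ 2 = mu n k * nrm (w k) ^+ 2.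
Proof.
move=> kn; apply: complexI; rewrite [RHS]rmorphM /= -!dotuu -dotZl -EF_fstring//.
by rewrite (uqoE_adj ho)//; exact: DF.
Qed.

Lemma nrm_fstring_gt0 k : (k <= n)%N -> 0 < nrm (w k).
Proof.
elim: k => [_|k IH kn]; first by rewrite /= u1.
have := IH (ltnW kn) => h; rewrite lt_def nrm_ge0 andbT -sqrf_eq0 nrm_fstringS 1?ltnW//.
by rewrite mulf_neq0 ?gt_eqF ?mu_gt0// exprn_gt0.
Qed.

Lemma fstring_top : w n.+1 = 0.
Proof. by apply/nrm_eq0/eqP; rewrite -sqrf_eq0 nrm_fstringS// mu_nn mul0r. Qed.

Definition nfstring k := (nrm (w k))^-1%:C *: w k.
Local Notation f := nfstring.

Definition nu k : R := nrm (w k.+1) / nrm (w k).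

Lemma nfstring_dom k : D (f k).
Proof. by have [] := uqoZ (nrm (w k))^-1%:C (Dw k). Qed.

Lemma nrm_nfstring k : (k <= n)%N -> nrm (f k) = 1.
Proof.
move=> kn; rewrite /f nrmZ nrmR ger0_norm ?invr_ge0 ?nrm_ge0// mulVf//.
by rewrite gt_eqF ?nrm_fstring_gt0.
Qed.

Lemma Ki_nfstring k : Ki (f k) = (s ^- n * s ^+ k.*2) *: f k.
Proof.
have [_ _ _ e _] := uqoZ (nrm (w k))^-1%:C (Dw k).
by rewrite /f e Ki_fstring !scalerA mulrC.
Qed.

Lemma K_nfstring k : K (f k) = (s ^+ n * s ^- k.*2) *: f k.
Proof.
have [_ _ e _ _] := uqoZ (nrm (w k))^-1%:C (Dw k).
by rewrite /f e K_fstring !scalerA mulrC.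
Qed.

Lemma F_nfstring k : (k <= n)%N -> F (f k) = (nu k)%:C *: f k.+1.
Proof.
move=> kn; have [_ e _ _ _] := uqoZ (nrm (w k))^-1%:C (Dw k).
rewrite /f e -[F (w k)]/(w k.+1) scalerA -rmorphM.
move: kn; rewrite leq_eqVlt => /predU1P[->|kn]; first by rewrite fstring_top !scaler0.
congr (_%:C *: _); have h := nrm_fstring_gt0 kn.
by rewrite [RHS]mulrAC divff ?mul1r// gt_eqF.
Qed.

Lemma E_nfstring0 : E (f 0) = 0.
Proof.
have [e _ _ _ _] := uqoZ (nrm (w 0))^-1%:C (Dw 0).
by rewrite /f e [w 0]/= Eu scaler0.
Qed.

Lemma E_nfstringS k : (k < n)%N -> E (f k.+1) = (nu k)%:C *: f k.
Proof.
move=> kn; have [e _ _ _ _] := uqoZ (nrm (w k.+1))^-1%:C (Dw k.+1).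
rewrite /f e -[E (w k.+1)]/(E (F (w k))) EF_fstring 1?ltnW// !scalerA -!rmorphM /=.
have h1 := nrm_fstring_gt0 kn; have h0 := nrm_fstring_gt0 (ltnW kn).
congr (_%:C *: _); rewrite /nu.
have -> : mu n k = nrm (w k.+1) ^+ 2 / nrm (w k) ^+ 2.
  by rewrite nrm_fstringS 1?ltnW// mulfK// expf_neq0// gt_eqF.
by field; rewrite !gt_eqF.
Qed.

Definition casimir_op v := E (F v)
  + (lam q) ^- 2 *: (q^-1%:C *: K (K v) + q%:C *: Ki (Ki v) - 2%:R *: v).

(* The square of [(n+1)/2]_q. *)
Lemma casimir_nfstring k : (k <= n)%N ->
  casimir_op (f k) = ((q ^- n.+1 + q ^+ n.+1 - 2) / qdiff 1 ^+ 2)%:C *: f k.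
Proof.
move=> kn; have [_ e _ _ _] := uqoZ (nrm (w k))^-1%:C (Dw k).
have [e1 e2 e3 e4 _] := uqoZ (nrm (w k))^-1%:C (Dw k).
have [f1 _ _ _ _] := uqoZ (nrm (w k))^-1%:C (DF (Dw k)).
have [_ _ f3 _ _] := uqoZ (nrm (w k))^-1%:C (DK (Dw k)).
have [_ _ _ f4 _] := uqoZ (nrm (w k))^-1%:C (DKi (Dw k)).
rewrite /casimir_op /f e2 f1 e3 f3 e4 f4 EF_fstring// KK_fstring// KiKi_fstring//.
rewrite !scalerA -scalerDl -scalerBl scalerA -scalerDl; congr (_ *: _).
rewrite /lam -[2%:R](rmorph_nat (real_complex R)) -!rmorphM -rmorphXn -!rmorphD -rmorphB.
rewrite -fmorphV -!rmorphM -rmorphD; congr (_%:C).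
have := nrm_fstring_gt0 kn; move: (nrm (w k)) => x x0.
have en : q ^+ n = q ^+ (n - k) * q ^+ k by rewrite -exprD subnK.
rewrite /mu /qdiff !exprS en !expr0; move: (n - k)%N => j.
field.
move/andP: qq1 => [h1 h2]; by rewrite h1 h2 qn0 !expf_neq0// gt_eqF.
Qed.

Definition Ki_weight k : R[i] := s ^- n * s ^+ k.*2.
Local Notation t := Ki_weight.

Lemma Ki_weight_gt0 k : 0 < t k.
Proof. by rewrite mulr_gt0 ?invr_gt0 ?exprn_gt0. Qed.

Let tconj k : (t k)^* = t k.
Proof. by apply/CrealP; rewrite realE ltW ?Ki_weight_gt0. Qed.

Let K_weight k : K (f k) = (t k)^-1 *: f k.
Proof. by rewrite K_nfstring /t invfM invrK. Qed.

Section StringTrace.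
Variables p pK pF : H -> H.
Hypothesis pD : forall v, D v -> [/\ D (p v), D (pK v) & D (pF v)].
Hypothesis pZ : forall (c : R[i]) v, D v -> p (c *: v) = c *: p v.
Hypothesis p_K : forall v, D v -> p (K v) = K (pK v).
Hypothesis p_F : forall v, D v -> Ki (pF v) = p (F v) - F (pK v).

Lemma string_trace_K k : <|pK (f k), f k|> = <|p (f k), f k|>.
Proof.
have Df := nfstring_dom k; have [D1 D2 D3] := pD Df.
have t0 : t k != 0 by rewrite gt_eqF ?Ki_weight_gt0.
apply: (mulfI (invr_neq0 t0)); rewrite -[in RHS]dotZl -pZ// -K_weight p_K//.
by rewrite (uqoK_adj ho)// K_weight [RHS]dotZr fmorphV /= tconj.
Qed.

Lemma pK_nfstring k : pK (f k) = (t k)^-1 *: Ki (p (f k)).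
Proof.
have Df := nfstring_dom k; have [D1 D2 D3] := pD Df.
rewrite -[LHS](uqoKiK ho)// -p_K// K_weight pZ//.
by have [_ _ _ -> _] := uqoZ (t k)^-1 D1.
Qed.

Let G k := t k * (nu k)%:C * <|p (f k.+1), f k|>.

Lemma string_trace_F : \sum_(k < n.+1) t k ^+ 2 * <|pF (f k), f k|> = 0.
Proof.
have F_adj x y : D x -> D y -> <|F x, y|> = <|x, E y|>.
  by move=> Dx Dy; rewrite dotC -(uqoE_adj ho)// -dotC.
have term k : (k <= n)%N -> t k ^+ 2 * <|pF (f k), f k|> =
    G k - t k * <|pK (f k), E (f k)|>.
  move=> kn; have Df := nfstring_dom k; have [D1 D2 D3] := pD Df.
  rewrite expr2 -mulrA -[t k in X in _ * X]tconj -dotZr -Ki_nfstring.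
  rewrite -(uqoKi_adj ho)// p_F// dotBl F_nfstring// pZ; last exact: nfstring_dom.
  by rewrite dotZl F_adj// mulrBr /G mulrA.
have termS k : (k < n)%N ->
    t k.+1 * <|pK (f k.+1), E (f k.+1)|> = G k.
  move=> kn; have Df := nfstring_dom k.+1; have [D1 D2 D3] := pD Df.
  have t0 : t k.+1 != 0 by rewrite gt_eqF ?Ki_weight_gt0.
  rewrite pK_nfstring dotZl mulVKf// (uqoKi_adj ho)//; last exact: DE.
  rewrite E_nfstringS//; have [_ _ _ -> _] := uqoZ (nu k)%:C (nfstring_dom k).
  by rewrite Ki_nfstring scalerA dotZr rmorphM /= conjR -/(t k) tconj /G (mulrC (t k)).
have main j : (j <= n)%N -> \sum_(k < j.+1) t k ^+ 2 * <|pF (f k), f k|> = G j.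
  elim: j => [|j IH] jn.
    by rewrite big_ord_recr big_ord0 /= term// E_nfstring0 dot0r mulr0 subr0 add0r.
  by rewrite big_ord_recr /= IH 1?ltnW// term// termS// addrC subrK.
by rewrite main// /G /nu fstring_top nrm0 mul0r mulr0 mul0r.
Qed.

End StringTrace.
End OneString.

Lemma sym_eigen_orth (T : H -> H) (x y : H) (a b : R) : <|T x, y|> = <|x, T y|> ->
  T x = a%:C *: x -> T y = b%:C *: y -> a != b -> <|x, y|> = 0.
Proof.
move=> hT hx hy ab; move: hT; rewrite hx hy dotZl dotZr conjR.
move/eqP; rewrite -subr_eq0 -mulrBl mulf_eq0 -rmorphB => /orP[|/eqP//].
by rewrite (inj_eq (@complexI R) _ 0) subr_eq0 (negPf ab).
Qed.

Lemma casimir_op_sym x y : D x -> D y -> <|casimir_op x, y|> = <|x, casimir_op y|>.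
Proof.
move=> Dx Dy; rewrite /casimir_op !dotDl !dotDr (uqoE_adj ho)//; last exact: DF.
rewrite (dotC x (E _)) (uqoE_adj ho)//; last exact: DF.
rewrite -dotC; congr (_ + _).
rewrite /lam -rmorphXn -fmorphV dotZl dotZr conjR !dotBl !dotBr !dotDl !dotDr.
rewrite !dotZl !dotZr !conjR rmorph_nat.
by rewrite !(uqoK_adj ho) ?(uqoKi_adj ho)//; (exact: DK || exact: DKi).
Qed.

Lemma casimir_val_lt a b : (0 < a < b)%N -> q ^- a + q ^+ a < q ^- b + q ^+ b.
Proof.
move=> /andP[a0 ab]; have xp : 0 < q ^+ a by rewrite exprn_gt0.
have yp : 0 < q ^+ b by rewrite exprn_gt0.
have x1 : q ^+ a < 1 by rewrite exprn_ilt1// ?ltW// -lt0n.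
have yx : q ^+ b < q ^+ a by rewrite ltr_iXn2l.
move: xp yp x1 yx; move: (q ^+ a) (q ^+ b) => x y xp yp x1 yx.
rewrite -subr_gt0; have -> : y^-1 + y - (x^-1 + x) = (x - y) * (1 - x * y) / (x * y).
  by field; rewrite !gt_eqF.
by rewrite divr_gt0 ?mulr_gt0// subr_gt0// (lt_trans _ x1)// gtr_pMr// (lt_trans yx).
Qed.

Section TwoStrings.
Variables (n n' : nat) (u v : H).
Hypotheses (hu : D u) (u1 : nrm u = 1) (Eu : E u = 0) (Kiu : Ki u = s ^- n *: u).
Hypotheses (hv : D v) (v1 : nrm v = 1) (Ev : E v = 0) (Kiv : Ki v = s ^- n' *: v).

Lemma nfstring_orth_level k k' : n != n' -> (k <= n)%N -> (k' <= n')%N ->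
  <|nfstring u k, nfstring v k'|> = 0.
Proof.
move=> nn kn kn'.
apply: (sym_eigen_orth (casimir_op_sym (nfstring_dom hu k) (nfstring_dom hv k'))
  (casimir_nfstring hu u1 Eu Kiu kn) (casimir_nfstring hv v1 Ev Kiv kn')).
have q1 : qdiff 1 ^+ 2 != 0 by rewrite expf_neq0// gt_eqF// qdiffS_gt0.
apply/negP => /eqP/(mulIf (invr_neq0 q1))/addIr h.
by move: nn; rewrite neq_ltn => /orP[] nn;
  have := @casimir_val_lt _.+1 _.+1 nn; rewrite h ltxx.
Qed.

Lemma nfstring_orth_weight k k' : n = n' -> k != k' ->
  <|nfstring u k, nfstring v k'|> = 0.
Proof.
move=> nn kk; have t_real j : s ^- n * s ^+ j.*2 =
    ((q `^ 2^-1) ^- n * (q `^ 2^-1) ^+ j.*2)%:C.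
  by rewrite rmorphM fmorphV !rmorphXn.
have e1 := Ki_nfstring hu Kiu k; have e2 := Ki_nfstring hv Kiv k'.
rewrite t_real in e1; rewrite -nn t_real in e2.
apply: (sym_eigen_orth _ e1 e2).
  by apply: (uqoKi_adj ho); apply: nfstring_dom.
have r0 : 0 < q `^ 2^-1 by rewrite powR_gt0.
have rn : (q `^ 2^-1) ^- n != 0 by rewrite invr_neq0// expf_neq0// gt_eqF.
rewrite (inj_eq (mulfI rn)) (inj_eq (ieexprIn r0 _)).
  by rewrite -!muln2 eqn_mul2r.
rewrite lt_eqF// -(@ltr_pXn2r _ 2) ?nnegrE ?ltW// expr1n -powR_mulrn ?powR_ge0//.
by rewrite -powRrM mulVf// powRr1// ltW.
Qed.

Lemma nfstring_orth_top k : n = n' -> (k <= n)%N -> <|u, v|> = 0 ->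
  <|nfstring u k, nfstring v k|> = 0.
Proof.
move=> nn kn uv; rewrite /nfstring dotZl dotZr.
suff -> : <|fstring u k, fstring v k|> = 0 by rewrite !mulr0.
elim: k kn => [//|k IH] kn /=.
rewrite -(uqoE_adj ho) ?(EF_fstring hu Eu Kiu (ltnW kn)) ?dotZl ?IH ?mulr0//.
- exact: ltnW.
- exact: DF (fstring_dom hu k).
- exact: fstring_dom hv k.
Qed.

End TwoStrings.
End Strings.

(** * Orthonormalization and enumeration *)

Section GramSchmidt.
Variables (R : realType) (H : hilbertType R).
Implicit Types (v e : nat -> H) (x y : H).

Definition inspan n v x := exists c : nat -> R[i], x = \sum_(i < n) c i *: v i.

Lemma inspanP n v (a : R[i]) x y : inspan n v x -> inspan n v y ->
  inspan n v (a *: x + y).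
Proof.
move=> [c ->] [d ->]; exists (fun i => a * c i + d i).
rewrite scaler_sumr -big_split; apply: eq_bigr => i _ /=.
by rewrite scalerDl scalerA.
Qed.

Lemma inspan0 n v : inspan n v 0.
Proof. by exists (fun=> 0); rewrite big1// => i _; rewrite scale0r. Qed.

Lemma inspanZ n v (a : R[i]) x : inspan n v x -> inspan n v (a *: x).
Proof. by move=> hx; rewrite -[a *: x]addr0; apply: inspanP => //; exact: inspan0. Qed.

Lemma inspan_mem n v i : (i < n)%N -> inspan n v (v i).
Proof.
move=> hi; exists (fun j => (j == i)%:R); rewrite (bigD1 (Ordinal hi))//= eqxx scale1r.
rewrite big1 ?addr0// => j; rewrite -val_eqE /= => /negPf ->; exact: scale0r.
Qed.

Lemma inspan_trans n k v e x : (forall i, (i < n)%N -> inspan k v (e i)) ->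
  inspan n e x -> inspan k v x.
Proof.
move=> he [c ->]; elim: n he => [|n IH] he; first by rewrite big_ord0; exact: inspan0.
rewrite big_ord_recr /= addrC; apply: inspanP; first exact: he.
by apply: IH => i hi; apply: he; rewrite ltnS ltnW.
Qed.

Lemma gram_schmidt n v :
  (forall c : nat -> R[i], \sum_(i < n) c i *: v i = 0 ->
     forall i, (i < n)%N -> c i = 0) ->
  exists e, [/\ forall i, (i < n)%N -> inspan n v (e i),
    forall i, (i < n)%N -> inspan n e (v i)
    & forall i j, (i < n)%N -> (j < n)%N -> <|e i, e j|> = (i == j)%:R].
Proof.
elim: n => [|n IH] hv; first by exists v; split.
have [|e [ev ve eo]] := IH.
  move=> c hc i hi; pose c' j := if (j < n)%N then c j else 0.
  have := hv c'; rewrite big_ord_recr /= {2}/c' ltnn scale0r addr0 => h.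
  have <- : c' i = c i by rewrite /c' hi.
  apply: h; last exact: ltnW.
  by rewrite -[RHS]hc; apply: eq_bigr => j _; rewrite /c' /= ltn_ord.
pose w := v n - \sum_(j < n) <|v n, e j|> *: e j.
have we j : (j < n)%N -> <|w, e j|> = 0.
  move=> hj; rewrite /w dotBl dot_suml (bigD1 (Ordinal hj))//= dotZl eo// eqxx mulr1.
  rewrite big1 ?addr0 ?subrr// => i; rewrite -val_eqE /= => /negPf hi.
  by rewrite dotZl eo// hi mulr0.
have spanS x : inspan n v x -> inspan n.+1 v x.
  by apply: inspan_trans => i hi; apply: inspan_mem; rewrite ltnS ltnW.
have sume : inspan n e (\sum_(j < n) <|v n, e j|> *: e j) by exists (fun j => <|v n, e j|>).
have w0 : w != 0.
  apply/eqP => w0.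
  have [c hc] : inspan n v (v n).
    move: w0 => /eqP; rewrite subr_eq0 => /eqP ->; exact: inspan_trans ev sume.
  pose c' j := if (j < n)%N then - c j else 1.
  have := hv c'; rewrite big_ord_recr /= {2}/c' ltnn scale1r => h.
  have : c' n = 0.
    apply: h => //; rewrite [X in _ + X = _]hc -big_split big1// => j _ /=.
    by rewrite /c' ltn_ord scaleNr addNr.
  by rewrite /c' ltnn => /eqP; rewrite oner_eq0.
have nw : 0 < nrm w.
  by rewrite lt_def nrm_ge0 andbT; apply: contra w0 => /eqP/nrm_eq0 ->.
pose e' i := if (i < n)%N then e i else (nrm w)^-1%:C *: w.
have e'E i : (i < n)%N -> e' i = e i by rewrite /e' => ->.
have e'n : e' n = (nrm w)^-1%:C *: w by rewrite /e' ltnn.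
have spane x : inspan n e x -> inspan n.+1 e' x.
  by apply: inspan_trans => i hi; rewrite -e'E//; apply: inspan_mem; rewrite ltnS ltnW.
have ltS k : (k < n.+1)%N -> (k < n)%N \/ k = n.
  by rewrite ltnS leq_eqVlt => /orP[/eqP|]; [right|left].
exists e'; split.
- move=> i /ltS[hi|->]; first by rewrite e'E//; apply: spanS; exact: ev.
  rewrite e'n; apply: inspanZ; rewrite /w addrC -scaleN1r; apply: inspanP.
    by apply: spanS; exact: inspan_trans ev sume.
  exact: inspan_mem.
- move=> i /ltS[hi|->]; first by apply: spane; exact: ve.
  have -> : v n = (nrm w)%:C *: e' n + \sum_(j < n) <|v n, e j|> *: e j.
    by rewrite e'n scalerA -rmorphM /= divff ?gt_eqF// scale1r subrK.
  by apply: inspanP; [exact: inspan_mem | exact: spane].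
- move=> i j /ltS[hi|->] /ltS[hj|->].
  + by rewrite !e'E// eo.
  + by rewrite (e'E i hi) e'n dotZr dotC we// rmorph0 mulr0 ltn_eqF.
  + by rewrite (e'E j hj) e'n dotZl we// mulr0 gtn_eqF.
  + rewrite e'n dotZl dotZr conjR dotuu -!rmorphM /= eqxx.
    by rewrite expr2 mulKf ?mulVf ?gt_eqF.
Qed.

End GramSchmidt.

Section TriangularEnumeration.

(* Enumerates the pairs (n, r) with r < (n + 1)^2. *)
Fixpoint blockpos m : nat * nat :=
  if m is m'.+1 then
    let: (n, r) := blockpos m' in
    if (r.+1 < n.+1 * n.+1)%N then (n, r.+1) else (n.+1, 0%N)
  else (0%N, 0%N).

Definition blockstart n : nat := (\sum_(j < n) j.+1 * j.+1)%N.

Lemma blockstartS n : blockstart n.+1 = (blockstart n + n.+1 * n.+1)%N.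
Proof. by rewrite /blockstart big_ord_recr. Qed.

Lemma blockposP m : let: (n, r) := blockpos m in
  (r < n.+1 * n.+1)%N /\ m = (blockstart n + r)%N.
Proof.
elim: m => [|m]; first by split => //; rewrite /blockstart big_ord0.
rewrite /=; case: (blockpos m) => n r [h1 h2]; case: ifPn => h3.
  by split=> //; rewrite h2 addnS.
by split=> //; rewrite blockstartS addn0 h2 -addnS; congr (_ + _)%N; lia.
Qed.

Lemma blockposE n r : (r < n.+1 * n.+1)%N -> blockpos (blockstart n + r) = (n, r).
Proof.
elim: n r => [|n IHn].
  by case=> [|r]; rewrite ?muln1// /blockstart big_ord0.
elim=> [_|r IHr hr].
  have /IHn h : ((n.+1 * n.+1).-1 < n.+1 * n.+1)%N by [].
  have -> : (blockstart n.+1 + 0 = (blockstart n + (n.+1 * n.+1).-1).+1)%N.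
    by rewrite blockstartS; lia.
  by rewrite /= h; case: ifPn => //; lia.
by rewrite addnS /= IHr ?hr// ltnW.
Qed.

Lemma leq_blockstart n : (n <= blockstart n)%N.
Proof. by elim: n => // n IH; rewrite blockstartS; nia. Qed.

Lemma sum_blocks (V : nmodType) (f : nat -> nat -> V) N :
  \sum_(m < blockstart N) f (blockpos m).1 (blockpos m).2 =
  \sum_(n < N) \sum_(r < n.+1 * n.+1) f n r.
Proof.
elim: N => [|N IH]; first by rewrite /blockstart !big_ord0.
rewrite big_ord_recr -IH blockstartS big_split_ord /=; congr (_ + _).
by apply: eq_bigr => i _; rewrite blockposE.
Qed.

Lemma sum_square (V : nmodType) (f : nat -> nat -> V) a b : (0 < b)%N ->
  \sum_(r < a * b) f (r %/ b)%N (r %% b)%N = \sum_(i < a) \sum_(k < b) f i k.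
Proof.
move=> b0; elim: a => [|a IH]; first by rewrite !big_ord0.
rewrite big_ord_recr -IH mulSnr big_split_ord /=; congr (_ + _).
apply: eq_bigr => k _; rewrite divnMDl// modnMDl divn_small// addn0.
by rewrite modn_small.
Qed.

End TriangularEnumeration.

(** * A basis of eigenvectors *)

Local Arguments hw_alpha : simpl never.
Local Arguments hw_gamma : simpl never.

Section HeisenbergBasis.
Variables (R : realType) (q : R).
Hypotheses (hq0 : 0 < q) (hq1 : q < 1).
Variables (U : uqSU2 q) (A : oqSU2 q) (m : modStarAlg (uq_hopf U) A).
Hypothesis hm : is_suq2_action m.
Variable h : {linear A -> R[i]}.
Hypothesis hh : is_haar m h.
Variables (X : crossProduct m) (H : hilbertType R).
Variables (pi_h : starRep A H) (v_h : H).
Hypothesis hgns : is_gns pi_h h v_h.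
Variable pi_t : starRep X H.
Hypothesis hheis : is_heisenberg pi_h v_h pi_t.

Let s : R[i] := (q `^ 2^-1)%:C.
Let sp : 0 < s := sqrtq_gt0 hq0.
Let s0 : s != 0. Proof. by rewrite gt_eqF. Qed.
Let s2 : s ^+ 2 = q%:C := sqrtq_sqr hq0.

Local Notation eta := (eta pi_h v_h).
Local Notation rho := (rho pi_t).
Local Notation D := (hdom pi_h).
Local Notation E := (rho (uqE U)).
Local Notation F := (rho (uqF U)).
Local Notation K := (rho (uqK U)).
Local Notation Ki := (rho (uqKi U)).

Lemma heisenberg_uq_operators : uq_operators q D E F K Ki.
Proof.
split.
- exact: rep_dom0.
- by move=> c u v; exact: hdom_lin.
- by move=> u hu; split; exact: (hdom_rho hheis).
- by move=> c u v hu hv; split; exact: (rho_lin hheis).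
- exact: (rhoKKi hheis).
- exact: (rhoKiK hheis).
- exact: (rhoKiF hq0 hheis).
- exact: (rhoEF hheis).
- exact: (rhoE_adj hheis).
- by move=> u v; apply: (rhoK_adj hheis); left.
- by move=> u v; apply: (rhoK_adj hheis); right.
Qed.

Let ho := heisenberg_uq_operators.

Lemma eta0_mull x y : eta y = 0 -> eta (x * y) = 0.
Proof.
move=> y0; rewrite -(rep_eta hgns) y0.
have h0 : rep_dom pi_h 0 by exact: rep_dom0.
have := rep_linear x (-1) h0 h0; rewrite scaler0 addr0 => e.
by rewrite [LHS]e scaleN1r addNr.
Qed.

Lemma eta0_actF x : eta x = 0 -> eta (act m x (uqF U)) = 0.
Proof.
move=> x0; have := rhoF_eta hq0 hgns hheis x; rewrite x0 (rho0 hheis) => /esym/eqP.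
rewrite scaler_eq0 oppr_eq0 (inj_eq (@complexI R) _ 0) gt_eqF//= => /eqP.
by [].
Qed.

Lemma eta_a_exp_neq0 n : eta (hw A n 0) != 0.
Proof.
elim: n => [|n IH]; first by rewrite /hw !expr0 mulr1; exact: (eta1_neq0 hh hgns).
apply: contra IH => /eqP e; have eF := eta0_actF e.
rewrite (actF_hw_exp hq0 hm) (etaZ hgns) in eF.
move/eqP : eF; rewrite scaler_eq0 gt_eqF/=; last first.
  by rewrite ltr_wpDr ?invr_gt0 ?exprn_gt0// mulr_ge0 ?(ltW sp)// hw_alpha_ge0.
move=> /eqP ec; rewrite -(d_a_expS A n) -scaleN1r addrC scalerA.
by rewrite (eta_linear hgns) (eta0_mull _ ec) (eta0_mull _ e) scaler0 addr0.
Qed.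

Lemma eta_hw_indep n (c : nat -> R[i]) :
  \sum_(i < n.+1) c i *: eta (hw A i (n - i)) = 0 -> forall i, (i < n.+1)%N -> c i = 0.
Proof.
elim: n c => [|n IH] c.
  rewrite big_ord_recr big_ord0 /= add0r => /eqP; rewrite scaler_eq0.
  by rewrite (negPf (eta_a_exp_neq0 0)) orbF => /eqP c0 [].
move=> hc; pose y : A := \sum_(i < n.+2) c i *: hw A i (n.+1 - i).
have y0 : eta y = 0.
  by rewrite /y (eta_sum hgns) -[RHS]hc; apply: eq_bigr => i _; rewrite (etaZ hgns).
have z0 : eta (oqa A * act m y (uqF U) - hw_alpha q n.+1 *: (oqc A * y)) = 0.
  have e1 : eta (oqa A * act m y (uqF U)) = 0 by exact/eta0_mull/eta0_actF.
  have e2 : eta (oqc A * y) = 0 by exact: eta0_mull.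
  by rewrite -scaleNr addrC (eta_linear hgns) e1 e2 scaler0 addr0.
have zE : oqa A * act m y (uqF U) - hw_alpha q n.+1 *: (oqc A * y) =
    \sum_(i < n.+1) (c i * (s ^+ i * hw_gamma q (n.+1 - i))) *: hw A i (n - i).
  rewrite /y linear_sumlz mulr_sumr mulr_sumr scaler_sumr -sumrB.
  rewrite big_ord_recr /= [X in _ + X](_ : _ = 0) ?addr0; last first.
    rewrite linearZl_LR -!scalerAr a_actF_hw// subnn addn0 /= mulr0 scale0r addr0.
    by rewrite !scalerA mulrC subrr.
  apply: eq_bigr => i _; have hi := ltn_ord i.
  rewrite linearZl_LR -!scalerAr a_actF_hw// subnKC 1?ltnW//.
  rewrite scalerDr !scalerA (mulrC (hw_alpha q n.+1)) addrAC subrr add0r.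
  congr (_ *: hw A _ _); lia.
have ci i : (i < n.+1)%N -> c i = 0.
  move=> hi; rewrite zE (eta_sum hgns) in z0.
  have h1 : c i * (s ^+ i * hw_gamma q (n.+1 - i)) = 0.
    apply: (IH (fun i => c i * (s ^+ i * hw_gamma q (n.+1 - i)))) => //.
    by rewrite -[RHS]z0; apply: eq_bigr => j _; rewrite (etaZ hgns).
  have gp : 0 < s ^+ i * hw_gamma q (n.+1 - i).
    by rewrite mulr_gt0 ?exprn_gt0// subSn// hw_gammaS_gt0.
  by move/eqP: h1; rewrite mulf_eq0 (gt_eqF gp) orbF => /eqP.
move=> i; rewrite ltnS leq_eqVlt => /predU1P[->|]; last exact: ci.
move/eqP: hc; rewrite big_ord_recr /= big1 ?add0r; last first.
  by move=> j _; rewrite ci ?scale0r.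
by rewrite subnn scaler_eq0 (negPf (eta_a_exp_neq0 _)) orbF => /eqP.
Qed.

Definition hw_vector n u := [/\ D u, E u = 0 & Ki u = s ^- n *: u].

Lemma hw_vector_eta n i : (i < n.+1)%N -> hw_vector n (eta (hw A i (n - i))).
Proof.
move=> hi; split; first exact: (hdom_eta hgns).
  by rewrite (rhoE_eta hq0 hgns hheis) actE_hw// (eta0 hgns) scaler0.
by rewrite (rhoKi_eta hheis) actK_hw// (etaZ hgns) subnKC.
Qed.

Lemma hw_vector_span n k v x : (forall i, (i < k)%N -> hw_vector n (v i)) ->
  inspan k v x -> hw_vector n x.
Proof.
move=> hv [c ->]; elim: k hv => [|k IH] hv.
  rewrite big_ord0; split; first exact: (uqo0 ho).
    exact: (rho0 hheis).
  by rewrite scaler0; exact: (rho0 hheis).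
have [h1 h2 h3] := hv k (ltnSn k).
have [|g1 g2 g3] := IH; first by move=> i hi; apply: hv; rewrite ltnS ltnW.
rewrite big_ord_recr /= addrC; split; first exact: (uqoP ho).
  by have [-> _ _ _] := uqo_linear ho (c k) h1 g1; rewrite h2 g2 scaler0 addr0.
have [_ _ _ ->] := uqo_linear ho (c k) h1 g1.
by rewrite h3 g3 scalerDr !scalerA mulrC.
Qed.

Lemma hw_basis_exists : exists u : nat -> nat -> H, forall n,
  [/\ forall i, (i < n.+1)%N -> hw_vector n (u n i),
      forall i, (i < n.+1)%N -> inspan n.+1 (u n) (eta (hw A i (n - i)))
    & forall i j, (i < n.+1)%N -> (j < n.+1)%N -> <|u n i, u n j|> = (i == j)%:R].
Proof.
suff /choice[u hu] : forall n, exists u : nat -> H,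
  [/\ forall i, (i < n.+1)%N -> hw_vector n (u i),
      forall i, (i < n.+1)%N -> inspan n.+1 u (eta (hw A i (n - i)))
    & forall i j, (i < n.+1)%N -> (j < n.+1)%N -> <|u i, u j|> = (i == j)%:R].
  by exists u.
move=> n; have [u [h1 h2 h3]] :=
  @gram_schmidt _ _ n.+1 (fun i => eta (hw A i (n - i))) (@eta_hw_indep n).
exists u; split=> // i hi; apply: hw_vector_span (h1 i hi).
exact: hw_vector_eta.
Qed.

Lemma rep_bounded x : exists2 M, 0 <= M &
  forall u, D u -> nrm (rep pi_h x u) <= M * nrm u.
Proof.
have [[_ _ _ _] [bc adda ad]] := oqP A.
have [sa sb] := oq_star A.
have sc : star (oqc A) = - q^-1%:C *: oqb A.
  rewrite -[oqb A]starK sb starZ scalerA rmorphN /= conjR mulrNN -rmorphM /=.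
  by rewrite mulVf ?scale1r// gt_eqF.
have sd : star (oqd A) = oqa A by rewrite -sa starK.
have da : oqd A * oqa A - q^-1%:C *: (oqb A * oqc A) = 1.
  by have := d_a_expS A 0; rewrite /hw expr1 !expr0 !mulr1.
have sq y z : star y * y + star z * z = 1 -> forall u, D u ->
    nrm (rep pi_h y u) <= 1 * nrm u /\ nrm (rep pi_h z u) <= 1 * nrm u.
  move=> hyz u hu; have e : nrm (rep pi_h y u) ^+ 2 + nrm (rep pi_h z u) ^+ 2 = nrm u ^+ 2.
    apply: complexI; rewrite rmorphD /= -!dotuu !rep_adj//; try exact: rep_stable.
    rewrite -!repM// -dotDr; congr (<|_, _|>).
    rewrite -[rep pi_h (_ * y) u]scale1r -rep_linearl// scale1r hyz; exact: rep1.
  rewrite !mul1r; split; rewrite -ler_sqr ?nnegrE ?nrm_ge0// -e.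
    by rewrite lerDl sqr_ge0.
  by rewrite lerDr sqr_ge0.
have h1 := sq (oqa A) (oqc A); have h2 := sq (oqb A) (oqd A).
rewrite sa sc -scalerAl scaleNr in h1; have {}h1 := h1 da.
rewrite sb sd -scalerAl scaleNr addrC -bc in h2; have {}h2 := h2 ad.
apply: (oq_gen_ind (P := fun x => exists2 M, 0 <= M &
  forall u, D u -> nrm (rep pi_h x u) <= M * nrm u)) x.
- exists 1 => // u hu; rewrite rep1// mul1r//.
- move=> c x y [M M0 hM] [N N0 hN]; exists (nrm c * M + N).
    by rewrite addr_ge0// mulr_ge0// nrm_ge0.
  move=> u hu; rewrite rep_linearl// (le_trans (nrmD _ _))// mulrDl lerD ?hN//.
  by rewrite nrmZ -mulrA ler_wpM2l ?nrm_ge0// hM.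
- move=> x y [M M0 hM] [N N0 hN]; exists (M * N); first exact: mulr_ge0.
  move=> u hu; rewrite repM// (le_trans (hM _ _))//; first exact: rep_stable.
  by rewrite -mulrA ler_wpM2l// hN.
- by exists 1 => // u hu; have [] := h1 u hu.
- by exists 1 => // u hu; have [] := h2 u hu.
- by exists 1 => // u hu; have [] := h1 u hu.
- by exists 1 => // u hu; have [] := h2 u hu.
Qed.

Section Basis.
Variable u : nat -> nat -> H.
Hypothesis hu : forall n,
  [/\ forall i, (i < n.+1)%N -> hw_vector n (u n i),
      forall i, (i < n.+1)%N -> inspan n.+1 (u n) (eta (hw A i (n - i)))
    & forall i j, (i < n.+1)%N -> (j < n.+1)%N -> <|u n i, u n j|> = (i == j)%:R].

Definition string_vec n i k : H := nfstring F (u n i) k.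
Local Notation f := string_vec.

Lemma nrm_hw_vector n i : (i < n.+1)%N -> nrm (u n i) = 1.
Proof.
move=> hi; have [_ _ /(_ i i hi hi)] := hu n; rewrite eqxx dotuu => /complexI e.
by apply/eqP; rewrite -(@eqrXn2 _ 2) ?nrm_ge0// expr1n; apply/eqP.
Qed.

Lemma string_vec_orth n i k n' i' k' :
  (i < n.+1)%N -> (k < n.+1)%N -> (i' < n'.+1)%N -> (k' < n'.+1)%N ->
  <|f n i k, f n' i' k'|> = [&& n == n', i == i' & k == k']%:R.
Proof.
move=> hi hk hi' hk'; have [hw _ hon] := hu n; have [hw' _ _] := hu n'.
have [h1 h2 h3] := hw i hi; have [g1 g2 g3] := hw' i' hi'.
have n1 := nrm_hw_vector hi; have m1 := nrm_hw_vector hi'.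
case: eqVneq => [en|nn] /=; last first.
  by apply: (nfstring_orth_level hq0 hq1 ho h1 n1 h2 h3 g1 m1 g2 g3).
subst n'; have [->|kk] := eqVneq k k'; last first.
  by rewrite andbF; apply: (nfstring_orth_weight hq0 hq1 ho h1 h3 g1 g3).
rewrite andbT; case: eqVneq => [<-|ii].
  by rewrite dotuu (nrm_nfstring hq0 hq1 ho h1 n1 h2 h3)// expr1n.
apply: (nfstring_orth_top hq0 hq1 ho h1 h2 h3 g1) => //.
by rewrite hon// (negPf ii).
Qed.

Definition basis_vec p : H := let: (n, r) := blockpos p in f n (r %/ n.+1) (r %% n.+1).

Lemma basis_vecE n i k : (i < n.+1)%N -> (k < n.+1)%N ->
  basis_vec (blockstart n + (i * n.+1 + k)) = f n i k.
Proof.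
move=> hi hk; rewrite /basis_vec blockposE; last by nia.
by rewrite divnMDl// modnMDl divn_small// addn0 modn_small.
Qed.

Lemma basis_vec_dom p : D (basis_vec p).
Proof.
rewrite /basis_vec; case: (blockpos p) (blockposP p) => n r [hr _].
have [hw _ _] := hu n; have [|h1 _ _] := hw (r %/ n.+1)%N; first by rewrite ltn_divLR.
exact: (nfstring_dom ho h1).
Qed.

Lemma orth_hwF w : (forall p, <|w, basis_vec p|> = 0) ->
  forall k i j, <|w, eta (hwF m k i j)|> = 0.
Proof.
move=> wo k i j; pose n := (i + j)%N.
have hi : (i < n.+1)%N by rewrite ltnS leq_addr.
have [hv hs _] := hu n.
have strings i' k' : (i' < n.+1)%N -> <|w, iter k' F (u n i')|> = 0.
  move=> hi'; have [h1 h2 h3] := hv i' hi'; have n1 := nrm_hw_vector hi'.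
  have [hk|hk] := ltnP k' n.+1.
    have := wo (blockstart n + (i' * n.+1 + k'))%N; rewrite basis_vecE// /f dotZr.
    rewrite conjR => /eqP; rewrite mulf_eq0 (inj_eq (@complexI R) _ 0) invr_eq0.
    by rewrite gt_eqF ?(nrm_fstring_gt0 hq0 hq1 ho h1 n1 h2 h3)//= => /eqP.
  have -> : iter k' F (u n i') = 0; last by rewrite dot0r.
  rewrite -(subnK hk) iterD -[iter n.+1 _ _]/(fstring F (u n i') n.+1).
  rewrite (fstring_top hq0 hq1 ho h1 h2 h3).
  by elim: (k' - n.+1)%N => //= l ->; exact: (rho0 hheis).
have iterD' l x : D x -> D (iter l F x).
  by move=> hx; elim: l => //= l; exact: (hdom_rho hheis).
have iterF l (c : R[i]) x y : D x -> D y ->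
    iter l F (c *: x + y) = c *: iter l F x + iter l F y.
  move=> hx hy; elim: l => //= l ->; exact: (rho_lin hheis _ _ (iterD' l x hx) (iterD' l y hy)).
have spans (c : nat -> R[i]) N : (N <= n.+1)%N ->
    D (\sum_(i < N) c i *: u n i) /\ <|w, iter k F (\sum_(i < N) c i *: u n i)|> = 0.
  elim: N => [_|N IH hN].
    rewrite big_ord0; split; first exact: (uqo0 ho).
    have -> : iter k F 0 = 0 by elim: (k) => //= l ->; exact: (rho0 hheis).
    by rewrite dot0r.
  have [d0 e0] := IH (ltnW hN); have [h1 _ _] := hv N hN.
  rewrite big_ord_recr /= addrC; split; first exact: (uqoP ho).
  by rewrite iterF// dotDr dotZr strings// mulr0 add0r.
have [c hc] : exists c : R[i], eta (hwF m k i j) = c *: iter k F (eta (hw A i j)).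
  elim: (k) => [|l [c hc]]; first by exists 1; rewrite scale1r.
  have /eqP := rhoF_eta hq0 hgns hheis (hwF m l i j).
  rewrite hc (rhoZ hheis)//; last by apply: iterD'; exact: (hdom_eta hgns).
  move/eqP => e; exists ((- q%:C)^-1 * c); rewrite hwFS -scalerA e scalerA mulVf ?scale1r//.
  by rewrite oppr_eq0 (inj_eq (@complexI R) _ 0) gt_eqF.
have [c' hc'] := hs i hi; rewrite /n addKn in hc'.
by rewrite hc dotZr hc'; have [_ ->] := spans c' n.+1 (leqnn _); rewrite mulr0.
Qed.

Lemma heisenberg_basis : orthonormal_basis basis_vec.
Proof.
split.
  move=> p p'; rewrite /basis_vec.
  case: (blockpos p) (blockposP p) => n r [hr ->].
  case: (blockpos p') (blockposP p') => n' r' [hr' ->].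
  rewrite string_vec_orth ?ltn_divLR ?ltn_mod//; congr ((nat_of_bool _)%:R).
  apply/idP/idP.
    move=> /and3P[/eqP en /eqP e1 /eqP e2]; subst n'.
    by rewrite eqn_add2l (divn_eq r n.+1) (divn_eq r' n.+1) e1 e2.
  move=> /eqP e; have := blockposE hr; rewrite e blockposE// => -[<- <-].
  by rewrite !eqxx.
move=> w wo; have hT x : <|eta x, w|> = 0.
  apply: (oq_span_ind hq0 hm (P := fun x => <|eta x, w|> = 0)).
  - by rewrite (eta0 hgns) dot0l.
  - by move=> r y z hy hz; rewrite (eta_linear hgns) dotDl dotZl hy hz mulr0 addr0.
  - by move=> k i j; rewrite dotC orth_hwF// rmorph0.
have orthD v : D v -> <|v, w|> = 0 by move=> /(hdomE hgns)[x ->].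
have [//|w0] := eqVneq w 0.
have nw : 0 < nrm w.
  by rewrite lt_def nrm_ge0 andbT; apply: contra w0 => /eqP/nrm_eq0 ->.
have [||v []] := rep_dense pi_h (O := ball w (nrm w)%:C) _ _.
  - by exists w; apply: ballxx; rewrite ltcR.
  - by apply: ball_open; rewrite ltcR.
rewrite -ball_normE /= nrmE ltcR => hv /orthD e.
have : nrm w ^+ 2 < nrm w ^+ 2.
  rewrite {1}(_ : nrm w ^+ 2 = Re <|w - v, w|>); last by rewrite dotBl e subr0 dotuu.
  rewrite (le_lt_trans (ler_norm _))// (le_lt_trans (Re_le_nrm _))//.
  by rewrite (le_lt_trans (dot_le _ _))// expr2 ltr_pM2r.
by rewrite ltxx.
Qed.

Lemma string_trace n i x : (i < n.+1)%N ->
  \sum_(k < n.+1) Ki_weight q n k ^+ 2 * <|rep pi_h x (f n i k), f n i k|> =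
  (\sum_(k < n.+1) Ki_weight q n k ^+ 2) * h x.
Proof.
move=> hi; have [hw _ _] := hu n; have [h1 h2 h3] := hw i hi.
have n1 := nrm_hw_vector hi.
pose psi0 x := \sum_(k < n.+1) Ki_weight q n k ^+ 2 * <|rep pi_h x (f n i k), f n i k|>.
have fD k : D (f n i k) by exact: (nfstring_dom ho h1).
have psi_lin : linear (psi0 : A -> R[i]^o).
  move=> c y z; rewrite /psi0 scaler_sumr -big_split; apply: eq_bigr => k _ /=.
  rewrite rep_linearl; last exact: fD.
  by rewrite dotDl dotZl mulrDr; congr (_ + _); exact: mulrCA.
pose psi : {linear A -> R[i]} := HB.pack psi0 (GRing.isLinear.Build _ _ _ _ psi0 psi_lin).
have psi1 : psi 1 = \sum_(k < n.+1) Ki_weight q n k ^+ 2.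
  rewrite /psi /= /psi0; apply: eq_bigr => k _; rewrite rep1; last exact: fD.
  rewrite dotuu.
  by rewrite (nrm_nfstring hq0 hq1 ho h1 n1 h2 h3) ?expr1n ?mulr1// -ltnS.
rewrite -psi1 -[LHS]/(psi x).
have pD y : forall v, D v -> [/\ D (rep pi_h y v), D (rep pi_h (act m y (uqK U)) v)
    & D (rep pi_h (act m y (uqF U)) v)].
  by move=> v hv; split; exact: rep_stable.
have pZ y : forall (c : R[i]) v, D v -> rep pi_h y (c *: v) = c *: rep pi_h y v.
  move=> c v hv; have [z ->] := hdomE hgns hv.
  by rewrite -(etaZ hgns) !(rep_eta hgns) -(etaZ hgns) scalerAr.
have pK y v : D v -> rep pi_h y (K v) = K (rep pi_h (act m y (uqK U)) v).
  move=> /(hdomE hgns)[z ->]; pose z' := act m z (uqKi U).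
  have -> : eta z = Ki (eta z') by rewrite (rhoKi_eta hheis) actKiK.
  rewrite (rhoKKi hheis); last exact: (hdom_eta hgns).
  rewrite (rhoKi_eta hheis) !(rep_eta hgns) -actK_mul -(rhoKi_eta hheis).
  by rewrite (rhoKKi hheis)//; exact: (hdom_eta hgns).
have pF y v : D v -> Ki (rep pi_h (act m y (uqF U)) v) =
    rep pi_h y (F v) - F (rep pi_h (act m y (uqK U)) v).
  move=> /(hdomE hgns)[z ->].
  rewrite (rhoF_eta hq0 hgns hheis) -(etaZ hgns) !(rep_eta hgns).
  rewrite (rhoKi_eta hheis) (rhoF_eta hq0 hgns hheis) -(etaZ hgns).
  rewrite actK_mul (actFK hq0) actF_mul actKK.
  rewrite -[X in _ = _ - X]scale1r -scaleNr addrC -(eta_linear hgns); congr eta.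
  by rewrite scaleN1r scaleNr opprK scalerDr -scalerAl -scalerAr scaleNr addrK.
apply: (haar_unique hq0 hq1 hm hh) => y.
  exact: (string_trace_F hq0 hq1 ho h1 n1 h2 h3 (pD y) (pZ y) (pK y) (pF y)).
apply: eq_bigr => k _; congr (_ * _).
exact: (string_trace_K hq0 ho h1 h3 (pD y) (pZ y) (pK y)).
Qed.

End Basis.
End HeisenbergBasis.

(** * The zeta function *)

Section ComplexPower.
Variable R : realType.
Implicit Types (z w : R[i]) (t : R).

Definition cexp w : R[i] := (expR (Re w))%:C * (cos (Im w) +i* sin (Im w)).

Lemma cexpD z w : cexp (z + w) = cexp z * cexp w.
Proof.
rewrite /cexp !raddfD /= expRD cosD sinD; apply/eqP; rewrite eq_complex /=.
by apply/andP; split; apply/eqP; ring.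
Qed.

Lemma cexp_real t : cexp t%:C = (expR t)%:C.
Proof. by rewrite /cexp /= cos0 sin0 complexr0 mulr1. Qed.

Lemma cpowE t w : cpow t w = cexp (w * (ln t)%:C).
Proof.
rewrite /cpow /cexp; case: w => a b /=.
by rewrite !mulr0 subr0 add0r.
Qed.

Lemma nrm_cpow t w : nrm (cpow t w) = expR (Re w * ln t).
Proof.
apply/eqP; rewrite -(@eqrXn2 _ 2) ?nrm_ge0 ?expR_ge0// sqr_nrm /cpow /=.
apply/eqP; move: (Im w * ln t) (expR _) => a x.
rewrite !mul0r subr0 addr0 !exprMn -mulrDr cos2Dsin2; ring.
Qed.

Lemma measurable_Re_cpow w :
  measurable_fun [set: measurableTypeR R]
    (fun t : measurableTypeR R => Re (cpow t w) : measurableTypeR R).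
Proof.
have -> : (fun t : measurableTypeR R => Re (cpow t w)) =
    (fun t : R => expR (Re w * ln t) * cos (Im w * ln t)).
  by apply/funext => t; rewrite /cpow /= mul0r subr0.
apply: measurable_funM.
  apply: measurableT_comp; first exact: measurable_expR.
  apply: measurable_funM => //; exact: measurable_ln.
apply: measurableT_comp; first by apply: continuous_measurable_fun; exact: continuous_cos.
apply: measurable_funM => //; exact: measurable_ln.
Qed.

Lemma measurable_Im_cpow w :
  measurable_fun [set: measurableTypeR R]
    (fun t : measurableTypeR R => Im (cpow t w) : measurableTypeR R).
Proof.
have -> : (fun t : measurableTypeR R => Im (cpow t w)) =
    (fun t : R => expR (Re w * ln t) * sin (Im w * ln t)).
  by apply/funext => t; rewrite /cpow /= mul0r addr0.
apply: measurable_funM.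
  apply: measurableT_comp; first exact: measurable_expR.
  apply: measurable_funM => //; exact: measurable_ln.
apply: measurableT_comp; first by apply: continuous_measurable_fun; exact: continuous_sin.
apply: measurable_funM => //; exact: measurable_ln.
Qed.

End ComplexPower.

Section ZetaTerms.
Variables (R : realType) (q : R) (z : R[i]).
Hypotheses (hq0 : 0 < q) (hq1 : q < 1) (hz : 1 < Re z).

(* The eigenvalue [(n+1)/2]_q^2 of the Casimir element. *)
Definition cas n : R := (q ^- n.+1 + q ^+ n.+1 - 2) / qdiff q 1 ^+ 2.

Definition zeta_term n : R[i] :=
  cpow (cas n) (- z) * (n.+1%:R * qdiff q n.+1 / qdiff q 1)%:C.

Let A n : R := q `^ (- (n%:R / 2)) - q `^ (n%:R / 2).
Let Q := qdiff q 1.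
Let Q0 : 0 < Q := qdiffS_gt0 hq0 hq1 0.

Let A_sqr n : A n ^+ 2 = q ^- n + q ^+ n - 2.
Proof.
have e1 : q `^ (n%:R / 2) ^+ 2 = q ^+ n.
  by rewrite -powR_mulrn ?powR_ge0// -powRrM divfK ?pnatr_eq0// powR_mulrn// ltW.
have p0 : 0 < q `^ (n%:R / 2) by rewrite powR_gt0.
rewrite /A powRN -e1; move: (q `^ _) p0 => x x0; field.
by rewrite gt_eqF.
Qed.

Let A_gt0 n : 0 < A n.+1.
Proof.
have lt1 : q `^ (n.+1%:R / 2) < 1.
  have : q `^ (n.+1%:R / 2) < 1 `^ (n.+1%:R / 2).
    by rewrite gt0_ltr_powR ?nnegrE ?ler01 ?(ltW hq0)// divr_gt0.
  by rewrite powR1.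
by rewrite subr_gt0 powRN (@lt_trans _ _ 1)// invf_gt1 ?powR_gt0.
Qed.

Lemma casE n : cas n = (A n.+1 / Q) ^+ 2.
Proof. by rewrite /cas -A_sqr expr_div_n. Qed.

Lemma cas_gt0 n : 0 < cas n.
Proof. by rewrite casE exprn_gt0// divr_gt0. Qed.

Lemma zeta_termE n : zeta_term n = cpow (q^-1 - q) (2%:R * z - 1) *
  (n.+1%:R * cpow (q `^ (- (n.+1%:R / 2)) - q `^ (n.+1%:R / 2)) (- (2%:R * z))
    * (q ^- n.+1 - q ^+ n.+1)%:C).
Proof.
have QE : q^-1 - q = Q by rewrite /Q /qdiff !expr1.
rewrite QE /zeta_term !cpowE -/(A n.+1) casE.
have -> : ln ((A n.+1 / Q) ^+ 2) = 2 * (ln (A n.+1) - ln Q).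
  by rewrite lnXn ?divr_gt0// ln_div ?posrE// mulr_natl.
have -> : - z * (2 * (ln (A n.+1) - ln Q))%:C =
    - (2%:R * z) * (ln (A n.+1))%:C + ((2%:R * z - 1) * (ln Q)%:C + (ln Q)%:C).
  by rewrite rmorphM rmorphB /= rmorph_nat; ring.
rewrite !cexpD cexp_real lnK ?posrE//.
rewrite -/(qdiff q n.+1) -/Q rmorphM fmorphV rmorphM rmorph_nat /=.
have Q0' : Q%:C != 0 :> R[i] by rewrite (inj_eq (@complexI R) _ 0) gt_eqF.
by field.
Qed.

Let rho : R := expR ((Re z - 1) * ln q).

Let rho01 : 0 < rho < 1.
Proof.
rewrite expR_gt0 /= -[ltRHS]expR0 ltr_expR pmulr_rlt0 ?ln_lt0 ?hq0//.
by rewrite subr_gt0.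
Qed.

Lemma sum_arith_geom_le (r : R) n : 0 <= r < 1 ->
  \sum_(i < n) i.+1%:R * r ^+ i <= (1 - r) ^- 2.
Proof.
move=> /andP[r0 r1]; have p : 0 < 1 - r by rewrite subr_gt0.
have -> : \sum_(i < n) i.+1%:R * r ^+ i =
    (1 - n.+1%:R * r ^+ n + n%:R * r ^+ n.+1) / (1 - r) ^+ 2.
  elim: n => [|n IH]; first by rewrite big_ord0 expr0 mul0r addr0 mulr1 subrr mul0r.
  rewrite big_ord_recr /= IH -!natr1 !exprS; field; by rewrite gt_eqF.
rewrite ler_pdivrMr ?exprn_gt0// mulVf ?expf_neq0 ?gt_eqF//.
rewrite -addrA gerDl addrC subr_le0 exprS mulrA ler_wpM2r ?exprn_ge0//.
by rewrite (@le_trans _ _ n%:R)// ?ler_nat// ler_piMr ?ler0n ?ltW.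
Qed.

Lemma zeta_term_bound : exists M, forall N, \sum_(n < N) nrm (zeta_term n) <= M.
Proof.
pose c0 := ((1 - q) / Q) ^+ 2.
have c0p : 0 < c0 by rewrite exprn_gt0// divr_gt0// subr_gt0.
have low n : c0 * q ^- n.+1 <= cas n.
  have qn0 : 0 < q ^+ n.+1 by rewrite exprn_gt0.
  have qn1 : q ^+ n.+1 <= q by rewrite -[leRHS]expr1 ler_wiXn2l// ltW.
  rewrite /cas /c0 expr_div_n mulrAC ler_wpM2r ?invr_ge0 ?sqr_ge0//.
  move: (q ^+ n.+1) qn0 qn1 => x x0 x1; rewrite ler_pdivrMr//.
  have -> : (x^-1 + x - 2) * x = (1 - x) ^+ 2 by field; rewrite gt_eqF.
  by rewrite ler_sqr ?nnegrE ?subr_ge0 ?lerD2l ?lerN2// ltW// (le_lt_trans x1).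
have z0 : 0 < Re z by rewrite (lt_trans _ hz).
pose C := expR (- Re z * ln c0) / Q * rho.
have C0 : 0 <= C by rewrite mulr_ge0 ?divr_ge0 ?expR_ge0// ltW.
have bnd n : nrm (zeta_term n) <= C * (n.+1%:R * rho ^+ n).
  rewrite /zeta_term nrmM nrm_cpow nrmR ger0_norm; last first.
    by rewrite divr_ge0 ?mulr_ge0 ?ltW// (qdiffS_gt0 hq0 hq1 n).
  have qn0 : 0 < q ^+ n.+1 by rewrite exprn_gt0.
  have h1 : expR (Re (- z) * ln (cas n)) <= expR (- Re z * ln c0) * expR (Re z * ln (q ^+ n.+1)).
    have hl : ln c0 - ln (q ^+ n.+1) <= ln (cas n).
      by rewrite -ln_div ?posrE// ler_ln ?posrE ?cas_gt0// divr_gt0.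
    have := ler_wpM2l (ltW z0) hl.
    by rewrite -expRD ler_expR raddfN /= mulrBr !mulNr; lra.
  have h2 : qdiff q n.+1 <= expR (- ln (q ^+ n.+1)).
    by rewrite expRN lnK ?posrE// /qdiff gerDl oppr_le0 ltW.
  rewrite -[n.+1%:R * _ / _]mulrA.
  have -> : C * (n.+1%:R * rho ^+ n) =
      expR (- Re z * ln c0) * expR (Re z * ln (q ^+ n.+1)) *
      (n.+1%:R * (expR (- ln (q ^+ n.+1)) / Q)).
    transitivity (expR (- Re z * ln c0) / Q * n.+1%:R *
      (expR (Re z * ln (q ^+ n.+1)) * expR (- ln (q ^+ n.+1)))); last by ring.
    rewrite -expRD lnXn// -(mulr_natl (ln q)).
    have -> : Re z * (n.+1%:R * ln q) - n.+1%:R * ln q = n.+1%:R * ((Re z - 1) * ln q) by ring.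
    rewrite expRM_natl -/rho exprS /C; ring.
  apply: ler_pM h1 _; rewrite ?expR_ge0//.
    by rewrite mulr_ge0 ?divr_ge0 ?(ltW Q0) ?(ltW (qdiffS_gt0 hq0 hq1 n)).
  by rewrite ler_wpM2l// ler_wpM2r// invr_ge0 ltW.
exists (C * (1 - rho) ^- 2) => N.
apply: (@le_trans _ _ (\sum_(n < N) C * (n.+1%:R * rho ^+ n))).
  by apply: ler_sum => i _; exact: bnd.
rewrite -mulr_sumr ler_wpM2l// sum_arith_geom_le//.
by case/andP: rho01 => /ltW -> ->.
Qed.

End ZetaTerms.

(** * Closures of operators *)

Section GraphClosure.
Variables (R : realType) (H : hilbertType R).
Implicit Types (S : set (H * H)).

Lemma closure_graphP S p : closure S p <-> forall e : R, 0 < e ->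
  exists s, [/\ S s, nrm (p.1 - s.1) < e & nrm (p.2 - s.2) < e].
Proof.
split=> [hp e e0|hp B /nbhs_ballP[e /gt0C[e0 ee] hB]].
  have [|s [Ss [h1 h2]]] := hp (ball p (e%:C)); first by apply: nbhsx_ballx; rewrite /= ltcR.
  exists s; split => //.
    by move: h1; rewrite -ball_normE /= nrmE ltcR.
  by move: h2; rewrite -ball_normE /= nrmE ltcR.
have [s [Ss h1 h2]] := hp _ e0; exists s; split => //; apply: hB; rewrite ee.
by split; rewrite -ball_normE /= nrmE ltcR.
Qed.

Lemma tends_closure S (u w : nat -> H) v y :
  (forall n, S (u n, w n)) -> tends u v -> tends w y -> closure S (v, y).
Proof.
move=> hS hu hw; apply/closure_graphP => e e0.
have [N hN] := hu e e0; have [M hM] := hw e e0.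
exists (u (maxn N M), w (maxn N M)); split => //=.
  by rewrite nrmBC hN// leq_maxl.
by rewrite nrmBC hM// leq_maxr.
Qed.

Lemma closure_seq S p : closure S p -> exists s : nat -> H * H,
  [/\ forall n, S (s n), tends (fun n => (s n).1) p.1 & tends (fun n => (s n).2) p.2].
Proof.
move=> /closure_graphP h.
have /choice[s hs] n : exists s,
    [/\ S s, nrm (p.1 - s.1) < n.+1%:R^-1 & nrm (p.2 - s.2) < n.+1%:R^-1].
  by apply: h; rewrite invr_gt0.
have hlim (e : R) : 0 < e -> exists N, forall n, (N <= n)%N -> n.+1%:R^-1 < e.
  move=> e0; have [N _ hN] := @near_infty_natSinv_lt R (PosNum e0).
  by exists N => n hn; exact: hN.
exists s; split=> [n||]; first by have [] := hs n.
  by apply: (tends_le hlim) => n; rewrite nrmBC; have [_ /ltW] := hs n.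
by apply: (tends_le hlim) => n; rewrite nrmBC; have [_ _ /ltW] := hs n.
Qed.

(* A relation between coefficients of the two components passes to limits. *)
Lemma closure_coef S (e b : nat -> H) (c : nat -> R[i]) :
  (forall p, S p -> forall i, <|p.2, e i|> = c i * <|p.1, b i|>) ->
  forall p, closure S p -> forall i, <|p.2, e i|> = c i * <|p.1, b i|>.
Proof.
move=> hS p /closure_seq[s [Ss s1 s2]] i.
apply: (tends_uniq (tends_dotl (e i) s2)).
apply: tends_ext (tendsZ (c i) (tends_dotl (b i) s1)) => n.
by rewrite -hS.
Qed.

End GraphClosure.

Section ClosedRepresentation.
Variables (R : realType) (X : starAlgType R) (H : hilbertType R).
Variable pi : starRep X H.

Lemma rep_op_clos x : rep_op pi x `<=` clos_op pi x.
Proof.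
move=> -[u w] [/= hu ->]; split; last by apply: subset_closure.
by move=> y; exists (rep pi y u); apply: subset_closure.
Qed.

Lemma clos_op_closure x : clos_op pi x `<=` closure (rep_op pi x).
Proof. by move=> p []. Qed.

Variable e : nat -> H.
Hypothesis he : orthonormal_basis e.
Hypothesis heD : forall i, rep_dom pi (e i).

Lemma trunc_dom n v : rep_dom pi (trunc e n v).
Proof.
rewrite /trunc; elim: n => [|n IH]; first by rewrite big_ord0; exact: rep_dom0.
by rewrite big_ord_recr /= addrC; exact: rep_domD.
Qed.

Lemma rep0 x : rep pi x 0 = 0.
Proof.
have h0 := rep_dom0 pi.
by have := rep_linear x (-1) h0 h0; rewrite scaler0 addr0 scaleN1r addNr.
Qed.

Lemma rep_trunc x n v : rep pi x (trunc e n v) = \sum_(i < n) <|v, e i|> *: rep pi x (e i).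
Proof.
rewrite /trunc; elim: n => [|n IH]; first by rewrite !big_ord0; exact: rep0.
rewrite !big_ord_recr /= addrC rep_linear// ?IH 1?addrC//.
exact: trunc_dom.
Qed.

Lemma clos_op_coef x (b : nat -> H) (c : nat -> R[i]) :
  (forall v, rep_dom pi v -> forall i, <|rep pi x v, e i|> = c i * <|v, b i|>) ->
  forall p, clos_op pi x p -> forall i, <|p.2, e i|> = c i * <|p.1, b i|>.
Proof.
move=> hx p /clos_op_closure; apply: closure_coef => -[u w] [/= hu ->]; exact: hx.
Qed.

(* A symmetric operator that is diagonal on an orthonormal basis of vectors in
   its domain is essentially self-adjoint. *)
Lemma closure_diag x (c : nat -> R) :
  (forall i, rep pi x (e i) = (c i)%:C *: e i) ->
  (forall u v, rep_dom pi u -> rep_dom pi v -> <|rep pi x u, v|> = <|u, rep pi x v|>) ->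
  closure (clos_op pi x) = diag_graph e (fun i => (c i)%:C).
Proof.
move=> hx sym; apply/seteqP; split=> [p|[v w] hp].
  apply: closure_coef; apply: clos_op_coef => v hv i.
  by rewrite sym// hx dotZr conjR.
apply: (tends_closure _ (trunc_tends he v) (trunc_tends he w)) => n.
apply: rep_op_clos; split; first exact: trunc_dom.
rewrite /= rep_trunc; apply: eq_bigr => i _.
by rewrite hx scalerA (hp i) mulrC.
Qed.

Lemma closure_diag_comp y (b : nat -> H) (g k : nat -> R[i]) (T : {linear H -> H}) M :
  (forall v, rep_dom pi v -> forall i, <|rep pi y v, e i|> = k i * <|v, b i|>) ->
  (forall v i, <|T v, e i|> = g i * k i * <|v, b i|>) -> opbound T M ->
  closure (op_comp (diag_graph e g) (clos_op pi y)) = graph_of T.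
Proof.
move=> hy hT Tb; apply/seteqP; split=> [p hp|[v w] hw].
  apply: (coef_inj he) => i; rewrite hT; move: p hp i; apply: closure_coef.
  move=> [u w] [v [/(clos_op_coef hy) hv hw]] i /=.
  by rewrite (hw i) /= (hv i) mulrA.
have {hw}-> : w = T v := hw.
apply: (tends_closure _ (trunc_tends he v) (opbound_tends Tb (trunc_tends he v))) => n.
exists (rep pi y (trunc e n v)); split.
  by apply: rep_op_clos; split => //=; exact: trunc_dom.
by move=> i /=; rewrite hT hy ?mulrA//; exact: trunc_dom.
Qed.

End ClosedRepresentation.

(** * The trace formula *)

Lemma sum_levels (V : nmodType) (f : nat -> nat -> nat -> V) N :
  \sum_(p < blockstart N) f (blockpos p).1 ((blockpos p).2 %/ (blockpos p).1.+1)%N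
      ((blockpos p).2 %% (blockpos p).1.+1)%N =
  \sum_(n < N) \sum_(i < n.+1) \sum_(k < n.+1) f n i k.
Proof.
rewrite (sum_blocks (fun n r => f n (r %/ n.+1)%N (r %% n.+1)%N)).
by apply: eq_bigr => n _; rewrite (sum_square (f n)).
Qed.

Section KiWeight.
Variables (R : realType) (q : R).
Hypotheses (hq0 : 0 < q) (hq1 : q < 1).

Lemma Ki_weight_sqr n k : Ki_weight q n k ^+ 2 = (q ^- n * q ^+ k.*2)%:C.
Proof.
rewrite /Ki_weight exprMn exprVn -!exprM !(mulnC _ 2) !exprM sqrtq_sqr//.
by rewrite rmorphM fmorphV !rmorphXn.
Qed.

Lemma sum_Ki_weight_real n :
  \sum_(k < n.+1) q ^- n * q ^+ k.*2 = qdiff q n.+1 / qdiff q 1.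
Proof.
have Q0 := gt_eqF (qdiffS_gt0 hq0 hq1 0); have q0 := gt_eqF hq0.
rewrite -mulr_sumr; apply: (canRL (mulfK _)); rewrite ?Q0//.
suff -> : \sum_(k < n.+1) q ^+ k.*2 = q ^+ n * qdiff q n.+1 / qdiff q 1.
  by field; rewrite Q0 expf_neq0// q0.
elim: n => [|n IH].
  by rewrite big_ord_recr big_ord0 /= add0r expr0 mul1r divff ?Q0.
rewrite big_ord_recr IH; apply: (canRL (mulfK _)); rewrite ?Q0//=.
rewrite mulrDl divfK ?Q0// /qdiff -addnn exprD !exprS expr0 mulr1.
by field; rewrite ?expf_neq0 ?q0.
Qed.

Lemma sum_Ki_weight n :
  \sum_(k < n.+1) Ki_weight q n k ^+ 2 = (qdiff q n.+1 / qdiff q 1)%:C.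
Proof.
rewrite -sum_Ki_weight_real rmorph_sum; apply: eq_bigr => k _; exact: Ki_weight_sqr.
Qed.

Lemma sum_nrm_Ki_weight n :
  \sum_(k < n.+1) nrm (Ki_weight q n k ^+ 2) = qdiff q n.+1 / qdiff q 1.
Proof.
rewrite -sum_Ki_weight_real; apply: eq_bigr => k _.
by rewrite Ki_weight_sqr nrmR ger0_norm// mulr_ge0 ?invr_ge0 ?exprn_ge0 ?ltW.
Qed.

End KiWeight.

Section TraceFormula.
Variables (R : realType) (q : R).
Hypotheses (hq0 : 0 < q) (hq1 : q < 1).
Variables (U : uqSU2 q) (A : oqSU2 q) (m : modStarAlg (uq_hopf U) A).
Hypothesis hm : is_suq2_action m.
Variable h : {linear A -> R[i]}.
Hypothesis hh : is_haar m h.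
Variables (X : crossProduct m) (H : hilbertType R).
Variables (pi_h : starRep A H) (v_h : H).
Hypothesis hgns : is_gns pi_h h v_h.
Variable pi_t : starRep X H.
Hypothesis hheis : is_heisenberg pi_h v_h pi_t.
Variable u : nat -> nat -> H.
Hypothesis hu : forall n,
  [/\ forall i, (i < n.+1)%N -> hw_vector pi_h pi_t n (u n i),
      forall i, (i < n.+1)%N -> inspan n.+1 (u n) (eta pi_h v_h (hw A i (n - i)))
    & forall i j, (i < n.+1)%N -> (j < n.+1)%N -> <|u n i, u n j|> = (i == j)%:R].

Local Notation rho := (rho pi_t).
Local Notation D := (hdom pi_h).
Local Notation e := (basis_vec pi_t u).
Let ho := heisenberg_uq_operators hq0 hheis.
Let he : orthonormal_basis e := heisenberg_basis hq0 hq1 hm hgns hheis hu.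
Let De p : D (e p) := basis_vec_dom hq0 hheis hu p.

Let level p := (blockpos p).1.
Let weight p := Ki_weight q (level p) ((blockpos p).2 %% (level p).+1)%N ^+ 2.

Lemma casimir_basis_vec p : rho (casimir U) (e p) = (cas q (level p))%:C *: e p.
Proof.
rewrite (rho_casimir hheis (De p)) /level /basis_vec.
case: (blockpos p) (blockposP p) => n r [hr _].
have [hw _ _] := hu n; have hi : (r %/ n.+1 < n.+1)%N by rewrite ltn_divLR.
have [h1 h2 h3] := hw _ hi.
have hk : (r %% n.+1 <= n)%N by rewrite -ltnS ltn_mod.
exact: (casimir_nfstring hq0 hq1 ho h1 (nrm_hw_vector hu hi) h2 h3 hk).
Qed.

Lemma Ki2_basis_vec p : rho (uqKi U ^+ 2) (e p) = weight p *: e p.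
Proof.
rewrite expr2 (rhoM hheis _ _ (De p)) /weight /level.
have Ki1 : rho (uqKi U) (e p) =
    Ki_weight q (level p) ((blockpos p).2 %% (level p).+1)%N *: e p.
  rewrite /level /basis_vec; case: (blockpos p) (blockposP p) => n r [hr _].
  have [hw _ _] := hu n; have hi : (r %/ n.+1 < n.+1)%N by rewrite ltn_divLR.
  have [h1 _ h3] := hw _ hi.
  exact: (Ki_nfstring hq0 ho h1 h3).
by rewrite Ki1 (rhoZ hheis _ _ (De p)) Ki1 scalerA.
Qed.

Lemma casimir_sym v w : D v -> D w -> <|rho (casimir U) v, w|> = <|v, rho (casimir U) w|>.
Proof.
by move=> hv hw; rewrite !(rho_casimir hheis)//; exact: (casimir_op_sym ho hv hw).
Qed.

Variable x : A.

Lemma Ki2_rep_coef v p : D v ->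
  <|rep pi_t (inU X (uqKi U ^+ 2) * inA X x) v, e p|> = weight p * <|v, rep pi_h (star x) (e p)|>.
Proof.
move=> hv; have [dt hA _] := hheis.
rewrite repM ?dt// hA// -/(rho _ _); have Dx : D (rep pi_h x v) by exact: rep_stable.
have Ki_adj := rhoK_adj hheis (f := uqKi U) (or_intror erefl).
have DKi y : D y -> D (rho (uqKi U) y) by move=> Dy; exact: (hdom_rho hheis).
rewrite expr2 (rhoM hheis)// Ki_adj//; last exact: DKi.
rewrite Ki_adj//; last exact: DKi.
rewrite -(rhoM hheis)// -expr2 Ki2_basis_vec dotZr rep_adj//; last exact: De.
by rewrite /weight Ki_weight_sqr// conjR.
Qed.

Variable z : R[i].
Hypothesis hz : 1 < Re z.

Let d p := cpow (cas q (level p)) (- z) * weight p.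

Lemma nrm_trace_weights N :
  \sum_(p < blockstart N) nrm (d p) = \sum_(n < N) nrm (zeta_term q z n).
Proof.
rewrite /d /weight /level.
under eq_bigr do rewrite nrmM.
rewrite (sum_levels (fun n _ k => nrm (cpow (cas q n) (- z)) * nrm (Ki_weight q n k ^+ 2))).
apply: eq_bigr => n _; rewrite sumr_const card_ord -mulr_sumr sum_nrm_Ki_weight//.
rewrite /zeta_term nrmM nrmR ger0_norm.
  by rewrite -mulr_natl; ring.
by rewrite divr_ge0 ?mulr_ge0 ?ltW// ?(qdiffS_gt0 hq0 hq1 0) ?(qdiffS_gt0 hq0 hq1 n).
Qed.

Lemma trace_weights_summable : exists M, forall N, \sum_(p < N) nrm (d p) <= M.
Proof.
have [M hM] := zeta_term_bound hq0 hq1 hz; exists M => N.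
apply: le_trans (hM N); rewrite -nrm_trace_weights -!(big_mkord xpredT (fun p => nrm (d p))).
rewrite (big_cat_nat (leq0n N) (leq_blockstart N)) /= lerDl.
by apply: sumr_ge0 => p _; exact: nrm_ge0.
Qed.

Lemma trace_levels N :
  \sum_(p < blockstart N) d p * <|e p, rep pi_h (star x) (e p)|> =
  (\sum_(n < N) zeta_term q z n) * h x.
Proof.
pose F n i k := cpow (cas q n) (- z) * (Ki_weight q n k ^+ 2 *
  <|rep pi_h x (string_vec pi_t u n i k), string_vec pi_t u n i k|>).
transitivity (\sum_(p < blockstart N) F (blockpos p).1 ((blockpos p).2 %/ (blockpos p).1.+1)%N
  ((blockpos p).2 %% (blockpos p).1.+1)%N).
  apply: eq_bigr => p _; rewrite /d /weight /level -rep_adj//; try exact: De.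
  by rewrite /basis_vec; case: (blockpos p) => n r /=; rewrite /F mulrA.
rewrite (sum_levels F) mulr_suml; apply: eq_bigr => n _.
transitivity (\sum_(i < n.+1) cpow (cas q n) (- z) * ((qdiff q n.+1 / qdiff q 1)%:C * h x)).
  apply: eq_bigr => i _; rewrite -mulr_sumr; congr (_ * _).
  by rewrite (string_trace hq0 hq1 hm hh hgns hheis hu)// sum_Ki_weight.
rewrite sumr_const card_ord /zeta_term -[_ *+ _]mulr_natl -[n.+1%:R * qdiff _ _ / _]mulrA.
by rewrite [(n.+1%:R * _)%:C]rmorphM rmorph_nat /=; ring.
Qed.

Lemma zeta_tends : tends (fun N => \sum_(n < N) zeta_term q z n) (zeta q z).
Proof.
have [M hM] := zeta_term_bound hq0 hq1 hz.
have [L hL] := abs_summable he hM.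
rewrite /zeta; set P := cpow _ (2%:R * z - 1).
have P0 : P != 0.
  apply/eqP => P0; have := nrm_cpow (q^-1 - q) (2%:R * z - 1).
  by rewrite -/P P0 nrm0 => /eqP; rewrite eq_sym gt_eqF ?expR_gt0.
rewrite (sum_from1_has_sum (l := P^-1 * L)) ?mulVKf//.
apply/has_sum_tends; apply: tends_ext (tendsZ P^-1 hL) => N.
rewrite mulr_sumr; apply: eq_bigr => n _.
by rewrite (zeta_termE z hq0 hq1) -/P mulKf.
Qed.

Lemma heisenberg_trace :
  let C := closure (clos_op pi_t (inU X (casimir U))) in
  let Cz := fun_calc C (fun t => cpow t (- z)) in
  let T := closure (op_comp Cz (clos_op pi_t (inU X (uqKi U ^+ 2) * inA X x))) in
  trace_class T /\ is_trace T (zeta q z * h x).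
Proof.
have [dt hA _] := hheis.
have Dt p : rep_dom pi_t (e p) by rewrite dt; exact: De.
move=> C Cz T.
have CE : C = diag_graph e (fun p => (cas q (level p))%:C).
  apply: (closure_diag he Dt) => [p|v w]; first exact: casimir_basis_vec.
  by rewrite dt; exact: casimir_sym.
have CzE : Cz = diag_graph e (fun p => cpow (cas q (level p)) (- z)).
  by rewrite /Cz CE fun_calc_diag//; [exact: measurable_Re_cpow|exact: measurable_Im_cpow].
pose b p := rep pi_h (star x) (e p).
have [M hM hMx] := rep_bounded hq0 pi_h (star x).
have bM p : nrm (b p) <= M.
  by apply: le_trans (hMx _ (De p)) _; rewrite nrm_basis// mulr1.
have [B hB] := trace_weights_summable.
have [S hS Sb] := nuclear_exists he hB bM.
have TE : T = graph_of S.
  rewrite /T CzE; apply: (closure_diag_comp he Dt _ hS Sb) => v; rewrite dt => Dv p.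
  exact: Ki2_rep_coef.
rewrite TE; split; first exact: (nuclear_trace_class he hB bM hS).
exists S => //; apply: (nuclear_trace he hB bM hS).
have [|L hL] := abs_summable he (c := fun p => d p * <|e p, b p|>) (M := B * M).
  move=> n; apply: le_trans (_ : (\sum_(p < n) nrm (d p)) * M <= _); last by rewrite ler_wpM2r.
  rewrite mulr_suml; apply: ler_sum => p _; rewrite nrmM ler_wpM2l ?nrm_ge0//.
  by apply: le_trans (dot_le _ _) _; rewrite nrm_basis// mul1r.
suff <- : L = zeta q z * h x by [].
apply: (tends_uniq (tends_sub leq_blockstart hL)).
have := tendsZ (h x) zeta_tends; rewrite mulrC; apply: tends_ext => N.
by rewrite trace_levels mulrC.
Qed.

End TraceFormula.

Theorem theorem5p7 (R : realType) (q : R) (hq0 : 0 < q) (hq1 : q < 1)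
    (U : uqSU2 q) (A : oqSU2 q) (m : modStarAlg (uq_hopf U) A)
    (hm : is_suq2_action m)
    (h : {linear A -> R[i]}) (hh : is_haar m h)
    (X : crossProduct m)
    (H : hilbertType R) (pi_h : starRep A H) (v_h : H)
    (hgns : is_gns pi_h h v_h)
    (pi_t : starRep X H) (hheis : is_heisenberg pi_h v_h pi_t)
    (z : R[i]) (hz : 1 < complex.Re z) (x : A) :
  let C := closure (clos_op pi_t (inU X (casimir U))) in
  let Cz := fun_calc C (fun t => cpow t (- z)) in
  let T := closure (op_comp Cz (clos_op pi_t (inU X (uqKi U ^+ 2) * inA X x))) in
  trace_class T /\
  exists2 tr : R[i], is_trace T tr &
    tr = zeta q z * h x /\ (zeta q z != 0 -> h x = (zeta q z)^-1 * tr).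
Proof.
have [u hu] := hw_basis_exists hq0 hq1 hm hh hgns hheis.
have [h1 h2] := heisenberg_trace hq0 hq1 hm hh hgns hheis hu x hz.
move=> C Cz T; split=> //; exists (zeta q z * h x) => //; split=> // z0.
by rewrite mulKf.
Qed.
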